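(* Let $\mathcal{J}$ be an arbitrary ideal of $\mathcal{L}$. (i) If $\mathcal{J}$ is a Hopf ideal, then $\mathcal{L}_{\mathcal{J}}$ is a Hopf dual algebra (with the canonical comultiplication). (ii) If $\mathcal{J}$ is homogeneous and $\mathcal{L}_{\mathcal{J}}$ is a Hopf dual algebra (with the canonical comultiplication), then $\mathcal{J}$ is a Hopf ideal.
   Context: Let $d$ be a fixed positive integer, $\mathbb{F}_d^*$ the unital free semigroup on $\{1,\dots,d\}$ with identity $\varnothing$. Let $\ell^2(\mathbb{F}_d^* )$ have orthonormal basis $\{\xi_w\}$ and put $L_u\xi_w=\xi_{uw}$. $\mathcal{L}=\mathcal{L}_d$ is the unital weak-operator-closed (WOT-closed) algebra generated by $\{L_u\}$. An ideal means a WOT-closed two-sided ideal; it is homogeneous if generated by homogeneous polynomials in $L_1,\dots,L_d$. For an ideal $\mathcal{J}$ put $\mathcal{N}_{\mathcal{J}}=(\mathcal{J}\xi_\varnothing)^\perp$, $\mathcal{L}_{\mathcal{J}}=P_{\mathcal{N}_{\mathcal{J}}}\mathcal{L}|_{\mathcal{N}_{\mathcal{J}}}$ (a dual operator algebra, completely isometrically isomorphic and weak*-homeomorphic to $\mathcal{L}/\mathcal{J}$), and let $\pi_{\mathcal{J}}:\mathcal{L}\to\mathcal{L}_{\mathcal{J}}$, $\pi_{\mathcal{J}}(A)=P_{\mathcal{N}_{\mathcal{J}}}A|_{\mathcal{N}_{\mathcal{J}}}$, be the compression homomorphism. A dual operator algebra $\mathcal{A}$ (a unital weak*-closed algebra of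 operators on a Hilbert space) is a Hopf dual algebra if there is a comultiplication $\Delta_{\mathcal{A}}:\mathcal{A}\to\mathcal{A}\overline\otimes\mathcal{A}$, i.e. a unital weak*-continuous completely contractive homomorphism with $(\mathrm{id}\otimes\Delta_{\mathcal{A}})\Delta_{\mathcal{A}}=(\Delta_{\mathcal{A}}\otimes\mathrm{id})\Delta_{\mathcal{A}}$, where $\overline\otimes$ is the normal tensor product. $\mathcal{L}$ is a Hopf dual algebra with $\Delta_{\mathcal{L}}(L_w)=L_w\otimes L_w$ ($w\in\mathbb{F}_d^*$). The canonical comultiplication $\Delta$ on $\mathcal{L}_{\mathcal{J}}$ is the one (if it exists) satisfying $\Delta\circ\pi_{\mathcal{J}}=(\pi_{\mathcal{J}}\otimes\pi_{\mathcal{J}})\circ\Delta_{\mathcal{L}}$, where $\pi_{\mathcal{J}}\otimes\pi_{\mathcal{J}}$ denotes the weak*-continuous extension $\mathcal{L}\overline\otimes\mathcal{L}\to\mathcal{L}_{\mathcal{J}}\overline\otimes\mathcal{L}_{\mathcal{J}}$. An ideal $\mathcal{J}$ of $\mathcal{L}$ is a Hopf ideal if it is also a coideal, i.e. $\Delta_{\mathcal{L}}(\mathcal{J})\subseteq\overline{\mathcal{J}\otimes\mathcal{L}+\mathcal{L}\otimes\mathcal{J}}^{w^*}$. *)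

(* Defs.v *)
From HB Require Import structures.
From mathcomp Require Import all_boot all_order all_algebra.
From mathcomp Require Import all_classical all_reals all_analysis.
From mathcomp Require Import complex ring lra.
Set Implicit Arguments.
Unset Strict Implicit.
Unset Printing Implicit Defensive.
Import Order.TTheory GRing.Theory Num.Theory numFieldNormedType.Exports.
Import ComplexField.
Local Open Scope classical_set_scope.
Local Open Scope ring_scope.

Section ell2.
Context {R : realType}.
Implicit Types (X Y Z : choiceType).

Definition sqsum X (h : X -> R[i]) : \bar R :=
  \esum_(x in [set: X]) (Normc.normc (h x) ^+ 2)%:E.

Lemma sqsum_ge0 X (h : X -> R[i]) : (0 <= sqsum h)%E.
Proof. by apply: esum_ge0 => x _; rewrite lee_fin sqr_ge0. Qed.

Lemma esumZ_le X (c : R) (a : X -> \bar R) : 0 <= c ->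
  (forall x, (0 <= a x)%E) ->
  (\esum_(x in [set: X]) (c%:E * a x) <= c%:E * \esum_(x in [set: X]) a x)%E.
Proof.
move=> c0 a0; apply: ge_ereal_sup => _ [A [finA _] <-].
rewrite -ge0_mule_fsumr//; apply: lee_wpmul2l; first by rewrite lee_fin.
by apply: ereal_sup_ubound; exists A.
Qed.

Lemma sqsum0 X : sqsum (0 : X -> R[i]) = 0%E.
Proof. by rewrite /sqsum esum1 // => x _; rewrite (_ : Normc.normc _ = 0) ?expr0n //; exact: Normc.normc0. Qed.

Lemma sqsumZ_le X (c : R[i]) (f : X -> R[i]) :
  (sqsum (c *: f)%R <= (Normc.normc c ^+ 2)%:E * sqsum f)%E.
Proof.
apply: le_trans (esumZ_le _ _); last 2 first.
- exact: sqr_ge0.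
- by move=> x; rewrite lee_fin sqr_ge0.
by apply: le_esum => x _; rewrite -EFinM lee_fin -exprMn -Normc.normcM.
Qed.

Lemma sqsumD_le X (f g : X -> R[i]) :
  (sqsum (f + g)%R <= 2%:E * (sqsum f + sqsum g))%E.
Proof.
rewrite /sqsum -esumD; try by move=> x _; rewrite lee_fin sqr_ge0.
apply: le_trans (esumZ_le _ _) => //; last first.
  by move=> x; rewrite adde_ge0// lee_fin sqr_ge0.
apply: le_esum => x _; rewrite -EFinD -EFinM lee_fin.
have : Normc.normc (f x + g x) <= Normc.normc (f x) + Normc.normc (g x).
  exact: (@le_normcD R (f x) (g x)).
have n0 (z : R[i]) : 0 <= Normc.normc z by case: z => u v; exact: sqrtr_ge0.
move=> h; apply: (@le_trans _ _ ((Normc.normc (f x) + Normc.normc (g x)) ^+ 2)).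
  by rewrite lerXn2r // nnegrE ?addr_ge0.
rewrite -subr_ge0; set a := Normc.normc (f x); set b := Normc.normc (g x).
have -> : 2 * (a ^+ 2 + b ^+ 2) - (a + b) ^+ 2 = (a - b) ^+ 2.
  by rewrite sqrrD sqrrB !mulr2n mulrDl !mul1r; ring.
exact: sqr_ge0.
Qed.

Definition l2_pred X : {pred X -> R[i]} := fun h => (sqsum h < +oo)%E.

Lemma l2_submod X : submod_closed (@l2_pred X).
Proof.
split=> [|c f g fl gl].
  by rewrite /l2_pred unfold_in sqsum0.
rewrite unfold_in /l2_pred.
apply: (le_lt_trans (sqsumD_le _ _)); apply: lte_mul_pinfty => //.
rewrite lte_add_pinfty //; apply: (le_lt_trans (sqsumZ_le _ _)).
by apply: lte_mul_pinfty => //; rewrite lee_fin sqr_ge0.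
Qed.

HB.instance Definition _ X :=
  GRing.isSubmodClosed.Build R[i] (X -> R[i]) (@l2_pred X) (@l2_submod X).


Record l2 X := L2 { l2_fun :> X -> R[i]; _ : l2_fun \in @l2_pred X }.
HB.instance Definition _ X := [isSub for @l2_fun X].
HB.instance Definition _ X := [Choice of l2 X by <:].
HB.instance Definition _ X := [SubChoice_isSubLmodule of l2 X by <:].

Definition l2norm X (f : l2 X) : R := Num.sqrt (fine (sqsum f)).

(* Sums of absolutely summable families of real and complex numbers. *)
Definition rsum X (h : X -> R) : R :=
  fine (\esum_(x in [set: X]) (Num.max (h x) 0)%:E)
  - fine (\esum_(x in [set: X]) (Num.max (- h x) 0)%:E).

Definition csum X (h : X -> R[i]) : R[i] :=
  Complex (rsum (fun x => complex.Re (h x))) (rsum (fun x => complex.Im (h x))).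

Definition ip X (f g : l2 X) : R[i] := csum (fun x => f x * (g x)^*%C).

Lemma l2_ext X (f g : l2 X) : (forall x, f x = g x) -> f = g.
Proof. by move=> fg; apply: val_inj; apply/funext. Qed.

Lemma sqsum_fin X (f : l2 X) : (sqsum f < +oo)%E.
Proof. by case: f. Qed.

Lemma l2norm_ge0 X (f : l2 X) : 0 <= l2norm f.
Proof. exact: sqrtr_ge0. Qed.

Lemma l2normE X (f : l2 X) : ((l2norm f ^+ 2)%:E = sqsum f)%E.
Proof.
rewrite /l2norm sqr_sqrtr ?fine_ge0 ?sqsum_ge0// fineK//.
by rewrite ge0_fin_numE ?sqsum_ge0// sqsum_fin.
Qed.

Lemma l2norm_leP X Y (f : l2 X) (g : l2 Y) (M : R) : 0 <= M ->
  l2norm f <= M * l2norm g <-> (sqsum f <= (M ^+ 2)%:E * sqsum g)%E.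
Proof.
move=> M0; rewrite -!l2normE -EFinM lee_fin -exprMn.
by rewrite ler_sqr // nnegrE ?mulr_ge0 ?l2norm_ge0.
Qed.

(* Bounded linear maps l2 X -> l2 Y. *)
Definition bounded_pred X Y : {pred l2 X -> l2 Y} := fun T =>
  `[< linear T /\ exists2 M : R, 0 <= M & forall f, l2norm (T f) <= M * l2norm f >].

Lemma bounded_submod X Y : submod_closed (@bounded_pred X Y).
Proof.
split=> [|c S T /asboolP [linS [M M0 SM]] /asboolP [linT [N N0 TN]]].
  apply/asboolP; split=> [a f g|]; first by rewrite /= scaler0 addr0.
  exists 0 => // f; apply/l2norm_leP => //.
  by rewrite (_ : val _ = 0 :> (Y -> R[i])) // sqsum0 expr0n /= mul0e.
apply/asboolP; split=> [a f g|].
  rewrite /= !fctE linS linT !scalerDr !scalerA (mulrC c) -!addrA.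
  by congr (_ + _); rewrite addrCA.
pose A := Normc.normc c ^+ 2 * M ^+ 2 + N ^+ 2.
have A0 : 0 <= A by apply: addr_ge0; [apply: mulr_ge0|]; exact: sqr_ge0.
exists (Num.sqrt (2 * A)) => // f; apply/l2norm_leP => //.
rewrite sqr_sqrtr ?mulr_ge0 //.
apply: (le_trans (sqsumD_le _ _)); rewrite EFinM -muleA.
apply: lee_wpmul2l; first by rewrite lee_fin.
rewrite EFinD ge0_muleDl ?lee_fin ?sqr_ge0 //; last exact: mulr_ge0 (sqr_ge0 _) (sqr_ge0 _). apply: leeD.
  apply: (le_trans (sqsumZ_le _ _)); rewrite [X in (_ <= X * _)%E]EFinM -[leRHS]muleA.
  by apply: lee_wpmul2l; [rewrite lee_fin sqr_ge0 | apply/l2norm_leP].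
exact/l2norm_leP.
Qed.

HB.instance Definition _ X Y :=
  GRing.isSubmodClosed.Build R[i] (l2 X -> l2 Y) (@bounded_pred X Y)
    (@bounded_submod X Y).

Record bop X Y := Bop { bop_fun :> l2 X -> l2 Y; _ : bop_fun \in @bounded_pred X Y }.
HB.instance Definition _ X Y := [isSub for @bop_fun X Y].
HB.instance Definition _ X Y := [Choice of bop X Y by <:].
HB.instance Definition _ X Y := [SubChoice_isSubLmodule of bop X Y by <:].

Lemma bop_linear X Y (T : bop X Y) : linear T.
Proof. by case: T => T /= /asboolP []. Qed.

Lemma bop_bounded X Y (T : bop X Y) :
  exists2 M : R, 0 <= M & forall f, l2norm (T f) <= M * l2norm f.
Proof. by case: T => T /= /asboolP []. Qed.

Lemma bop_ext X Y (S T : bop X Y) : (forall f, S f = T f) -> S = T.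
Proof. by move=> ST; apply: val_inj; apply/funext. Qed.

Lemma id_bounded X : (@idfun (l2 X)) \in @bounded_pred X X.
Proof.
by apply/asboolP; split=> //; exists 1 => // f; rewrite mul1r.
Qed.
Definition bid X : bop X X := Bop (@id_bounded X).

Lemma comp_bounded X Y Z (S : bop Y Z) (T : bop X Y) :
  (S \o T) \in @bounded_pred X Z.
Proof.
apply/asboolP; split=> [a f g|]; first by rewrite /= !bop_linear.
have [M M0 SM] := bop_bounded S; have [N N0 TN] := bop_bounded T.
exists (M * N) => [|f]; first exact: mulr_ge0.
by apply: (le_trans (SM _)); rewrite -mulrA ler_wpM2l.
Qed.
Definition bcomp X Y Z (S : bop Y Z) (T : bop X Y) : bop X Z :=
  Bop (comp_bounded S T).

(* The operator f |-> f \o h, for an injection h. *)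
Lemma reindex_l2 X Y (h : Y -> X) (hI : injective h) (f : l2 X) :
  (sqsum (f \o h) <= sqsum f)%E.
Proof.
rewrite /sqsum -(@esum_image _ _ _ [set: Y] h
  (fun x => (Normc.normc (f x) ^+ 2)%:E)); last by move=> x y _ _; exact: hI.
rewrite esum_mkcond; apply: le_esum => x _; case: ifP => // _.
by rewrite lee_fin sqr_ge0.
Qed.

Lemma reindex_pred X Y (h : Y -> X) (hI : injective h) (f : l2 X) :
  (f \o h) \in @l2_pred Y.
Proof. by rewrite unfold_in; apply: le_lt_trans (sqsum_fin f); exact: reindex_l2. Qed.

Lemma reindex_bounded X Y (h : Y -> X) (hI : injective h) :
  (fun f => L2 (reindex_pred hI f)) \in @bounded_pred X Y.
Proof.
apply/asboolP; split=> [a f g|]; first exact: l2_ext.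
by exists 1 => // f; apply/l2norm_leP; rewrite // expr1n mul1e; exact: reindex_l2.
Qed.
Definition reindex X Y (h : Y -> X) (hI : injective h) : bop X Y :=
  Bop (reindex_bounded hI).

(* The unitaries implementing X * Y = Y * X and X * (Y * Z) = (X * Y) * Z. *)
Definition swap X Y (p : X * Y) : Y * X := (p.2, p.1).
Definition unassoc X Y Z (p : (X * Y) * Z) : X * (Y * Z) :=
  (p.1.1, (p.1.2, p.2)).

Lemma swap_inj X Y : injective (@swap X Y).
Proof. by move=> [? ?] [? ?] [-> ->]. Qed.
Lemma unassoc_inj X Y Z : injective (@unassoc X Y Z).
Proof. by move=> [[? ?] ?] [[? ?] ?] [-> -> ->]. Qed.

Definition bswap X Y : bop (Y * X)%type (X * Y)%type := reindex (@swap_inj X Y).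
Definition bassoc X Y Z : bop (X * (Y * Z))%type ((X * Y) * Z)%type :=
  reindex (@unassoc_inj X Y Z).

Definition slice X Y (f : l2 (X * Y)%type) (x : X) : l2 Y :=
  reindex (fun y y' (e : (x, y) = (x, y')) => congr1 snd e) f.

Lemma sqsum_slice X Y (h : X * Y -> R[i]) :
  sqsum h = \esum_(x in [set: X]) sqsum (fun y => h (x, y)).
Proof.
rewrite /sqsum esum_esum; last by move=> *; rewrite lee_fin sqr_ge0.
rewrite (_ : [set: X] `*`` _ = setT); last by apply/seteqP; split.
by apply: eq_esum => -[].
Qed.

(* The operator I (x) T, acting as T on each slice. *)
Lemma amp_le X Y Z (T : bop Y Z) (M : R) :
  0 <= M -> (forall f, l2norm (T f) <= M * l2norm f) ->
  forall f : l2 (X * Y)%type,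
  (sqsum (fun p : X * Z => T (slice f p.1) p.2) <= (M ^+ 2)%:E * sqsum f)%E.
Proof.
move=> M0 TM f; rewrite !sqsum_slice.
apply: le_trans (esumZ_le _ _); rewrite ?sqr_ge0//; last first.
  by move=> x; exact: sqsum_ge0.
apply: le_esum => x _.
by have /l2norm_leP := TM (slice f x); exact.
Qed.

Lemma amp_pred X Y Z (T : bop Y Z) (f : l2 (X * Y)%type) :
  (fun p : X * Z => T (slice f p.1) p.2) \in @l2_pred (X * Z)%type.
Proof.
have [M M0 TM] := bop_bounded T; rewrite unfold_in.
apply: (le_lt_trans (amp_le M0 TM f)).
by apply: lte_mul_pinfty; rewrite ?lee_fin ?sqr_ge0// sqsum_fin.
Qed.

Lemma amp_bounded X Y Z (T : bop Y Z) :
  (fun f => L2 (amp_pred T f)) \in @bounded_pred (X * Y)%type (X * Z)%type.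
Proof.
have [M M0 TM] := bop_bounded T; apply/asboolP; split=> [a f g|].
  by apply: l2_ext => -[x z] /=; rewrite /slice !bop_linear.
by exists M => // f; apply/l2norm_leP => //; exact: amp_le.
Qed.
Definition amp X Y Z (T : bop Y Z) : bop (X * Y)%type (X * Z)%type :=
  Bop (amp_bounded X T).

Definition tens X Y X' Y' (S : bop X X') (T : bop Y Y') :
    bop (X * Y)%type (X' * Y')%type :=
  bcomp (bswap X' Y') (bcomp (amp Y' S) (bcomp (bswap Y' X) (amp X T))).

(* Elementary tensors; on them tens S T acts as S (x) T. *)
Lemma tensv_pred X Y (f : l2 X) (g : l2 Y) :
  (fun p : X * Y => f p.1 * g p.2) \in @l2_pred (X * Y)%type.
Proof.
rewrite unfold_in /l2_pred sqsum_slice.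
have le x : (sqsum (fun y => f x * g y)%R <=
             (l2norm g ^+ 2)%:E * (Normc.normc (f x) ^+ 2)%:E)%E.
  by rewrite muleC l2normE; exact: (sqsumZ_le (f x) g).
apply: (le_lt_trans (le_esum (fun x _ => le x))).
apply: (le_lt_trans (esumZ_le _ _)); rewrite ?sqr_ge0//.
  by move=> x; rewrite lee_fin sqr_ge0.
by apply: lte_mul_pinfty; rewrite ?lee_fin ?sqr_ge0//; exact: sqsum_fin.
Qed.
Definition tensv X Y (f : l2 X) (g : l2 Y) : l2 (X * Y)%type :=
  L2 (tensv_pred f g).

Lemma tensE X Y X' Y' (S : bop X X') (T : bop Y Y') (f : l2 X) (g : l2 Y) :
  tens S T (tensv f g) = tensv (S f) (T g).
Proof.
have bopZ U V (A : bop U V) c h : A (c *: h) = c *: A h.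
  have A0 : A 0 = 0.
    by have := bop_linear A (-1) 0 0; rewrite scaler0 addr0 scaleN1r addNr.
  by have := bop_linear A c h 0; rewrite !addr0 A0 addr0.
apply: l2_ext => -[x y] /=.
rewrite (_ : slice _ y = T g y *: f).
  by rewrite bopZ; exact: mulrC.
apply: l2_ext => u /=.
rewrite (_ : slice _ u = f u *: g); last exact: l2_ext.
by rewrite bopZ; exact: mulrC.
Qed.

(* The weak operator topology, generated by T |-> <T f, g>, and the weak*
   (ultraweak) topology, generated by T |-> \sum_n <T f_n, g_n> with
   \sum_n |f_n|^2 and \sum_n |g_n|^2 finite. *)
Definition wot_coef X (T : bop X X) : {ptws l2 X * l2 X -> R[i]^o} :=
  fun p => ip (T p.1) p.2.
Definition wot X := initial_topology (@wot_coef X).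

Definition sqseq X := {f : nat -> l2 X |
  (\esum_(n in [set: nat]) sqsum (f n) < +oo)%E}.

Definition wstar_coef X (T : bop X X) : {ptws sqseq X * sqseq X -> R[i]^o} :=
  fun p => csum (fun n => ip (T (sval p.1 n)) (sval p.2 n)).
Definition wstar X := initial_topology (@wstar_coef X).

Definition wot_closed X (A : set (bop X X)) := closed (A : set (wot X)).
Definition wstar_closed X (A : set (bop X X)) := closed (A : set (wstar X)).
Definition wstar_closure X (A : set (bop X X)) : set (bop X X) :=
  closure (A : set (wstar X)).
Definition wstar_continuous X Y (A : set (bop X X)) (F : bop X X -> bop Y Y) :=
  {within (A : set (wstar X)), continuous (F : wstar X -> wstar Y)}.

Definition subspace_set (V : lmodType R[i]) (A : set V) :=
  A 0 /\ forall (c : R[i]) S T, A S -> A T -> A (c *: S + T).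
Definition lspan (V : lmodType R[i]) (G : set V) : set V :=
  smallest (@subspace_set V) G.

Definition subalgebra X (A : set (bop X X)) :=
  subspace_set A /\ forall S T, A S -> A T -> A (bcomp S T).

Definition projection X (e : bop X X) :=
  bcomp e e = e /\ forall f g, ip (e f) g = ip f (e g).

(* Operators on the closed subspace N = e (l2 X) are identified with the
   operators T on l2 X such that e T = T = T e; the unit of B(N) is then e, and
   the norms and the weak* topology are those inherited from B(l2 X). *)
Definition dual_operator_algebra X (e : bop X X) (A : set (bop X X)) :=
  [/\ projection e, A e, forall T, A T -> bcomp e T = T /\ bcomp T e = T,
      subalgebra A & wstar_closed A].

Definition alg_tens X Y (A : set (bop X X)) (B : set (bop Y Y)) :
    set (bop (X * Y)%type (X * Y)%type) :=
  lspan [set tens S T | S in A & T in B].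
Definition normal_tens X Y (A : set (bop X X)) (B : set (bop Y Y)) :=
  wstar_closure (alg_tens A B).

Definition linear_on X Y (A : set (bop X X)) (F : bop X X -> bop Y Y) :=
  forall (c : R[i]) S T, A S -> A T -> F (c *: S + T) = c *: F S + F T.

(* F is the weak*-continuous extension of f (x) g to the normal tensor product
   of A and B. *)
Definition tens_extension X Y X' Y' (A : set (bop X X)) (B : set (bop Y Y))
    (f : bop X X -> bop X' X') (g : bop Y Y -> bop Y' Y')
    (F : bop (X * Y)%type (X * Y)%type -> bop (X' * Y')%type (X' * Y')%type) :=
  [/\ linear_on (normal_tens A B) F, wstar_continuous (normal_tens A B) F &
      forall S T, A S -> B T -> F (tens S T) = tens (f S) (g T)].

(* The norm of a matrix of operators, acting on (l2 X)^n. *)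
Definition mxnorm n X (a : 'M[bop X X]_n) : R :=
  inf [set M : R | 0 <= M /\ forall v : 'I_n -> l2 X,
    \sum_i l2norm (\sum_j a i j (v j)) ^+ 2 <= M ^+ 2 * \sum_j l2norm (v j) ^+ 2].

Definition completely_contractive X Y (A : set (bop X X))
    (F : bop X X -> bop Y Y) :=
  forall n (a : 'M[bop X X]_n), (forall i j, A (a i j)) ->
    mxnorm (map_mx F a) <= mxnorm a.

Definition coassociative X (A : set (bop X X))
    (D : bop X X -> bop (X * X)%type (X * X)%type) :=
  exists Dr Dl, [/\ tens_extension A A idfun D Dr, tens_extension A A D idfun Dl &
    forall T, A T ->
      bcomp (bassoc X X X) (Dr (D T)) = bcomp (Dl (D T)) (bassoc X X X)].

Definition comultiplication X (e : bop X X) (A : set (bop X X))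
    (D : bop X X -> bop (X * X)%type (X * X)%type) :=
  [/\ (forall T, A T -> normal_tens A A (D T)) /\ D e = tens e e,
      linear_on A D /\ (forall S T, A S -> A T -> D (bcomp S T) = bcomp (D S) (D T)),
      wstar_continuous A D, completely_contractive A D & coassociative A D].

Definition hopf_dual_algebra X (e : bop X X) (A : set (bop X X))
    (D : bop X X -> bop (X * X)%type (X * X)%type) :=
  dual_operator_algebra e A /\ comultiplication e A D.

(* The orthogonal projection onto N (0 if N is not a closed subspace). *)
Definition orthoproj X (N : set (l2 X)) : bop X X :=
  xget (0 : bop X X) [set P : bop X X | forall f, N (P f) /\ forall g, N g -> ip (f - P f) g = 0].

End ell2.

Section free_semigroup_algebra.
Context {R : realType} {d : nat}.
Local Notation word := (seq 'I_d).
Local Notation op := (@bop R word word).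
Implicit Types (u v w : word) (J : set op).

Lemma xi_pred w : (fun v => (v == w)%:R) \in @l2_pred R word.
Proof.
rewrite unfold_in /l2_pred /sqsum.
rewrite (_ : (\esum_(v in _) _)%E = (\esum_(v in [set w]) 1)%E).
  by rewrite esum_set1 ?lee01 // ltry.
rewrite [RHS]esum_mkcond; apply: eq_esum => v _.
case: eqVneq => [->|vw].
  by rewrite mem_set // (_ : Normc.normc _ = 1) ?expr1n //; exact: Normc.normc1.
rewrite memNset; last by move=> /eqP; rewrite (negbTE vw).
by rewrite (_ : Normc.normc _ = 0) ?expr0n //; exact: Normc.normc0.
Qed.
Definition xi w : l2 word := L2 (xi_pred w).

Definition shift_fun u (f : word -> R[i]) : word -> R[i] :=
  fun v => if prefix u v then f (drop (size u) v) else 0.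

Lemma shift_le u f : (sqsum (shift_fun u f) <= sqsum f)%E.
Proof.
rewrite {2}/sqsum (eq_esum (b := fun v =>
  (Normc.normc (shift_fun u f (u ++ v)) ^+ 2)%:E)); last first.
  by move=> v _; rewrite /shift_fun prefix_prefix drop_size_cat.
rewrite -(@esum_image _ _ _ [set: word] (cat u)
  (fun v => (Normc.normc (shift_fun u f v) ^+ 2)%:E)); last first.
  by move=> v w _ _ /eqP; rewrite eqseq_cat // eqxx => /eqP.
rewrite esum_mkcond; apply: le_esum => v _; case: ifPn => // vu.
rewrite /shift_fun; case: prefixP => [[w vE]|_]; last first.
  by rewrite (_ : Normc.normc _ = 0) ?expr0n //; exact: Normc.normc0.
by move: vu; rewrite mem_set //; exists w.
Qed.

Lemma shift_pred u (f : l2 word) : shift_fun u f \in @l2_pred R word.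
Proof. by rewrite unfold_in; apply: le_lt_trans (sqsum_fin f); exact: shift_le. Qed.

Lemma shift_bounded u :
  (fun f => L2 (shift_pred u f)) \in @bounded_pred R word word.
Proof.
apply/asboolP; split=> [a f g|].
  apply: l2_ext => v.
  change (shift_fun u (a *: f + g) v = a * shift_fun u f v + shift_fun u g v).
  by rewrite /shift_fun; case: ifP => // _; rewrite mulr0 addr0.
by exists 1 => // f; apply/l2norm_leP; rewrite // expr1n mul1e; exact: shift_le.
Qed.
Definition L u : op := Bop (shift_bounded u).

Lemma shift_xi u w : L u (xi w) = xi (u ++ w).
Proof.
apply: l2_ext => v /=; rewrite /shift_fun; case: prefixP => [[t ->]|nuv].
  by rewrite drop_size_cat //= eqseq_cat // eqxx.
by case: eqP => // vE; case: nuv; exists w.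
Qed.

Definition fs_alg : set op :=
  smallest (fun A => [/\ subalgebra A, A (bid word) & wot_closed A]) (range L).

Definition wot_ideal J :=
  [/\ J `<=` fs_alg, subspace_set J,
      forall S T, fs_alg S -> J T -> J (bcomp S T) /\ J (bcomp T S) & wot_closed J].

Definition hom_poly (T : op) :=
  exists n : nat, lspan [set L w | w in [set w : word | size w = n]] T.

Definition homogeneous J :=
  exists2 G : set op, G `<=` hom_poly & J = smallest wot_ideal G.

Definition Nspace J : set (l2 word) := [set f | forall T, J T -> ip f (T (xi [::])) = 0].

Definition Nproj J : op := orthoproj (Nspace J).

(* The compression homomorphism; as above, P_N T |_N is identified with the
   operator P_N T P_N on the whole space. *)
Definition compr J (T : op) : op := bcomp (Nproj J) (bcomp T (Nproj J)).
Definition quot_alg J : set op := [set compr J T | T in fs_alg].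

(* These properties determine DL on fs_alg, the weak*-closed span of the L w. *)
Definition is_fs_comult (DL : op -> bop (word * word)%type (word * word)%type) :=
  hopf_dual_algebra (bid word) fs_alg DL /\ forall w, DL (L w) = tens (L w) (L w).

Definition hopf_ideal DL J :=
  forall T, J T -> wstar_closure
    [set A + B | A in alg_tens J fs_alg & B in alg_tens fs_alg J] (DL T).

Definition canonical_comult DL J (D : op -> bop (word * word)%type (word * word)%type) :=
  exists2 F, tens_extension fs_alg fs_alg (compr J) (compr J) F &
    forall T, fs_alg T -> D (compr J T) = F (DL T).

End free_semigroup_algebra.

(* Main.v *)
Require Import Defs.
From mathcomp Require Import all_boot all_order all_algebra.
From mathcomp Require Import all_classical all_reals all_analysis.
From mathcomp Require Import finmap complex ring lra.
Set Implicit Arguments.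
Unset Strict Implicit.
Unset Printing Implicit Defensive.
Import Order.TTheory GRing.Theory Num.Theory numFieldNormedType.Exports.
Import ComplexField.
Local Open Scope classical_set_scope.
Local Open Scope ring_scope.

(** Write L for the free semigroup algebra, N for the coinvariant subspace of
the ideal J, e for the projection onto N and DL for the comultiplication of L.

Everything rests on one fact about L [vector_functional]: a functional
T |-> <(1 ⊗ T) x, y>, with any multiplicity space in the first leg, agrees on L
with a functional T |-> <T v, y'> on the words alone, where |v| <= |x|,
|y'| <= |y|, and v is cyclic for the shifts L_w unless y' = 0.  The operators
1 ⊗ L_w form a row isometry without unitary part, so the closed invariant
subspace generated by x is zero or, by the Wold decomposition, a copy of l2 of
words [wold_isometry]; v and y' are x and y read inside this copy.  Consequences:
- the weak* and weak operator topologies agree on L and the span of the L_w is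
  weak*-dense in L, so linear weak*-continuous maps on L are determined by
  their values on the L_w [fs_eq];
- if <T v, y> vanishes on J then y lies in N, because v is cyclic and J absorbs
  right multiplication [annihilator_N]; as functionals separate J from its
  complement, the compression T |-> e T e of L has kernel J [compr_kernel];
- the range of the compression is weak*-closed [quot_alg_closed]: an operator X
  in the closure acts on the functionals <T v, y> with y in N; the Hahn-Banach
  theorem extends this action with its norm to all vector functionals, and the
  extension is an element of L that compresses to X.

For the first half, splitting off the longest common prefix of two words
defines a coisometry G [wold_map] with DL(T) G = G (1 ⊗ T) for T in L
[DL_intertwine]: it is the Wold decomposition of the row isometry L_w ⊗ L_w.
Put P = e ⊗ e and B = P G.  If J is a Hopf ideal then P DL(T) = 0 for T in J,
hence B (1 ⊗ T) = 0 for T in J, which says that B = B (1 ⊗ e) [B_Nproj].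
Therefore D(X) = B (1 ⊗ X) adj(B) satisfies D(e T e) = P DL(T) P
[quot_comult_compr].  This one formula is a well-defined map on the quotient, is
weak*-continuous, and is completely contractive since B is a contraction, so no
norms have to be lifted to L.  Multiplicativity comes from DL, and
coassociativity is compared on words.

For the converse, the weak*-continuous extension of the compression to the
tensor product can only be Y |-> P Y P, so P DL(T) P = 0 for T in J.  When T is
a polynomial, DL(T) is a finite sum of elementary tensors, and the finite
tensor identity P DL(T) P = 0 together with compr_kernel puts DL(T) in
J ⊗ L + L ⊗ J by elimination [tensor_kernel].  The elements T of L with DL(T) in
the weak* closure of J ⊗ L + L ⊗ J form a WOT-closed ideal
[coideal_preimage_ideal]; it contains the polynomial generators of J, hence J. *)

Arguments ip : simpl never.
Arguments csum : simpl never.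
Arguments conjc : simpl never.

(** * Absolutely summable families *)

Section sums.
Context {R : realType}.
Implicit Types (X Y Z : choiceType).
Local Notation nc := (@Normc.normc R).

Lemma nc_ge0 (z : R[i]) : 0 <= nc z.
Proof. by case: z => u v; exact: sqrtr_ge0. Qed.

Lemma nc_sqr (z : R[i]) : nc z ^+ 2 = complex.Re z ^+ 2 + complex.Im z ^+ 2.
Proof. by case: z => u v; rewrite sqr_sqrtr // addr_ge0 ?sqr_ge0. Qed.

Lemma Re_le_nc (z : R[i]) : `|complex.Re z| <= nc z.
Proof.
by rewrite -ler_sqr ?nnegrE ?nc_ge0 // nc_sqr real_normK ?num_real // lerDl sqr_ge0.
Qed.

Lemma Im_le_nc (z : R[i]) : `|complex.Im z| <= nc z.
Proof.
by rewrite -ler_sqr ?nnegrE ?nc_ge0 // nc_sqr real_normK ?num_real // lerDr sqr_ge0.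
Qed.

Lemma ncJ (z : R[i]) : nc (z^*)%C = nc z.
Proof. by case: z => u v /=; rewrite sqrrN. Qed.

Lemma nc0 : nc 0 = 0.
Proof. exact: Normc.normc0. Qed.

Lemma nc_real (r : R) : 0 <= r -> nc (r%:C)%C = r.
Proof. by move=> r0; rewrite /= expr0n addr0 sqrtr_sqr ger0_norm. Qed.

Lemma cReD (z w : R[i]) : complex.Re (z + w) = complex.Re z + complex.Re w.
Proof. by case: z w => [? ?] [? ?]. Qed.

Lemma cImD (z w : R[i]) : complex.Im (z + w) = complex.Im z + complex.Im w.
Proof. by case: z w => [? ?] [? ?]. Qed.

Lemma cReN (z : R[i]) : complex.Re (- z) = - complex.Re z.
Proof. by case: z. Qed.

Lemma cReR (x : R) : complex.Re (x%:C)%C = x.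
Proof. by []. Qed.

Lemma cReM (z w : R[i]) : complex.Re (z * w) =
  complex.Re z * complex.Re w - complex.Im z * complex.Im w.
Proof. by case: z w => [? ?] [? ?]. Qed.

Lemma cImM (z w : R[i]) : complex.Im (z * w) =
  complex.Re z * complex.Im w + complex.Im z * complex.Re w.
Proof. by case: z w => [? ?] [? ?]. Qed.

Lemma cpx_ext (z w : R[i]) : complex.Re z = complex.Re w ->
  complex.Im z = complex.Im w -> z = w.
Proof. by case: z w => [? ?] [? ?] /= -> ->. Qed.

Lemma esumZ X (c : R) (a : X -> \bar R) : 0 <= c ->
  (forall x, (0 <= a x)%E) ->
  (\esum_(x in [set: X]) (c%:E * a x) = c%:E * \esum_(x in [set: X]) a x)%E.
Proof.
move=> c0 a0; apply/eqP; rewrite eq_le esumZ_le //=.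
have [->|cn0] := eqVneq c 0.
  by rewrite mul0e; apply: esum_ge0 => x _; rewrite mul0e.
have cE : (\esum_(x in [set: X]) a x)%E =
    (\esum_(x in [set: X]) (c^-1%:E * (c%:E * a x)))%E.
  by apply: eq_esum => x _; rewrite muleA -EFinM mulVf // mul1e.
rewrite cE; apply: le_trans (lee_wpmul2l _ (esumZ_le _ _)) _ => //.
- by rewrite invr_ge0.
- by move=> x; rewrite mule_ge0.
- by rewrite muleA -EFinM divff // mul1e.
Qed.

Lemma esum_fin X (a b : X -> R) :
  (\esum_(x in [set: X]) (b x)%:E < +oo)%E -> (forall x, 0 <= a x <= b x) ->
  (\esum_(x in [set: X]) (a x)%:E \is a fin_num)%E.
Proof.
move=> bfin ab; rewrite ge0_fin_numE.
  by apply: le_lt_trans bfin; apply: le_esum => x _; rewrite lee_fin; case/andP: (ab x).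
by apply: esum_ge0 => x _; rewrite lee_fin; case/andP: (ab x).
Qed.

(** rsum takes the positive and negative parts of h; any other decomposition into
nonnegative summable families gives the same number.  Additivity and Fubini for
rsum therefore reduce to nonnegative sums. *)
Lemma rsum_diff X (h a b : X -> R) : (forall x, 0 <= a x) -> (forall x, 0 <= b x) ->
  (\esum_(x in [set: X]) (a x)%:E < +oo)%E ->
  (\esum_(x in [set: X]) (b x)%:E < +oo)%E ->
  (forall x, h x = a x - b x) ->
  rsum h = fine (\esum_(x in [set: X]) (a x)%:E) -
           fine (\esum_(x in [set: X]) (b x)%:E).
Proof.
move=> a0 b0 afin bfin hE; rewrite /rsum.
set p := fun x => Num.max (h x) 0; set q := fun x => Num.max (- h x) 0.
have pa x : 0 <= p x <= a x.
  by rewrite /p le_max lexx orbT ge_max a0 hE gerBl b0.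
have qb x : 0 <= q x <= b x.
  by rewrite /q le_max lexx orbT ge_max b0 hE opprB gerBl a0.
have pf := esum_fin afin pa; have qf := esum_fin bfin qb.
have af : (\esum_(x in [set: X]) (a x)%:E \is a fin_num)%E.
  by apply: (esum_fin afin) => x; rewrite a0 lexx.
have bf : (\esum_(x in [set: X]) (b x)%:E \is a fin_num)%E.
  by apply: (esum_fin bfin) => x; rewrite b0 lexx.
have : (\esum_(x in [set: X]) (p x)%:E + \esum_(x in [set: X]) (b x)%:E =
        \esum_(x in [set: X]) (q x)%:E + \esum_(x in [set: X]) (a x)%:E)%E.
  rewrite -!esumD; try by move=> x _; rewrite lee_fin ?a0 ?b0 //; case/andP: (pa x); case/andP: (qb x).
  apply: eq_esum => x _; rewrite -!EFinD; congr EFin.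
  rewrite /p /q !hE opprB.
  have [/ltW ab|ba] := ltP (a x - b x) 0.
    rewrite max_l; last by rewrite subr_ge0 -subr_le0.
    by rewrite add0r subrK.
  by rewrite max_r ?add0r ?subrK // subr_le0 -subr_ge0.
rewrite -(fineK pf) -(fineK qf) -(fineK af) -(fineK bf) -!EFinD => /(congr1 fine).
rewrite /=; set u := fine _; set v := fine _; set w := fine _; set z := fine _; lra.
Qed.

Definition rsummable X (h : X -> R) := (\esum_(x in [set: X]) `|h x|%:E < +oo)%E.

Lemma rsummable_le X (h a : X -> R) : rsummable a ->
  (forall x, `|h x| <= `|a x|) -> rsummable h.
Proof.
by move=> afin ha; apply: le_lt_trans afin; apply: le_esum => x _; rewrite lee_fin.
Qed.

Lemma rsummableZ X (c : R) (h : X -> R) : rsummable h ->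
  rsummable (fun x => c * h x).
Proof.
move=> hf; rewrite /rsummable (eq_esum (b := fun x => (`|c|%:E * `|h x|%:E)%E)).
  by rewrite esumZ // lte_mul_pinfty.
by move=> x _; rewrite normrM EFinM.
Qed.

Definition rpos (r : R) := Num.max r 0.
Definition rneg (r : R) := Num.max (- r) 0.

Lemma rposneg (r : R) : r = rpos r - rneg r.
Proof.
rewrite /rpos /rneg; have [r0|r0] := leP 0 r.
  by rewrite max_r ?subr0 // oppr_le0.
by rewrite max_l ?sub0r ?opprK // oppr_ge0 ltW.
Qed.
Lemma rpos_ge0 r : 0 <= rpos r. Proof. by rewrite /rpos le_max lexx orbT. Qed.
Lemma rneg_ge0 r : 0 <= rneg r. Proof. by rewrite /rneg le_max lexx orbT. Qed.
Lemma rpos_le r : rpos r <= `|r|. Proof. by rewrite /rpos ge_max ler_norm normr_ge0. Qed.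
Lemma rneg_le r : rneg r <= `|r|.
Proof. by rewrite /rneg ge_max normr_ge0 andbT -normrN ler_norm. Qed.

Lemma rpos_fin X (h : X -> R) : rsummable h ->
  (\esum_(x in [set: X]) (rpos (h x))%:E < +oo)%E.
Proof.
by move=> hf; apply: le_lt_trans hf; apply: le_esum => x _; rewrite lee_fin rpos_le.
Qed.
Lemma rneg_fin X (h : X -> R) : rsummable h ->
  (\esum_(x in [set: X]) (rneg (h x))%:E < +oo)%E.
Proof.
by move=> hf; apply: le_lt_trans hf; apply: le_esum => x _; rewrite lee_fin rneg_le.
Qed.

Lemma rsumD X (h k : X -> R) : rsummable h -> rsummable k ->
  rsum (fun x => h x + k x) = rsum h + rsum k.
Proof.
move=> hf kf; rewrite (@rsum_diff _ _ (fun x => rpos (h x) + rpos (k x))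
   (fun x => rneg (h x) + rneg (k x))).
- under eq_esum do rewrite EFinD.
  under [X in _ - fine X = _]eq_esum do rewrite EFinD.
  rewrite !esumD; try by move=> x _; rewrite lee_fin ?rpos_ge0 ?rneg_ge0.
  have pn (k' : X -> R) : rsummable k' -> (\esum_(x in [set: X]) (rpos (k' x))%:E \is a fin_num)%E.
    move=> k'f; rewrite ge0_fin_numE; first exact: rpos_fin.
    by apply: esum_ge0 => x _; rewrite lee_fin rpos_ge0.
  have nn (k' : X -> R) : rsummable k' -> (\esum_(x in [set: X]) (rneg (k' x))%:E \is a fin_num)%E.
    move=> k'f; rewrite ge0_fin_numE; first exact: rneg_fin.
    by apply: esum_ge0 => x _; rewrite lee_fin rneg_ge0.
  rewrite (fineD (pn _ hf) (pn _ kf)) (fineD (nn _ hf) (nn _ kf)).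
  by rewrite /rsum -/rpos -/rneg; ring.
- by move=> x; rewrite addr_ge0 ?rpos_ge0.
- by move=> x; rewrite addr_ge0 ?rneg_ge0.
- under eq_esum do rewrite EFinD.
  by rewrite esumD ?lte_add_pinfty ?rpos_fin // => x _; rewrite lee_fin rpos_ge0.
- under eq_esum do rewrite EFinD.
  by rewrite esumD ?lte_add_pinfty ?rneg_fin // => x _; rewrite lee_fin rneg_ge0.
- by move=> x; rewrite {1}(rposneg (h x)) {1}(rposneg (k x)); ring.
Qed.

Lemma rsumN X (h : X -> R) : rsum (fun x => - h x) = - rsum h.
Proof.
rewrite /rsum opprB; congr (_ - fine _); apply: eq_esum => x _.
by rewrite opprK.
Qed.

Lemma rsumZ X (c : R) (h : X -> R) : rsummable h ->
  rsum (fun x => c * h x) = c * rsum h.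
Proof.
have pos (d : R) (k : X -> R) : 0 <= d -> rsummable k ->
    rsum (fun x => d * k x) = d * rsum k.
  move=> d0 kf; have ppf := rpos_fin kf; have npf := rneg_fin kf.
  rewrite (@rsum_diff _ _ (fun x => d * rpos (k x)) (fun x => d * rneg (k x))).
  - under eq_esum do rewrite EFinM.
    under [X in _ - fine X = _]eq_esum do rewrite EFinM.
    rewrite !esumZ //; try by move=> x; rewrite lee_fin ?rpos_ge0 ?rneg_ge0.
    have pn : (\esum_(x in [set: X]) (rpos (k x))%:E \is a fin_num)%E.
      by rewrite ge0_fin_numE //; apply: esum_ge0 => x _; rewrite lee_fin rpos_ge0.
    have nn : (\esum_(x in [set: X]) (rneg (k x))%:E \is a fin_num)%E.
      by rewrite ge0_fin_numE //; apply: esum_ge0 => x _; rewrite lee_fin rneg_ge0.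
    by rewrite (fineM _ pn) // (fineM _ nn) // -mulrBr.
  - by move=> x; rewrite mulr_ge0 ?rpos_ge0.
  - by move=> x; rewrite mulr_ge0 ?rneg_ge0.
  - under eq_esum do rewrite EFinM.
    rewrite !esumZ ?lte_mul_pinfty // => x; by rewrite lee_fin rpos_ge0.
  - under eq_esum do rewrite EFinM.
    rewrite !esumZ ?lte_mul_pinfty // => x; by rewrite lee_fin rneg_ge0.
  - by move=> x; rewrite -mulrBr -rposneg.
move=> hf; have [c0|/ltW c0] := leP 0 c; first exact: pos.
rewrite -[c]opprK mulNr -pos ?oppr_ge0 // -rsumN; congr rsum.
by apply/funext => x; rewrite mulNr.
Qed.

Lemma rsum_pos X (h : X -> R) : (forall x, 0 <= h x) ->
  rsum h = fine (\esum_(x in [set: X]) (h x)%:E).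
Proof.
move=> h0; rewrite /rsum [X in _ - fine X]esum1; last first.
  by move=> x _; rewrite max_r // oppr_le0.
by rewrite subr0; congr fine; apply: eq_esum => x _; rewrite max_l.
Qed.

Lemma esum_pair X Y (a : X * Y -> \bar R) : (forall p, (0 <= a p)%E) ->
  (\esum_(p in [set: X * Y]) a p =
   \esum_(x in [set: X]) \esum_(y in [set: Y]) a (x, y))%E.
Proof.
move=> a0; rewrite esum_esum //.
rewrite (_ : [set: X] `*`` _ = setT); last by apply/seteqP; split.
by apply: eq_esum => -[].
Qed.

Lemma rsum_pair X Y (h : X * Y -> R) : rsummable h ->
  rsum h = rsum (fun x => rsum (fun y => h (x, y))).
Proof.
move=> hf.
have fin (a : X * Y -> R) : (forall p, 0 <= a p) ->
   (\esum_(p in [set: X * Y]) (a p)%:E < +oo)%E ->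
   forall x, (\esum_(y in [set: Y]) (a (x, y))%:E < +oo)%E.
  move=> a0 af x; apply: le_lt_trans af.
  rewrite esum_pair //.
  rewrite -(@esum_set1 _ _ x (fun x => \esum_(y in [set: Y]) (a (x, y))%:E)%E).
    rewrite esum_mkcond; apply: le_esum => z _; case: ifP => // _.
    by apply: esum_ge0 => y _; rewrite lee_fin.
  by apply: esum_ge0 => y _; rewrite lee_fin.
have pf := rpos_fin hf; have nf := rneg_fin hf.
rewrite [RHS](@rsum_diff _ _
    (fun x => fine (\esum_(y in [set: Y]) (rpos (h (x, y)))%:E))
    (fun x => fine (\esum_(y in [set: Y]) (rneg (h (x, y)))%:E))).
- rewrite [LHS]/rsum !esum_pair; try by move=> p; rewrite lee_fin ?rpos_ge0 ?rneg_ge0.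
  congr (fine _ - fine _); apply: eq_esum => x _; rewrite fineK // ge0_fin_numE;
    try by apply: esum_ge0 => y _; rewrite lee_fin ?rpos_ge0 ?rneg_ge0.
    by apply: (fin (rpos \o h)) => // p; exact: rpos_ge0.
  by apply: (fin (rneg \o h)) => // p; exact: rneg_ge0.
- by move=> x; rewrite fine_ge0 // esum_ge0 // => y _; rewrite lee_fin rpos_ge0.
- by move=> x; rewrite fine_ge0 // esum_ge0 // => y _; rewrite lee_fin rneg_ge0.
- rewrite esum_pair in pf; last by move=> p; rewrite lee_fin rpos_ge0.
  apply: le_lt_trans pf; apply: le_esum => x _.
  rewrite fineK // ge0_fin_numE; last by apply: esum_ge0 => y _; rewrite lee_fin rpos_ge0.
  apply: (fin (rpos \o h)) => [p|]; [exact: rpos_ge0|exact: rpos_fin].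
- rewrite esum_pair in nf; last by move=> p; rewrite lee_fin rneg_ge0.
  apply: le_lt_trans nf; apply: le_esum => x _.
  rewrite fineK // ge0_fin_numE; last by apply: esum_ge0 => y _; rewrite lee_fin rneg_ge0.
  apply: (fin (rneg \o h)) => [p|]; [exact: rneg_ge0|exact: rneg_fin].
- by move=> x.
Qed.

Lemma rsum_pt X (h : X -> R) (x0 : X) : (forall x, x != x0 -> h x = 0) ->
  rsum h = h x0.
Proof.
move=> h0; have pt (k : X -> R) : (forall x, 0 <= k x) ->
   (forall x, x != x0 -> k x = 0) -> (\esum_(x in [set: X]) (k x)%:E = (k x0)%:E)%E.
  move=> k0 kx; rewrite -(@esum_set1 _ _ x0 (fun x => (k x)%:E)) ?lee_fin //.
  rewrite [RHS]esum_mkcond; apply: eq_esum => x _.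
  case: ifPn => [//|]; rewrite notin_setE /= => /eqP; exact: (fun H => congr1 EFin (kx x H)).
rewrite /rsum (pt (fun x => rpos (h x))) ?(pt (fun x => rneg (h x))) /=.
- by rewrite -rposneg.
- by move=> x; exact: rneg_ge0.
- by move=> x /h0 ->; rewrite /rneg oppr0 maxxx.
- by move=> x; exact: rpos_ge0.
- by move=> x /h0 ->; rewrite /rpos maxxx.
Qed.

Definition csummable X (h : X -> R[i]) := (\esum_(x in [set: X]) (nc (h x))%:E < +oo)%E.

Lemma csummable_le X (h : X -> R[i]) (a : X -> R) :
  (\esum_(x in [set: X]) (a x)%:E < +oo)%E ->
  (forall x, nc (h x) <= a x) -> csummable h.
Proof.
by move=> af ha; apply: le_lt_trans af; apply: le_esum => x _; rewrite lee_fin.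
Qed.

Lemma csummable_Re X (h : X -> R[i]) : csummable h -> rsummable (@complex.Re R \o h).
Proof.
by move=> hf; apply: le_lt_trans hf; apply: le_esum => x _; rewrite lee_fin Re_le_nc.
Qed.

Lemma csummable_Im X (h : X -> R[i]) : csummable h -> rsummable (@complex.Im R \o h).
Proof.
by move=> hf; apply: le_lt_trans hf; apply: le_esum => x _; rewrite lee_fin Im_le_nc.
Qed.

Lemma csumD X (h k : X -> R[i]) : csummable h -> csummable k ->
  csum (fun x => h x + k x) = csum h + csum k.
Proof.
move=> hf kf; rewrite /csum.
under [fun x => complex.Re _]eq_fun do rewrite cReD.
under [fun x => complex.Im _]eq_fun do rewrite cImD.
rewrite !rsumD //; [exact: csummable_Im|exact: csummable_Im|exact: csummable_Re|exact: csummable_Re].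
Qed.

Lemma csumZ X (c : R[i]) (h : X -> R[i]) : csummable h ->
  csum (fun x => c * h x) = c * csum h.
Proof.
move=> hf; have re := csummable_Re hf; have im := csummable_Im hf.
rewrite /csum; apply: cpx_ext; rewrite ?cReM ?cImM [LHS]/= -!rsumZ //=.
- under [fun x => complex.Re _]eq_fun do rewrite cReM.
  rewrite rsumD ?rsumN //; first exact: rsummableZ.
  by apply: (rsummable_le (rsummableZ (complex.Im c) im)) => x; rewrite normrN.
- under [fun x => complex.Im _]eq_fun do rewrite cImM.
  by rewrite rsumD //; exact: rsummableZ.
Qed.

Lemma csumJ X (h : X -> R[i]) : csum (fun x => (h x)^*%C) = ((csum h)^*)%C.
Proof.
rewrite /csum; apply: cpx_ext => /=.
  by congr rsum; apply/funext => x; case: (h x).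
by rewrite -rsumN; congr rsum; apply/funext => x; case: (h x).
Qed.

Lemma csum_pair X Y (h : X * Y -> R[i]) : csummable h ->
  csum h = csum (fun x => csum (fun y => h (x, y))).
Proof.
move=> hf; rewrite /csum /= (rsum_pair (csummable_Re hf)).
by rewrite (rsum_pair (csummable_Im hf)).
Qed.

Lemma csum_pt X (h : X -> R[i]) (x0 : X) : (forall x, x != x0 -> h x = 0) ->
  csum h = h x0.
Proof.
move=> h0; rewrite /csum !(rsum_pt (x0 := x0)); first by case: (h x0).
  by move=> x /h0 ->.
by move=> x /h0 ->.
Qed.

Lemma csum_real X (h : X -> R) : csum (fun x => ((h x)%:C)%C) = ((rsum h)%:C)%C.
Proof.
by rewrite /csum; apply: cpx_ext => //=; rewrite rsum_pos // esum1.
Qed.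

End sums.

(** * The inner product *)

Section inner_product.
Context {R : realType}.
Implicit Types (X Y Z : choiceType).
Local Notation nc := (@Normc.normc R).
Local Notation C := R[i].
Local Notation cj := (@conjc R).
Local Notation l2 := (@l2 R).
Local Notation bop := (@bop R).

Lemma conjcKK (z : C) : cj (cj z) = z.
Proof. by case: z => a b; rewrite /conjc opprK. Qed.
Lemma conjcD (z w : C) : cj (z + w) = cj z + cj w.
Proof. exact: rmorphD. Qed.
Lemma conjcM (z w : C) : cj (z * w) = cj z * cj w.
Proof. exact: rmorphM. Qed.
Lemma conjcN (z : C) : cj (- z) = - cj z.
Proof. exact: rmorphN. Qed.
Lemma conjcB (z w : C) : cj (z - w) = cj z - cj w.
Proof. exact: rmorphB. Qed.
Lemma conjcR (x : R) : cj (x%:C)%C = (x%:C)%C.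
Proof. exact: conjc_real. Qed.

Lemma ncN (z : C) : nc (- z) = nc z.
Proof. by case: z => a b /=; rewrite !sqrrN. Qed.

Lemma rcM (x y : R) : (x * y)%:C%C = x%:C%C * y%:C%C.
Proof. exact: rmorphM. Qed.
Lemma rcB (x y : R) : (x - y)%:C%C = x%:C%C - y%:C%C.
Proof. exact: rmorphB. Qed.

Lemma sumC I (s : seq I) (F : I -> R) :
  (\sum_(i <- s) F i)%:C%C = \sum_(i <- s) (F i)%:C%C.
Proof. exact: rmorph_sum. Qed.

Lemma subBB (V : zmodType) (f a b : V) : (f - a) - (f - b) = b - a.
Proof. by rewrite opprB addrC addrA subrK. Qed.

Lemma l2_csummable X (f g : l2 X) : csummable (fun x => f x * (g x)^*%C : C).
Proof.
apply: (@csummable_le _ _ _ (fun x => nc (f x) ^+ 2 + nc (g x) ^+ 2)).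
  under eq_esum do rewrite EFinD.
  rewrite esumD; try by move=> x _; rewrite lee_fin sqr_ge0.
  by rewrite lte_add_pinfty //; exact: sqsum_fin.
move=> x; rewrite Normc.normcM ncJ.
have := sqr_ge0 (nc (f x) - nc (g x)); have := nc_ge0 (f x); have := nc_ge0 (g x).
nra.
Qed.

Lemma ipE X (f g : l2 X) : ip f g = csum (fun x => f x * (g x)^*%C).
Proof. by []. Qed.

End inner_product.

Local Opaque ip.

(** * Hilbert space geometry *)

Section hilbert_space.
Context {R : realType}.
Implicit Types (X Y Z : choiceType).
Local Notation nc := (@Normc.normc R).
Local Notation C := R[i].
Local Notation cj := (@conjc R).
Local Notation l2 := (@l2 R).
Local Notation bop := (@bop R).

Lemma ipDl X (f g h : l2 X) : ip (f + g) h = ip f h + ip g h.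
Proof.
rewrite !ipE -csumD; [|exact: l2_csummable..].
by congr csum; apply/funext => x; rewrite -mulrDl.
Qed.

Lemma ipZl X c (f h : l2 X) : ip (c *: f) h = c * ip f h.
Proof.
rewrite !ipE -csumZ; last exact: l2_csummable.
by congr csum; apply/funext => x; rewrite mulrA.
Qed.

Lemma ipC X (f g : l2 X) : ip f g = cj (ip g f).
Proof.
rewrite !ipE -csumJ; congr csum; apply/funext => x.
by rewrite conjcM conjcKK mulrC.
Qed.

Lemma ipDr X (f g h : l2 X) : ip h (f + g) = ip h f + ip h g.
Proof. by rewrite ipC ipDl conjcD -!ipC. Qed.

Lemma ipZr X c (f h : l2 X) : ip h (c *: f) = cj c * ip h f.
Proof. by rewrite ipC ipZl conjcM -ipC. Qed.

Lemma ip0l X (h : l2 X) : ip 0 h = 0.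
Proof. by rewrite -(scale0r (0 : l2 X)) ipZl mul0r. Qed.
Lemma ip0r X (h : l2 X) : ip h 0 = 0.
Proof. by rewrite ipC ip0l conjc0. Qed.
Lemma ipNl X (f h : l2 X) : ip (- f) h = - ip f h.
Proof. by rewrite -scaleN1r ipZl mulN1r. Qed.
Lemma ipNr X (f h : l2 X) : ip h (- f) = - ip h f.
Proof. by rewrite ipC ipNl conjcN -ipC. Qed.
Lemma ipBl X (f g h : l2 X) : ip (f - g) h = ip f h - ip g h.
Proof. by rewrite ipDl ipNl. Qed.
Lemma ipBr X (f g h : l2 X) : ip h (f - g) = ip h f - ip h g.
Proof. by rewrite ipDr ipNr. Qed.
Lemma ip_suml X I (s : seq I) (F : I -> l2 X) h :
  ip (\sum_(i <- s) F i) h = \sum_(i <- s) ip (F i) h.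
Proof.
elim: s => [|i s IH]; first by rewrite !big_nil ip0l.
by rewrite !big_cons ipDl IH.
Qed.
Lemma ip_sumr X I (s : seq I) (F : I -> l2 X) h :
  ip h (\sum_(i <- s) F i) = \sum_(i <- s) ip h (F i).
Proof.
elim: s => [|i s IH]; first by rewrite !big_nil ip0r.
by rewrite !big_cons ipDr IH.
Qed.

Lemma ip_norm X (f : l2 X) : ip f f = ((l2norm f ^+ 2)%:C)%C.
Proof.
rewrite !ipE (_ : (fun x => _) = fun x => ((nc (f x) ^+ 2)%:C)%C); last first.
  apply/funext => x; apply: cpx_ext; rewrite ?cReM ?cImM /= ?nc_sqr; case: (f x) => a b /=; ring.
rewrite csum_real rsum_pos //; last by move=> x; rewrite sqr_ge0.
rewrite /l2norm sqr_sqrtr // fine_ge0 // esum_ge0 // => x _.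
by rewrite lee_fin sqr_ge0.
Qed.

Lemma l2norm_Re X (f : l2 X) : l2norm f ^+ 2 = complex.Re (ip f f).
Proof. by rewrite ip_norm. Qed.

Lemma l2norm0 X : l2norm (0 : l2 X) = 0.
Proof. by apply/eqP; rewrite -sqrf_eq0 l2norm_Re ip0l. Qed.

Lemma sqsum_fin_num X (f : l2 X) : sqsum f \is a fin_num.
Proof. by rewrite ge0_fin_numE ?sqsum_ge0 ?sqsum_fin. Qed.

Lemma nc_le_l2norm X (f : l2 X) x : nc (f x) <= l2norm f.
Proof.
rewrite -ler_sqr ?nnegrE ?nc_ge0 ?l2norm_ge0 // -lee_fin l2normE /sqsum.
rewrite -(@esum_set1 _ _ x (fun x => (nc (f x) ^+ 2)%:E)) ?lee_fin ?sqr_ge0 //.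
rewrite esum_mkcond; apply: le_esum => y _.
by case: ifP => // _; rewrite lee_fin sqr_ge0.
Qed.

Lemma nc_eq0 (z : C) : nc z = 0 -> z = 0.
Proof. exact: Normc.eq0_normc. Qed.

Lemma nc_le0 (z : C) : nc z <= 0 -> z = 0.
Proof. by move=> z0; apply: nc_eq0; apply/le_anti; rewrite z0 nc_ge0. Qed.

Lemma l2norm_eq0 X (f : l2 X) : l2norm f = 0 -> f = 0.
Proof.
by move=> f0; apply: l2_ext => x; apply: nc_le0; rewrite -f0 nc_le_l2norm.
Qed.

Lemma l2normZ X (c : C) (f : l2 X) : l2norm (c *: f) = nc c * l2norm f.
Proof.
apply/eqP; rewrite -(@eqrXn2 _ 2) ?mulr_ge0 ?nc_ge0 ?l2norm_ge0 //; apply/eqP.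
rewrite exprMn !l2norm_Re ipZl ipZr ip_norm !cReM !cImM nc_sqr /=.
case: c => a b /=; ring.
Qed.

Lemma l2normN X (f : l2 X) : l2norm (- f) = l2norm f.
Proof. by rewrite -scaleN1r l2normZ ncN Normc.normc1 mul1r. Qed.

Lemma ncZ2 (a : C) : a * a^*%C = ((nc a ^+ 2)%:C)%C.
Proof. by apply: cpx_ext; rewrite ?cReM ?cImM /= ?nc_sqr; case: a => u v /=; ring. Qed.

Lemma cauchy_schwarz X (f g : l2 X) : nc (ip f g) <= l2norm f * l2norm g.
Proof.
rewrite -ler_sqr ?nnegrE ?nc_ge0 ?mulr_ge0 ?l2norm_ge0 //.
have [/eqP|g0] := eqVneq (l2norm g) 0.
  move=> /eqP /l2norm_eq0 ->; rewrite ip0r nc0 ?expr0n.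
  by rewrite sqr_ge0.
set a := ip f g; set t := l2norm g ^+ 2.
have t0 : 0 < t by rewrite exprn_gt0 // lt_neqAle eq_sym g0 l2norm_ge0.
have : 0 <= l2norm ((t%:C)%C *: f - a *: g) ^+ 2 by rewrite sqr_ge0.
rewrite l2norm_Re ipBl !ipBr !ipZl !ipZr !ip_norm -/a (ipC g f) -/a -/t.
rewrite conjcR.
have -> : t%:C%C * (t%:C%C * (l2norm f ^+ 2)%:C%C) - t%:C%C * (cj a * a) -
   (a * (t%:C%C * cj a) - a * (cj a * t%:C%C)) =
   t%:C%C * (t%:C%C * (l2norm f ^+ 2)%:C%C - a * cj a) by ring.
rewrite ncZ2 -rmorphM -rmorphB -rmorphM.
rewrite /= pmulr_rge0 // subr_ge0 => /le_trans; apply.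
by rewrite exprMn mulrC.
Qed.

Lemma l2normD X (f g : l2 X) : l2norm (f + g) <= l2norm f + l2norm g.
Proof.
rewrite -ler_sqr ?nnegrE ?addr_ge0 ?l2norm_ge0 // (l2norm_Re (f + g)) ipDl !ipDr !cReD -(l2norm_Re f) -(l2norm_Re g).
have h1 := le_trans (ler_norm _) (le_trans (Re_le_nc (ip f g)) (cauchy_schwarz f g)).
have h2 := le_trans (ler_norm _) (le_trans (Re_le_nc (ip g f)) (cauchy_schwarz g f)).
by rewrite sqrrD; move: h1 h2; rewrite (mulrC (l2norm g)); lra.
Qed.


Lemma pythagoras X (f g : l2 X) : ip f g = 0 ->
  l2norm (f + g) ^+ 2 = l2norm f ^+ 2 + l2norm g ^+ 2.
Proof.
move=> fg; rewrite (l2norm_Re (f + g)) ipDl !ipDr fg [ip g f]ipC fg conjc0.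
by rewrite addr0 add0r cReD -(l2norm_Re f) -(l2norm_Re g).
Qed.

Lemma ip_eq X (f g : l2 X) : (forall h, ip f h = ip g h) -> f = g.
Proof.
move=> fg; apply/eqP; rewrite -subr_eq0; apply/eqP; apply: l2norm_eq0.
by apply/eqP; rewrite -sqrf_eq0 l2norm_Re ipBl fg subrr.
Qed.

Lemma ip_eqr X (f g : l2 X) : (forall h, ip h f = ip h g) -> f = g.
Proof. by move=> fg; apply: ip_eq => h; rewrite ipC fg -ipC. Qed.

Lemma std_vec_pred X (x : X) : (fun y => (y == x)%:R) \in @l2_pred R X.
Proof.
rewrite unfold_in /l2_pred /sqsum.
rewrite (_ : (\esum_(v in _) _)%E = (\esum_(v in [set x]) 1)%E).
  by rewrite esum_set1 ?lee01 // ltry.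
rewrite [RHS]esum_mkcond; apply: eq_esum => v _.
case: eqVneq => [->|vw].
  by rewrite mem_set // (_ : nc _ = 1) ?expr1n //; exact: Normc.normc1.
rewrite memNset; last by move=> /eqP; rewrite (negbTE vw).
by rewrite (_ : nc _ = 0) ?expr0n //; exact: Normc.normc0.
Qed.
Definition std_vec X (x : X) : l2 X := L2 (std_vec_pred x).

Lemma std_vecE X (x y : X) : std_vec x y = (y == x)%:R. Proof. by []. Qed.

Lemma ip_std_vec X (f : l2 X) x : ip f (std_vec x) = f x.
Proof.
rewrite !ipE (@csum_pt _ _ _ x) => [|y yx] /=.
  by rewrite eqxx conjc1 mulr1.
by rewrite (negbTE yx) conjc0 mulr0.
Qed.

Lemma ip_std_vecl X (f : l2 X) x : ip (std_vec x) f = (f x)^*%C.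
Proof. by rewrite ipC ip_std_vec. Qed.

Definition trunc X (f : l2 X) (s : seq X) : l2 X := \sum_(x <- s) f x *: std_vec x.

Lemma ip_trunc X (f : l2 X) s : uniq s ->
  ip f (trunc f s) = ((\sum_(x <- s) nc (f x) ^+ 2)%:C)%C.
Proof.
move=> _; rewrite /trunc ip_sumr sumC; apply: eq_bigr => x _.
by rewrite ipZr ip_std_vec mulrC ncZ2.
Qed.

Lemma trunc_eval X (f : l2 X) s x : uniq s -> trunc f s x = if x \in s then f x else 0.
Proof.
move=> us; rewrite -ip_std_vec /trunc ip_suml.
under eq_bigr do rewrite ipZl ip_std_vec std_vecE.
case: ifPn => xs.
  rewrite (bigD1_seq x) //= eqxx mulr1 big1 ?addr0 // => y yx.
  by rewrite eq_sym (negbTE yx) mulr0.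
rewrite big_seq big1 // => y ys; case: eqP => [xy|]; last by rewrite mulr0.
by rewrite xy ys in xs.
Qed.

Lemma l2norm_trunc X (f : l2 X) s : uniq s ->
  l2norm (trunc f s) ^+ 2 = \sum_(x <- s) nc (f x) ^+ 2.
Proof.
move=> us; rewrite l2norm_Re {2}/trunc ip_sumr -[RHS]/(complex.Re ((\sum_(x <- s) nc (f x) ^+ 2)%:C)%C).
rewrite sumC; congr complex.Re; rewrite !big_seq; apply: eq_bigr => x xs.
by rewrite ipZr ip_std_vec trunc_eval // xs mulrC ncZ2.
Qed.

Lemma l2norm_truncB X (f : l2 X) s : uniq s ->
  l2norm (f - trunc f s) ^+ 2 = l2norm f ^+ 2 - \sum_(x <- s) nc (f x) ^+ 2.
Proof.
move=> us; rewrite l2norm_Re ipBl !ipBr [ip (trunc f s) f]ipC ip_trunc // conjcR.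
rewrite !(cReD, cReN) -(l2norm_Re f) -(l2norm_Re (trunc f s)) l2norm_trunc //= ; ring.
Qed.

Lemma trunc_approx X (f : l2 X) (e : R) : 0 < e ->
  exists2 s, uniq s & l2norm (f - trunc f s) < e.
Proof.
move=> e0; have : (sqsum f - (e ^+ 2)%:E < sqsum f)%E.
  by rewrite lteBlDr // lteDl ?sqsum_fin_num // lte_fin exprn_gt0.
rewrite {2}/sqsum /esum => /ereal_sup_gt [_ [A [finA _] <-] lt].
exists (enum_fset (fset_set A)); first exact: fset_uniq.
rewrite -ltr_sqr ?nnegrE ?l2norm_ge0 ?ltW // l2norm_truncB ?fset_uniq //.
rewrite fsbig_finite //= -l2normE sumEFin in lt.
by move: lt; rewrite -EFinB lte_fin ltrBlDr addrC -ltrBlDr.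
Qed.

Lemma sqsum_le X (h : X -> C) (M : R) :
  (forall s, uniq s -> \sum_(x <- s) nc (h x) ^+ 2 <= M) -> (sqsum h <= M%:E)%E.
Proof.
move=> hM; apply: ge_ereal_sup => _ [A [finA _] <-].
by rewrite fsbig_finite //= sumEFin lee_fin hM // fset_uniq.
Qed.

Lemma l2norm_le X (f : l2 X) (M : R) : 0 <= M ->
  (forall s, uniq s -> \sum_(x <- s) nc (f x) ^+ 2 <= M ^+ 2) -> l2norm f <= M.
Proof.
move=> M0 fM; rewrite -ler_sqr ?nnegrE ?l2norm_ge0 // -lee_fin l2normE.
exact: sqsum_le.
Qed.

Lemma le0_eps (x K : R) : 0 <= K -> (forall e : R, 0 < e -> x <= K * e) -> x <= 0.
Proof.
move=> K0 h; rewrite leNgt; apply/negP => x0.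
have K1 : 0 < K + 1 by rewrite ltr_wpDl.
have := h (x / (K + 1)) (divr_gt0 x0 K1).
rewrite mulrA ler_pdivlMr // => H.
have : x * K + x <= K * x by rewrite -{2}(mulr1 x) -mulrDr.
by rewrite mulrC gerDl leNgt x0.
Qed.

(** The coordinates of the representing vector are the conjugates of the values of
phi on the standard basis.  Testing phi on finite truncations bounds its norm by
M, and density of the truncations identifies phi. *)
Lemma riesz X (phi : l2 X -> C) (M : R) : 0 <= M ->
  (forall c f g, phi (c *: f + g) = c * phi f + phi g) ->
  (forall f, nc (phi f) <= M * l2norm f) ->
  exists2 h, (forall f, phi f = ip f h) & l2norm h <= M.
Proof.
move=> M0 lin bd.
have phi0 : phi 0 = 0 by apply: nc_le0; apply: le_trans (bd 0) _; rewrite l2norm0 mulr0.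
have phiZ c f : phi (c *: f) = c * phi f by rewrite -[c *: f]addr0 lin phi0 addr0.
have phiD f g : phi (f + g) = phi f + phi g by rewrite -{1}[f]scale1r lin mul1r.
have phiS s (F : X -> l2 X) : phi (\sum_(x <- s) F x) = \sum_(x <- s) phi (F x).
  by elim: s => [|x s IH]; rewrite ?big_nil // !big_cons phiD IH.
pose h x := (phi (std_vec x))^*%C.
have hM s : uniq s -> \sum_(x <- s) nc (h x) ^+ 2 <= M ^+ 2.
  move=> us; set S := \sum_(x <- s) _.
  have S0 : 0 <= S by apply: sumr_ge0 => x _; rewrite sqr_ge0.
  pose f := \sum_(x <- s) h x *: std_vec x.
  have phif : phi f = (S%:C)%C.
    rewrite /f phiS sumC; apply: eq_bigr => x _.
    by rewrite phiZ -ncZ2 /h conjcKK.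
  have fx x : x \in s -> f x = h x.
    move=> xs; rewrite -ip_std_vec /f ip_suml (bigD1_seq x) //= ipZl ip_std_vec std_vecE eqxx mulr1.
    rewrite big1 ?addr0 // => y yx; rewrite ipZl ip_std_vec std_vecE.
    by rewrite eq_sym (negbTE yx) mulr0.
  have nf : l2norm f ^+ 2 = S.
    rewrite l2norm_Re -[RHS]/(complex.Re (S%:C)%C); congr complex.Re.
    rewrite {2}/f ip_sumr sumC !big_seq; apply: eq_bigr => x xs.
    by rewrite ipZr ip_std_vec fx // mulrC ncZ2.
  have := bd f; rewrite phif nc_real // -{1}nf expr2.
  have [/eqP|f0] := eqVneq (l2norm f) 0.
    by move=> /eqP f0; rewrite -nf f0 expr0n sqr_ge0.
  rewrite ler_pM2r; last by rewrite lt_neqAle eq_sym f0 l2norm_ge0.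
  by move=> ?; rewrite -nf ler_sqr ?nnegrE ?l2norm_ge0.
have hl2 : h \in @l2_pred R X.
  by rewrite unfold_in; apply: le_lt_trans (sqsum_le hM) _; rewrite ltry.
exists (L2 hl2); last exact: l2norm_le.
move=> f; apply/eqP; rewrite -subr_eq0; apply/eqP; apply: nc_le0.
set H := L2 hl2.
apply: (@le0_eps _ (M + l2norm H)); first by rewrite addr_ge0 ?l2norm_ge0.
move=> e e0; have [s us fs] := trunc_approx f e0.
have E : phi (trunc f s) = ip (trunc f s) H.
  rewrite /trunc phiS ip_suml; apply: eq_bigr => x _.
  by rewrite phiZ ipZl ip_std_vecl /= /h conjcKK.
have -> : phi f - ip f H = phi (f - trunc f s) - ip (f - trunc f s) H.
  rewrite ipBl phiD -[- trunc f s]scaleN1r phiZ mulN1r E; ring.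
apply: le_trans (@le_normcD R _ _) _; rewrite ncN mulrDl.
apply: lerD; first by apply: le_trans (bd _) _; rewrite ler_wpM2l // ltW.
apply: le_trans (cauchy_schwarz _ _) _; rewrite mulrC.
by rewrite ler_wpM2l ?l2norm_ge0 // ltW.
Qed.

Lemma bopD X Y (T : bop X Y) f g : T (f + g) = T f + T g.
Proof. by rewrite -{1}[f]scale1r bop_linear scale1r. Qed.
Lemma bop0 X Y (T : bop X Y) : T 0 = 0.
Proof. by apply: (addIr (T 0)); rewrite -bopD !add0r. Qed.
Lemma bopZ X Y (T : bop X Y) c f : T (c *: f) = c *: T f.
Proof. by rewrite -[c *: f]addr0 bop_linear bop0 addr0. Qed.
Lemma bopN X Y (T : bop X Y) f : T (- f) = - T f.
Proof. by rewrite -scaleN1r bopZ scaleN1r. Qed.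
Lemma bopB X Y (T : bop X Y) f g : T (f - g) = T f - T g.
Proof. by rewrite bopD bopN. Qed.
Lemma bop_sum X Y (T : bop X Y) I (s : seq I) (F : I -> l2 X) :
  T (\sum_(i <- s) F i) = \sum_(i <- s) T (F i).
Proof.
by elim: s => [|i s IH]; rewrite ?big_nil ?bop0 // !big_cons bopD IH.
Qed.

Lemma bop_gt0 X Y (T : bop X Y) : exists2 M : R, 0 < M &
  forall f, l2norm (T f) <= M * l2norm f.
Proof.
have [M M0 TM] := bop_bounded T; exists (M + 1); first by rewrite ltr_wpDl.
move=> f; apply: le_trans (TM f) _; rewrite ler_wpM2r ?l2norm_ge0 //.
by rewrite lerDl.
Qed.

(** Operators are built below from bounded sesquilinear forms, by the Riesz
representation of each form in its second variable. *)
Lemma form_bop X Y (b : l2 X -> l2 Y -> C) (M : R) : 0 <= M ->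
  (forall c f f' g, b (c *: f + f') g = c * b f g + b f' g) ->
  (forall c f g g', b f (c *: g + g') = cj c * b f g + b f g') ->
  (forall f g, nc (b f g) <= M * l2norm f * l2norm g) ->
  exists2 T : bop X Y, (forall f g, ip (T f) g = b f g) &
    forall f, l2norm (T f) <= M * l2norm f.
Proof.
move=> M0 linl linr bd.
have ex f : exists h, (forall g, ip h g = b f g) /\ l2norm h <= M * l2norm f.
  have [|||h hE hM] := @riesz _ (fun g => (b f g)^*%C) (M * l2norm f).
  - by rewrite mulr_ge0 ?l2norm_ge0.
  - by move=> c g g'; rewrite linr conjcD conjcM conjcKK.
  - by move=> g; rewrite ncJ.
  by exists h; split=> // g; rewrite ipC -hE conjcKK.
pose T f := projT1 (cid (ex f)).
have TE f g : ip (T f) g = b f g by rewrite /T; case: cid => h [/= ->].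
have TM f : l2norm (T f) <= M * l2norm f by rewrite /T; case: cid => h [].
have Tb : T \in @bounded_pred R X Y.
  apply/asboolP; split; last by exists M.
  by move=> c f g; apply: ip_eq => h; rewrite ipDl ipZl !TE linl.
by exists (Bop Tb).
Qed.

(** The bound is stated for every M that bounds T: the adjoint of a contraction
must come out as a contraction. *)
Lemma adj_ex X Y (T : bop X Y) : exists S : bop Y X,
  (forall f g, ip (T f) g = ip f (S g)) /\
  forall M, 0 <= M -> (forall f, l2norm (T f) <= M * l2norm f) ->
    forall g, l2norm (S g) <= M * l2norm g.
Proof.
have [M M0 TM] := bop_bounded T.
have [||||S SE _] := @form_bop Y X (fun g f => ip g (T f)) M.
- by [].
- by move=> c f f' g; rewrite ipDl ipZl.
- by move=> c f g g'; rewrite bopD bopZ ipDr ipZr.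
- move=> g f; apply: le_trans (cauchy_schwarz _ _) _.
  by rewrite mulrAC [leLHS]mulrC ler_wpM2r ?l2norm_ge0 // -mulrA mulrC -mulrA TM.
have SA f g : ip (T f) g = ip f (S g) by rewrite ipC [RHS]ipC SE.
exists S; split=> // N N0 TN g.
have [/eqP|Sg0] := eqVneq (l2norm (S g)) 0.
  by move=> /eqP ->; rewrite mulr_ge0 ?l2norm_ge0.
rewrite -(@ler_pM2l _ (l2norm (S g))); last by rewrite lt_neqAle eq_sym Sg0 l2norm_ge0.
rewrite -expr2 l2norm_Re -SA; apply: le_trans (ler_norm _) _.
apply: le_trans (Re_le_nc _) _; apply: le_trans (cauchy_schwarz _ _) _.
by rewrite mulrCA mulrA ler_wpM2r ?l2norm_ge0.
Qed.

Definition adj X Y (T : bop X Y) : bop Y X := projT1 (cid (adj_ex T)).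

Lemma adjE X Y (T : bop X Y) f g : ip (T f) g = ip f (adj T g).
Proof. by rewrite /adj; case: cid => S [/= SE _]. Qed.

Lemma adjEr X Y (T : bop X Y) f g : ip (adj T f) g = ip f (T g).
Proof. by rewrite ipC -adjE -ipC. Qed.

Lemma adj_norm X Y (T : bop X Y) M : 0 <= M ->
  (forall f, l2norm (T f) <= M * l2norm f) ->
  forall g, l2norm (adj T g) <= M * l2norm g.
Proof. by rewrite /adj; case: cid => S [/= _]; apply. Qed.

Lemma adj_eq X Y (T : bop X Y) (S : bop Y X) :
  (forall f g, ip (T f) g = ip f (S g)) -> adj T = S.
Proof. by move=> TS; apply: bop_ext => g; apply: ip_eqr => f; rewrite -adjE. Qed.

Lemma adjK X Y (T : bop X Y) : adj (adj T) = T.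
Proof. by apply: adj_eq => f g; rewrite adjEr. Qed.

Lemma adj_comp X Y Z (S : bop Y Z) (T : bop X Y) :
  adj (bcomp S T) = bcomp (adj T) (adj S).
Proof. by apply: adj_eq => f g; rewrite /= !adjE. Qed.

Lemma bop_std_vec X Y (S T : bop X Y) : (forall x, S (std_vec x) = T (std_vec x)) -> S = T.
Proof.
move=> ST; rewrite -[S]adjK -[T]adjK; congr adj.
apply: bop_ext => g; apply: l2_ext => x.
by rewrite -!ip_std_vec !adjEr ST.
Qed.

(** The limit is sup (u n - e n), because every u n - e n is below every
u m + e m.  The explicit rate e makes filters unnecessary. *)
Lemma real_cauchy (u : nat -> R) (e : nat -> R) :
  (forall n m, `|u n - u m| <= e n + e m) -> exists l, forall n, `|u n - l| <= e n.
Proof.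
move=> cau; have H n m : u n - e n <= u m + e m.
  by have := cau n m; rewrite ler_norml => /andP [_]; lra.
pose S := [set x | exists n, x = u n - e n].
have S0 : S !=set0 by exists (u 0%N - e 0%N); exists 0%N.
have ubS m : ubound S (u m + e m) by move=> _ [n ->].
exists (sup S) => n; rewrite ler_norml; apply/andP; split.
  by have := ge_sup S0 (ubS n); lra.
have : u n - e n <= sup S by apply: ub_le_sup; [exists (u n + e n)|exists n].
by lra.
Qed.

Lemma complex_cauchy (u : nat -> C) (e : nat -> R) :
  (forall n m, nc (u n - u m) <= e n + e m) ->
  exists l, forall n, nc (u n - l) <= 2 * e n.
Proof.
move=> cau.
have [a aE] : exists l, forall n, `|complex.Re (u n) - l| <= e n.
  apply: real_cauchy => n m; apply: le_trans (cau n m).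
  by apply: le_trans (Re_le_nc _); case: (u n) (u m) => [? ?] [? ?].
have [b bE] : exists l, forall n, `|complex.Im (u n) - l| <= e n.
  apply: real_cauchy => n m; apply: le_trans (cau n m).
  by apply: le_trans (Im_le_nc _); case: (u n) (u m) => [? ?] [? ?].
exists (Complex a b) => n.
have e0 : 0 <= e n by apply: le_trans (aE n).
rewrite -ler_sqr ?nnegrE ?nc_ge0 ?mulr_ge0 // nc_sqr.
have h1 := aE n; have h2 := bE n; rewrite -ler_sqr ?nnegrE // real_normK ?num_real // in h1.
rewrite -ler_sqr ?nnegrE // real_normK ?num_real // in h2.
move: h1 h2; case: (u n) => x y /= h1 h2.
have := sqr_ge0 (e n); rewrite exprMn; move: h1 h2; set p := (_ - _) ^+ 2; set q := (_ - _) ^+ 2; lra.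
Qed.

(** Annihilators are the only closed subspaces that occur, so they stand in for
closed subspaces in general. *)
Definition ann X (A : set (l2 X)) : set (l2 X) :=
  [set f | forall a, A a -> ip f a = 0].

Lemma ann_lin X (A : set (l2 X)) c f g : ann A f -> ann A g -> ann A (c *: f + g).
Proof. by move=> fA gA a Aa; rewrite ipDl ipZl fA // gA // mulr0 addr0. Qed.

Lemma ann0 X (A : set (l2 X)) : ann A 0.
Proof. by move=> a _; rewrite ip0l. Qed.

Lemma annB X (A : set (l2 X)) f g : ann A f -> ann A g -> ann A (f - g).
Proof.
by move=> fA gA; rewrite addrC -scaleN1r; apply: ann_lin.
Qed.

(** The variational inequality: a point g of the subspace that nearly minimises the
distance to f has f - g nearly orthogonal to the subspace.  It is obtained by
moving g along h by the optimal coefficient <f - g, h> / |h|^2. *)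
Lemma ann_near X (A : set (l2 X)) (f g : l2 X) (del e : R) : 0 <= e ->
  (forall g, ann A g -> del <= l2norm (f - g) ^+ 2) -> ann A g ->
  l2norm (f - g) ^+ 2 <= del + e ^+ 2 ->
  forall h, ann A h -> nc (ip (f - g) h) <= e * l2norm h.
Proof.
move=> e0 delP gA fge h hA.
have [/eqP|h0] := eqVneq (l2norm h) 0.
  move=> /eqP /l2norm_eq0 ->; rewrite ip0r l2norm0 mulr0.
  by rewrite nc0.
set t := l2norm h ^+ 2; set c := ip (f - g) h.
have t0 : 0 < t by rewrite exprn_gt0 // lt_neqAle eq_sym h0 l2norm_ge0.
rewrite -ler_sqr ?nnegrE ?nc_ge0 ?mulr_ge0 ?l2norm_ge0 // exprMn -/t.
set k := (t^-1)%:C%C * c.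
have /delP : ann A (k *: h + g) by exact: ann_lin.
rewrite opprD addrCA addrC l2norm_Re.
move: fge; rewrite -/c; set u := f - g in c k * => fge; clearbody u.
rewrite (_ : ip _ _ = ((l2norm u ^+ 2 - nc c ^+ 2 / t)%:C)%C); last first.
  have kJ : cj k = (t^-1)%:C%C * cj c by rewrite conjcM conjcR.
  have tk : (t^-1)%:C%C * t%:C%C = 1 :> C by rewrite -rcM mulVf ?gt_eqF.
  rewrite ipBl !ipBr !ipZl !ipZr !ip_norm [ip h u]ipC -/c -/t kJ.
  rewrite rcB (rcM (nc c ^+ 2)) -ncZ2 /k.
  transitivity ((l2norm u ^+ 2)%:C%C - (t^-1)%:C%C * (c * cj c) * (2 - (t^-1)%:C%C * t%:C%C)); first by ring.
  by rewrite tk; ring.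
rewrite cReR => le1; have : nc c ^+ 2 / t <= e ^+ 2.
  by move: le1 fge; set q := nc c ^+ 2 / t; lra.
by rewrite ler_pdivrMr.
Qed.

(** A minimising sequence is Cauchy by ann_near.  Its limit is taken weakly: the
functionals h |-> <h, g n> converge, and the limit functional is represented by
riesz, so completeness of l2 is never needed. *)
Lemma ann_proj_ex X (A : set (l2 X)) (f : l2 X) :
  exists g, ann A g /\ forall h, ann A h -> ip (f - g) h = 0.
Proof.
pose D := [set x : R | exists2 g, ann A g & x = l2norm (f - g) ^+ 2].
have D0 : D !=set0 by exists (l2norm (f - 0) ^+ 2); exists 0 => //; exact: ann0.
have lbD : lbound D 0 by move=> _ [g _ ->]; rewrite sqr_ge0.
pose del := inf D.
have delP g : ann A g -> del <= l2norm (f - g) ^+ 2.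
  by move=> gA; apply: ge_inf; [exists 0|exists g].
(* e n bounds the inner products of f - g n with the subspace, whence the square
   in the distance defect. *)
pose e n : R := n.+1%:R^-1.
have e_gt0 n : 0 < e n by rewrite invr_gt0.
have ex n : exists g, ann A g /\ l2norm (f - g) ^+ 2 <= del + e n ^+ 2.
  have [|_ [g gA ->] lt] := @inf_adherent _ D (e n ^+ 2) _ (conj D0 (ex_intro _ 0 lbD)).
    by rewrite exprn_gt0.
  by exists g; split => //; exact: ltW.
pose g n := projT1 (cid (ex n)).
have gA n : ann A (g n) by rewrite /g; case: cid => ? [].
have gd n : l2norm (f - g n) ^+ 2 <= del + e n ^+ 2 by rewrite /g; case: cid => ? [].
have near n h : ann A h -> nc (ip (f - g n) h) <= e n * l2norm h.
  by move=> hA; apply: (ann_near (ltW (e_gt0 n)) delP (gA n) (gd n)).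
have cau n m : l2norm (g n - g m) <= e n + e m.
  have [/eqP|n0] := eqVneq (l2norm (g n - g m)) 0.
    by move=> /eqP ->; rewrite addr_ge0 // ltW.
  rewrite -(@ler_pM2r _ (l2norm (g n - g m))); last by rewrite lt_neqAle eq_sym n0 l2norm_ge0.
  rewrite -expr2 l2norm_Re; apply: le_trans (ler_norm _) _.
  apply: le_trans (Re_le_nc _) _.
  have hA : ann A (g n - g m) by exact: annB.
  have -> : ip (g n - g m) (g n - g m) =
     ip (f - g m) (g n - g m) - ip (f - g n) (g n - g m).
    by rewrite -ipBl subBB.
  apply: le_trans (@le_normcD R _ _) _; rewrite ncN mulrDl addrC.
  by apply: lerD; exact: near.
have lim h : exists l, forall n, nc (ip h (g n) - l) <= 2 * (l2norm h * e n).
  apply: complex_cauchy => n m; rewrite -ipBr -mulrDr.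
  by apply: le_trans (cauchy_schwarz _ _) _; rewrite ler_wpM2l ?l2norm_ge0.
pose phi h := projT1 (cid (lim h)).
have phiP h n : nc (ip h (g n) - phi h) <= 2 * (l2norm h * e n).
  by rewrite /phi; case: cid.
have small (z : C) K : 0 <= K -> (forall n, nc z <= K * e n) -> z = 0.
  move=> K0 zK; apply: nc_le0; apply: (le0_eps K0) => r r0.
  pose n := Num.truncn r^-1.
  apply: le_trans (zK n) _; rewrite ler_wpM2l //.
  rewrite /e -[leRHS]invrK lef_pV2 ?posrE ?invr_gt0 //.
  by rewrite ltW // truncnS_gt.
have phi_lin c h k : phi (c *: h + k) = c * phi h + phi k.
  apply/eqP; rewrite -subr_eq0; apply/eqP.
  apply: (small _ (2 * l2norm (c *: h + k) + nc c * (2 * l2norm h) + 2 * l2norm k)).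
    by rewrite !addr_ge0 ?mulr_ge0 ?nc_ge0 ?l2norm_ge0.
  move=> n; have -> : phi (c *: h + k) - (c * phi h + phi k) =
     - (ip (c *: h + k) (g n) - phi (c *: h + k)) +
     c * (ip h (g n) - phi h) + (ip k (g n) - phi k).
    by rewrite ipDl ipZl; ring.
  apply: le_trans (@le_normcD R _ _) _; rewrite mulrDl; apply: lerD; last first.
    by rewrite -mulrA.
  apply: le_trans (@le_normcD R _ _) _; rewrite mulrDl; apply: lerD.
    by rewrite ncN -mulrA.
  by rewrite Normc.normcM -!mulrA ler_wpM2l ?nc_ge0.
have phi_bd h : nc (phi h) <= (l2norm (g 0%N) + 2) * l2norm h.
  have -> : phi h = ip h (g 0%N) + - (ip h (g 0%N) - phi h) by ring.
  apply: le_trans (@le_normcD R _ _) _; rewrite mulrDl; apply: lerD.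
    by rewrite mulrC cauchy_schwarz.
  by rewrite ncN; have := phiP h 0%N; rewrite /e invr1 mulr1.
have [|g' g'E _] := riesz _ phi_lin phi_bd; first by rewrite addr_ge0 ?l2norm_ge0.
exists g'; split.
  move=> a Aa; rewrite ipC -g'E; apply/eqP; rewrite conjc_eq0; apply/eqP.
  apply: (small _ (2 * l2norm a)); first by rewrite mulr_ge0 ?l2norm_ge0.
  move=> n; have := phiP a n.
  by rewrite [ip a (g n)]ipC gA // conjc0 sub0r ncN mulrA.
move=> h hA; apply: (small _ (l2norm h + 2 * l2norm h)).
  by rewrite addr_ge0 ?mulr_ge0 ?l2norm_ge0.
move=> n; have -> : ip (f - g') h = ip (f - g n) h + cj (ip h (g n) - phi h).
  by rewrite conjcB -ipC g'E -ipC !ipBl; ring.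
apply: le_trans (@le_normcD R _ _) _; rewrite mulrDl; apply: lerD.
  by rewrite mulrC near.
by rewrite ncJ -mulrA.
Qed.

Lemma ann_proj X (A : set (l2 X)) : exists P : bop X X,
  forall f, ann A (P f) /\ forall h, ann A h -> ip (f - P f) h = 0.
Proof.
pose P f := projT1 (cid (ann_proj_ex A f)).
have PA f : ann A (P f) by rewrite /P; case: cid => ? [].
have PP f h : ann A h -> ip (f - P f) h = 0.
  by rewrite /P; case: cid => ? [? /= H] /H.
have uniq f g : ann A g -> (forall h, ann A h -> ip (f - g) h = 0) -> P f = g.
  move=> gA fg; have dA : ann A (P f - g) by exact: annB.
  apply/eqP; rewrite -subr_eq0; apply/eqP; apply: l2norm_eq0; apply/eqP.
  rewrite -sqrf_eq0 l2norm_Re.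
  have {1}-> : P f - g = (f - g) - (f - P f) by rewrite subBB.
  by rewrite ipBl PP // fg // subr0.
have Pb : P \in @bounded_pred R X X.
  apply/asboolP; split.
    move=> c f g; apply: uniq; first exact: ann_lin.
    move=> h hA.
    have -> : c *: f + g - (c *: P f + P g) = c *: (f - P f) + (g - P g).
      by rewrite scalerBr opprD addrACA.
    rewrite ipDl (PP g _ hA) addr0 ipZl (PP f _ hA).
    by rewrite mulr0.
  exists 1 => // f; rewrite mul1r.
  rewrite -ler_sqr ?nnegrE ?l2norm_ge0 //.
  have -> : l2norm f ^+ 2 = l2norm (P f) ^+ 2 + l2norm (f - P f) ^+ 2.
    by rewrite -{1}(subrK (P f) f) (pythagoras (PP f _ (PA f))) addrC.
  by rewrite lerDl sqr_ge0.
by exists (Bop Pb) => f; split; [exact: PA|exact: PP].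
Qed.

End hilbert_space.

(** * Topologies of pointwise convergence *)

Section pointwise_topology.
Context {R : realType} (S : choiceType) (I : eqType).
Local Notation nc := (@Normc.normc R).
Local Notation C := R[i].
Variable c : S -> {ptws I -> C^o}.

Definition basic_nbhs (x : S) (U : set S) := exists (s : seq I) (e : R),
  0 < e /\ forall y, (forall i, i \in s -> nc (c y i - c x i) < e) -> U y.

Lemma basic_nbhs_filter (x : S) : Filter (basic_nbhs x).
Proof.
split.
- by exists [::], 1; split.
- move=> P Q [s [e [e0 sP]]] [t [r [r0 tQ]]].
  exists (s ++ t), (Num.min e r); split=> [|y H]; first by rewrite lt_min e0 r0.
  split; [apply: sP|apply: tQ] => i si.
    by have := H i; rewrite mem_cat si => /(_ isT); rewrite lt_min => /andP [].
  by have := H i; rewrite mem_cat si orbT => /(_ isT); rewrite lt_min => /andP [].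
- by move=> P Q PQ [s [e [e0 sP]]]; exists s, e; split=> // y /sP /PQ.
Qed.

Lemma normC_nc (z : C^o) : `|z| = (nc z)%:C%C.
Proof. by []. Qed.

Lemma gt0C (e : C) : 0 < e -> exists2 r : R, 0 < r & e = r%:C%C.
Proof.
move=> e0; exists (complex.Re e); first by move: e0; rewrite ltcE => /andP [].
by move: e0; rewrite ltcE => /andP [/eqP /= i0 _]; apply: cpx_ext.
Qed.

Lemma ptws_cvg (F : set_system (I -> C^o)) (f : {ptws I -> C^o}) :
  Filter F -> (forall i, fmap (fun g => g i) F --> f i) -> F --> f.
Proof.
move=> FF Ff; apply/cvg_sup => i U.
set T := (X in @nbhs X); rewrite (@nbhsE T) => -[B [[V oV <-] Vf] BU].
have /(Ff i) : nbhs (f i) V by exact: open_nbhs_nbhs.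
by move=> FV; exact: (@filterS _ F FF (fun g => V (g i)) U BU FV).
Qed.

Lemma ptws_ev (f : {ptws I -> C^o}) (i : I) (V : set C^o) :
  nbhs (f i) V -> nbhs f [set g | V (g i)].
Proof.
move=> fV; have FF : Filter (nbhs f) := nbhs_filter f.
have /(_ i) H := (@cvg_sup _ _ _ (nbhs f) f FF).1 (@cvg_id _ (nbhs f)).
apply: (H [set g | V (g i)]).
exact: (@initial_continuous _ _ (fun g : {ptws I -> C^o} => g i) f V fV).
Qed.

(** Both operator topologies are initial topologies for a map into a product of
copies of the complex numbers; this makes their neighbourhoods explicit. *)
Lemma initial_nbhsP (x : initial_topology c) (U : set S) :
  nbhs x U <-> basic_nbhs x U.
Proof.
split.
  rewrite nbhsE => -[B [[V oV <-] Vx] BU].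
  have FF := basic_nbhs_filter x.
  have cv : fmap c (basic_nbhs x) --> (c x : {ptws I -> C^o}).
    apply: ptws_cvg => i; apply/(@cvgrPdist_lt _ _ _ _ (fmap_filter _ (fmap_filter c FF))) => e /gt0C [r r0 ->].
    exists [:: i], r; split=> // y /(_ i); rewrite inE eqxx => /(_ isT) H /=.
    by rewrite distrC normC_nc ltcR.
  have /cv : nbhs (c x) V by exact: open_nbhs_nbhs.
  by case: FF => _ _; apply.
move=> [s [e [e0 sU]]].
suff : nbhs x [set y | forall i, i \in s -> nc (c y i - c x i) < e].
  by apply: filterS => y /sU.
elim: s {sU} => [|i s IH]; first by apply: filterS filterT => y _ i.
have : nbhs x [set y | nc (c y i - c x i) < e].
  have VC : nbhs (c x i) [set z | nc (z - c x i) < e].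
    have /cvgrPdist_lt /(_ e%:C%C) := @cvg_id _ (nbhs (c x i)).
    rewrite ltcR => /(_ e0); apply: filterS => z.
    by rewrite /= distrC normC_nc ltcR.
  exact: (@initial_continuous _ _ c x _ (ptws_ev VC)).
move: IH; apply: filterS2 => y H1 H2 j; rewrite inE => /orP [/eqP ->//|].
exact: H1.
Qed.

Lemma initial_closureP (A : set S) (x : S) :
  closure (A : set (initial_topology c)) x <->
  forall (s : seq I) (e : R), 0 < e -> exists2 y, A y &
    forall i, i \in s -> nc (c y i - c x i) < e.
Proof.
split=> [cl s e e0|H B /initial_nbhsP [s [e [e0 sB]]]].
  have [|y [Ay yB]] := cl [set y | forall i, i \in s -> nc (c y i - c x i) < e].
    by apply/initial_nbhsP; exists s, e.
  by exists y.
by have [y Ay ys] := H s e e0; exists y; split=> //; exact: sB.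
Qed.

End pointwise_topology.

(** * Tensor products *)

Section tensors.
Context {R : realType}.
Implicit Types (X Y Z : choiceType).
Local Notation l2 := (@l2 R).
Local Notation bop := (@bop R).
Local Notation reindex := (@Defs.reindex R _ _ _).

Lemma sliceE X Y (f : l2 (X * Y)%type) x y : slice f x y = f (x, y).
Proof. by []. Qed.

Lemma sliceD X Y (f g : l2 (X * Y)%type) x : slice (f + g) x = slice f x + slice g x.
Proof. exact: bopD. Qed.

Lemma sliceZ X Y c (f : l2 (X * Y)%type) x : slice (c *: f) x = c *: slice f x.
Proof. exact: bopZ. Qed.

Lemma slice_ext X Y (f g : l2 (X * Y)%type) :
  (forall x, slice f x = slice g x) -> f = g.
Proof. by move=> fg; apply: l2_ext => -[x y]; rewrite -!sliceE fg. Qed.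

Lemma ip_slice X Y (f g : l2 (X * Y)%type) :
  ip f g = csum (fun x => ip (slice f x) (slice g x)).
Proof. by rewrite ipE csum_pair //; exact: l2_csummable. Qed.


Lemma sqsum_slices X Y (f : l2 (X * Y)%type) :
  sqsum f = (\esum_(x in [set: X]) (l2norm (slice f x) ^+ 2)%:E)%E.
Proof. by rewrite sqsum_slice; apply: eq_esum => x _; rewrite l2normE. Qed.

Lemma slice_amp X Y Z (T : bop Y Z) (f : l2 (X * Y)%type) x :
  slice (amp X T f) x = T (slice f x).
Proof. exact: l2_ext. Qed.

Lemma amp_norm X Y Z (T : bop Y Z) (M : R) : 0 <= M ->
  (forall f, l2norm (T f) <= M * l2norm f) ->
  forall f : l2 (X * Y)%type, l2norm (amp X T f) <= M * l2norm f.
Proof. by move=> M0 TM f; apply/l2norm_leP => //; exact: amp_le. Qed.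

Lemma adj_amp X Y Z (T : bop Y Z) : adj (amp X T) = amp X (adj T).
Proof.
apply: adj_eq => f g; rewrite !ip_slice; congr csum; apply/funext => x.
by rewrite !slice_amp adjE.
Qed.

Lemma bcompE X Y Z (S : bop Y Z) (T : bop X Y) f : bcomp S T f = S (T f).
Proof. by []. Qed.

Lemma bidE X (f : l2 X) : bid X f = f.
Proof. by []. Qed.

Lemma amp_comp X Y Z W (S : bop Z W) (T : bop Y Z) :
  amp X (bcomp S T) = bcomp (amp X S) (amp X T).
Proof. by apply: bop_ext => f; apply: slice_ext => x; rewrite bcompE !slice_amp. Qed.

Lemma amp_id X Y : amp X (bid Y) = bid (X * Y)%type :> bop _ _.
Proof. by apply: bop_ext => f; apply: slice_ext => x; rewrite slice_amp. Qed.

Lemma addbopE X Y (S T : bop X Y) f : (S + T) f = S f + T f.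
Proof. by []. Qed.
Lemma scalebopE X Y c (T : bop X Y) f : (c *: T) f = c *: T f.
Proof. by []. Qed.
Lemma zerobopE X Y f : (0 : bop X Y) f = 0.
Proof. by []. Qed.
Lemma bcomp_linl X Y Z c (S S' : bop Y Z) (T : bop X Y) :
  bcomp (c *: S + S') T = c *: bcomp S T + bcomp S' T.
Proof. exact: bop_ext. Qed.

Lemma bcomp_linr X Y Z c (S S' : bop X Y) (T : bop Y Z) :
  bcomp T (c *: S + S') = c *: bcomp T S + bcomp T S'.
Proof. by apply: bop_ext => f; rewrite bcompE !(addbopE, scalebopE) bopD bopZ. Qed.

Lemma bcompA X Y Z W (S : bop Z W) (T : bop Y Z) (U : bop X Y) :
  bcomp S (bcomp T U) = bcomp (bcomp S T) U.
Proof. exact: bop_ext. Qed.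

Lemma bcomp1l X Y (T : bop X Y) : bcomp (bid Y) T = T.
Proof. exact: bop_ext. Qed.

Lemma bcomp1r X Y (T : bop X Y) : bcomp T (bid X) = T.
Proof. exact: bop_ext. Qed.

Lemma bcomp0l X Y Z (T : bop X Y) : bcomp (0 : bop Y Z) T = 0.
Proof. exact: bop_ext. Qed.

Lemma bcomp0r X Y Z (T : bop Y Z) : bcomp T (0 : bop X Y) = 0.
Proof. by apply: bop_ext => f; rewrite bcompE !zerobopE bop0. Qed.

Lemma amp_lin X Y Z c (S T : bop Y Z) :
  amp X (c *: S + T) = c *: amp X S + amp X T.
Proof.
apply: bop_ext => f; apply: slice_ext => x.
by rewrite addbopE scalebopE sliceD sliceZ !slice_amp.
Qed.

Lemma amp0 X Y Z : amp X (0 : bop Y Z) = 0.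
Proof. by have := amp_lin X (-1) (0 : bop Y Z) 0; rewrite scaler0 addr0 scaleN1r addNr. Qed.

Lemma slice_tensv X Y (f : l2 X) (g : l2 Y) x : slice (tensv f g) x = f x *: g.
Proof. exact: l2_ext. Qed.

Lemma amp_tensv X Y Z (T : bop Y Z) (f : l2 X) g :
  amp X T (tensv f g) = tensv f (T g).
Proof. by apply: slice_ext => x; rewrite slice_amp !slice_tensv bopZ. Qed.

Lemma tensv_linl X Y c (f f' : l2 X) (g : l2 Y) :
  tensv (c *: f + f') g = c *: tensv f g + tensv f' g.
Proof. by apply: l2_ext => -[x y]; rewrite /= mulrDl -mulrA. Qed.

Lemma tensv_linr X Y c (f : l2 X) (g g' : l2 Y) :
  tensv f (c *: g + g') = c *: tensv f g + tensv f g'.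
Proof. by apply: l2_ext => -[x y]; rewrite /= mulrDr mulrCA. Qed.

Lemma std_vec_pair X Y x y : std_vec (x, y) = tensv (std_vec x) (std_vec y) :> l2 (X * Y)%type.
Proof.
apply: l2_ext => -[a b]; rewrite /= xpair_eqE.
by case: eqP; case: eqP; rewrite ?mulr1 ?mulr0.
Qed.

Lemma bop_tensv X Y Z (S T : bop (X * Y)%type Z) :
  (forall x y, S (tensv (std_vec x) (std_vec y)) = T (tensv (std_vec x) (std_vec y))) -> S = T.
Proof. by move=> ST; apply: bop_std_vec => -[x y]; rewrite std_vec_pair. Qed.

Lemma bop_tensv3 X Y Z W (S T : bop (X * (Y * Z))%type W) :
  (forall f g h, S (tensv f (tensv g h)) = T (tensv f (tensv g h))) -> S = T.
Proof. by move=> ST; apply: bop_tensv => x [y z]; rewrite std_vec_pair. Qed.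

Lemma bop_tensv3l X Y Z W (S T : bop ((X * Y) * Z)%type W) :
  (forall f g h, S (tensv (tensv f g) h) = T (tensv (tensv f g) h)) -> S = T.
Proof. by move=> ST; apply: bop_tensv => -[x y] z; rewrite std_vec_pair. Qed.

Lemma tens_comp X Y X' Y' X'' Y'' (S : bop X X') (T : bop Y Y')
    (S' : bop X' X'') (T' : bop Y' Y'') :
  bcomp (tens S' T') (tens S T) = tens (bcomp S' S) (bcomp T' T).
Proof. by apply: bop_tensv => x y; rewrite bcompE !tensE. Qed.

Lemma tens_linl X Y X' Y' c (S S' : bop X X') (T : bop Y Y') :
  tens (c *: S + S') T = c *: tens S T + tens S' T.
Proof. by apply: bop_tensv => x y; rewrite addbopE scalebopE !tensE tensv_linl. Qed.

Lemma tens_linr X Y X' Y' c (S : bop X X') (T T' : bop Y Y') :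
  tens S (c *: T + T') = c *: tens S T + tens S T'.
Proof. by apply: bop_tensv => x y; rewrite addbopE scalebopE !tensE tensv_linr. Qed.

Lemma tens0l X Y X' Y' (T : bop Y Y') : tens (0 : bop X X') T = 0.
Proof.
by have := tens_linl (-1) (0 : bop X X') 0 T; rewrite scaler0 addr0 scaleN1r addNr.
Qed.

Lemma tens0r X Y X' Y' (S : bop X X') : tens S (0 : bop Y Y') = 0.
Proof.
by have := tens_linr (-1) S (0 : bop Y Y') 0; rewrite scaler0 addr0 scaleN1r addNr.
Qed.

Lemma amp_tens X Y Z (T : bop Y Z) : amp X T = tens (bid X) T.
Proof. by apply: bop_tensv => x y; rewrite tensE amp_tensv. Qed.

Lemma ip_tensv X Y (f f' : l2 X) (g g' : l2 Y) :
  ip (tensv f g) (tensv f' g') = ip f f' * ip g g'.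
Proof.
rewrite ip_slice mulrC (ipE f) -csumZ; last exact: l2_csummable.
congr csum; apply/funext => x; rewrite !slice_tensv ipZl ipZr.
by rewrite [RHS]mulrC -mulrA.
Qed.

Lemma adj_tens X Y X' Y' (S : bop X X') (T : bop Y Y') :
  adj (tens S T) = tens (adj S) (adj T).
Proof.
apply: bop_tensv => a b; rewrite tensE; apply: l2_ext => -[u v].
rewrite -(ip_std_vec (adj _ _)) -(ip_std_vec (tensv _ _)) std_vec_pair adjEr tensE.
by rewrite (ip_tensv (std_vec a)) (ip_tensv (adj S _)) !adjEr.
Qed.

Lemma reindexE X Y (h : Y -> X) (hI : injective h) (f : l2 X) y :
  reindex hI f y = f (h y).
Proof. by []. Qed.

Lemma reindex_std_vec X Y (h : Y -> X) (hI : injective h) y :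
  reindex hI (std_vec (h y)) = std_vec y :> l2 Y.
Proof. by apply: l2_ext => z; rewrite reindexE !std_vecE (inj_eq hI). Qed.

Lemma adj_reindex_std_vec X Y (h : Y -> X) (hI : injective h) y :
  adj (reindex hI) (std_vec y) = std_vec (h y) :> l2 X.
Proof.
apply: l2_ext => x; rewrite -ip_std_vec adjEr ip_std_vecl reindexE std_vecE std_vecE.
by rewrite eq_sym; case: eqP => _; rewrite ?conjc1 ?conjc0.
Qed.

Lemma reindex_coiso X Y (h : Y -> X) (hI : injective h) :
  bcomp (reindex hI) (adj (reindex hI)) = bid Y :> bop Y Y.
Proof. by apply: bop_std_vec => y; rewrite bcompE adj_reindex_std_vec reindex_std_vec. Qed.

Lemma reindex_norm X Y (h : Y -> X) (hI : injective h) (f : l2 X) :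
  l2norm (reindex hI f) <= 1 * l2norm f.
Proof. by apply/l2norm_leP => //; rewrite expr1n mul1e; exact: reindex_l2. Qed.

End tensors.

(** * The weak* topology *)

Section weak_star.
Context {R : realType}.
Implicit Types (X Y Z : choiceType).
Local Notation nc := (@Normc.normc R).
Local Notation C := R[i].
Local Notation l2 := (@l2 R).
Local Notation bop := (@bop R).
Local Notation reindex := (@Defs.reindex R _ _ _).

(** A square-summable sequence of vectors is one vector of l2 (nat * X), so weak*
functionals are the matrix coefficients of the amplification of T by nat. *)
Definition wcoef X (T : bop X X) (f g : l2 (nat * X)%type) : C := ip (amp nat T f) g.

Lemma vec_pred X (p : sqseq X) :
  (fun nx : nat * X => sval p nx.1 nx.2) \in @l2_pred R (nat * X)%type.
Proof.
rewrite unfold_in /l2_pred sqsum_slice.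
by case: p => f /= ff; apply: le_lt_trans ff; apply: le_esum.
Qed.
Definition vec X (p : sqseq X) : l2 (nat * X)%type := L2 (vec_pred p).

Lemma slice_vec X (p : sqseq X) n : slice (vec p) n = sval p n.
Proof. exact: l2_ext. Qed.

Lemma sq_of_subproof X (f : l2 (nat * X)%type) :
  (\esum_(n in [set: nat]) sqsum (slice f n) < +oo)%E.
Proof. by have := sqsum_fin f; rewrite sqsum_slice. Qed.
Definition sq_of X (f : l2 (nat * X)%type) : sqseq X :=
  exist _ (fun n => slice f n) (sq_of_subproof f).

Lemma sq_ofK X : cancel (@sq_of X) (@vec X).
Proof. by move=> f; apply: slice_ext => n; rewrite slice_vec. Qed.

Lemma wstar_coefE X (T : bop X X) (p : sqseq X * sqseq X) :
  wstar_coef T p = wcoef T (vec p.1) (vec p.2).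
Proof.
rewrite /wcoef ip_slice; congr csum; apply/funext => n.
by rewrite slice_amp !slice_vec.
Qed.

Definition wclose X (s : seq (l2 (nat * X)%type * l2 (nat * X)%type)) (e : R)
    (T S : bop X X) :=
  forall p, p \in s -> nc (wcoef S p.1 p.2 - wcoef T p.1 p.2) < e.

Lemma wstar_nbhsP X (T : bop X X) (U : set (bop X X)) :
  nbhs (T : wstar X) U <->
  exists s e, 0 < e /\ forall S, wclose s e T S -> U S.
Proof.
have P := @initial_nbhsP R (bop X X) {classic (sqseq X * sqseq X)} (@wstar_coef R X) T U.
split.
  move=> /P [s [e [e0 sU]]]; exists [seq (vec p.1, vec p.2) | p <- s], e.
  split=> // S H; apply: sU => p ps; rewrite !wstar_coefE.
  apply: (H (vec p.1, vec p.2)).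
  exact: (@map_f {classic (sqseq X * sqseq X)} _ (fun p => (vec p.1, vec p.2)) s p ps).
move=> [s [e [e0 sU]]]; apply/P.
exists [seq ((sq_of p.1, sq_of p.2) : {classic (sqseq X * sqseq X)}) | p <- s], e.
split=> // S H; apply: sU => p ps.
have /H : ((sq_of p.1, sq_of p.2) : {classic (sqseq X * sqseq X)}) \in
   [seq ((sq_of p.1, sq_of p.2) : {classic (sqseq X * sqseq X)}) | p <- s].
  exact: (@map_f _ {classic (sqseq X * sqseq X)} (fun p => (sq_of p.1, sq_of p.2)) s p ps).
by rewrite !wstar_coefE /= !sq_ofK.
Qed.

Lemma wstar_closureP X (A : set (bop X X)) (T : bop X X) :
  wstar_closure A T <-> forall s e, 0 < e -> exists2 S, A S & wclose s e T S.
Proof.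
split=> [cl s e e0|H B /wstar_nbhsP [s [e [e0 sB]]]].
  have [|S [AS Sc]] := cl (wclose s e T); first by apply/wstar_nbhsP; exists s, e.
  by exists S.
by have [S AS Ss] := H s e e0; exists S; split=> //; exact: sB.
Qed.

Definition wotclose X (s : seq (l2 X * l2 X)) (e : R) (T S : bop X X) :=
  forall p, p \in s -> nc (ip (S p.1) p.2 - ip (T p.1) p.2) < e.

Lemma wot_closureP X (A : set (bop X X)) (T : bop X X) :
  closure (A : set (wot X)) T <->
  forall s e, 0 < e -> exists2 S, A S & wotclose s e T S.
Proof. exact: (@initial_closureP R (bop X X) (l2 X * l2 X)%type (@wot_coef R X) A T). Qed.

Lemma wot_closedP X (A : set (bop X X)) : wot_closed A <->
  forall T, (forall s e, 0 < e -> exists2 S, A S & wotclose s e T S) -> A T.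
Proof.
split=> [cA T /wot_closureP|H T /wot_closureP]; [exact: cA|exact: H].
Qed.

Lemma wstar_closedP X (A : set (bop X X)) : wstar_closed A <-> wstar_closure A `<=` A.
Proof. by []. Qed.

Lemma wstar_closure_closed X (A : set (bop X X)) : wstar_closed (wstar_closure A).
Proof. exact: closed_closure. Qed.

Lemma sub_wstar_closure X (A : set (bop X X)) : A `<=` wstar_closure A.
Proof.
move=> T AT; apply/wstar_closureP => s e e0; exists T => // p _.
by rewrite subrr nc0.
Qed.

Lemma wcoef_lin X c (S T : bop X X) f g : wcoef (c *: S + T) f g = c * wcoef S f g + wcoef T f g.
Proof. by rewrite /wcoef amp_lin addbopE scalebopE ipDl ipZl. Qed.

(** A single matrix coefficient is a weak* functional: its sequences of vectors
are concentrated at the index 0. *)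
Lemma wcoef_tensv X (T : bop X X) f g : wcoef T (tensv (std_vec 0%N) f) (tensv (std_vec 0%N) g) = ip (T f) g.
Proof. by rewrite /wcoef amp_tensv ip_tensv ip_std_vec std_vecE eqxx mul1r. Qed.

Lemma wcoef_sep X (S T : bop X X) : (forall f g, wcoef S f g = wcoef T f g) -> S = T.
Proof.
move=> ST; apply: bop_ext => f; apply: ip_eq => g.
by rewrite -!wcoef_tensv ST.
Qed.

Lemma eps_eq (z w : C) : (forall e, 0 < e -> nc (z - w) <= e) -> z = w.
Proof.
move=> H; apply/eqP; rewrite -subr_eq0; apply/eqP; apply: nc_le0.
by apply: (@le0_eps _ _ 1) => // e; rewrite mul1r; exact: H.
Qed.

Lemma nc_tri (a b z : C) : nc (a - b) <= nc (z - a) + nc (z - b).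
Proof.
rewrite -(ncN (z - a)); apply: le_trans (@le_normcD R _ _).
by rewrite (_ : - (z - a) + (z - b) = a - b) //; ring.
Qed.

Lemma wstar_closure_sub X (A : set (bop X X)) :
  subspace_set A -> subspace_set (wstar_closure A).
Proof.
move=> [A0 Alin]; split; first exact: sub_wstar_closure.
move=> c S T /wstar_closureP AS /wstar_closureP AT; apply/wstar_closureP => s e e0.
pose k := nc c + 1; have k0 : 0 < k by rewrite ltr_wpDl ?nc_ge0.
have [S' AS' SS'] := AS s (e / 2 / k) (divr_gt0 (divr_gt0 e0 (ltr0n _ 2)) k0).
have [T' AT' TT'] := AT s (e / 2) (divr_gt0 e0 (ltr0n _ 2)).
exists (c *: S' + T'); first exact: Alin.
move=> p ps; rewrite !wcoef_lin.
have -> : c * wcoef S' p.1 p.2 + wcoef T' p.1 p.2 - (c * wcoef S p.1 p.2 + wcoef T p.1 p.2) =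
  c * (wcoef S' p.1 p.2 - wcoef S p.1 p.2) + (wcoef T' p.1 p.2 - wcoef T p.1 p.2) by ring.
apply: le_lt_trans (@le_normcD R _ _) _; rewrite (splitr e).
apply: ler_ltD; last exact: TT'.
rewrite Normc.normcM; have /ltW H := SS' p ps.
apply: le_trans (ler_wpM2l (nc_ge0 c) H) _.
rewrite mulrA ler_pdivrMr // mulrC ler_wpM2l //; first by rewrite divr_ge0 // ltW.
by rewrite lerDl.
Qed.

(** Pulling weak* functionals back to weak* functionals, without linearity or a
domain.  The property is stable under composition and yields both continuity
and the inclusion of images of closures. *)
Definition normal_map X Y (F : bop X X -> bop Y Y) :=
  forall f g, exists f' g', forall T, wcoef (F T) f g = wcoef T f' g'.

Lemma normal_comp X Y Z (F : bop X X -> bop Y Y) (G : bop Y Y -> bop Z Z) :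
  normal_map F -> normal_map G -> normal_map (G \o F).
Proof.
move=> nF nG f g; have [f1 [g1 G1]] := nG f g; have [f2 [g2 F2]] := nF f1 g1.
by exists f2, g2 => T /=; rewrite G1 F2.
Qed.

Lemma normal_id X : normal_map (@idfun (bop X X)).
Proof. by move=> f g; exists f, g. Qed.

Lemma normal_mul X Y (B : bop X Y) (D : bop Y X) :
  normal_map (fun T => bcomp B (bcomp T D)).
Proof.
move=> f g; exists (amp nat D f), (amp nat (adj B) g) => T.
by rewrite /wcoef !amp_comp !bcompE adjE adj_amp.
Qed.

(** An amplification by a countable K is absorbed by the amplification by nat,
pairs (n, k) being coded as natural numbers. *)
Definition pair_idx (K : countType) X (p : nat * (K * X)) : nat * X :=
  (choice.pickle (p.1, p.2.1), p.2.2).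

Lemma pair_idx_inj (K : countType) X : injective (@pair_idx K X).
Proof.
move=> [n [k x]] [m [j y]] [/(pcan_inj choice.pickleK) [-> ->] ->] //.
Qed.

Lemma amp_pair_idx (K : countType) X (T : bop X X) :
  bcomp (amp nat (amp K T)) (reindex (@pair_idx_inj K X)) =
  bcomp (reindex (@pair_idx_inj K X)) (amp nat T).
Proof.
apply: bop_ext => f; rewrite !bcompE; apply: slice_ext => n; apply: slice_ext => k.
have HE g : slice (slice (reindex (@pair_idx_inj K X) g) n) k =
    slice g (choice.pickle (n, k)) by exact: l2_ext.
by rewrite !slice_amp !HE slice_amp.
Qed.

Lemma normal_amp (K : countType) X : normal_map (@amp R K X X).
Proof.
move=> f g; set E : bop _ _ := reindex (@pair_idx_inj K X).
have Ef : E (adj E f) = f by rewrite -bcompE reindex_coiso bidE.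
exists (adj E f), (adj E g) => T; rewrite /wcoef -adjE -(bcompE E) -amp_pair_idx bcompE.
by rewrite Ef.
Qed.

Lemma normal_spatial (K : countType) X Y (B : bop (K * X)%type Y) (D : bop Y (K * X)%type) :
  normal_map (fun T => bcomp B (bcomp (amp K T) D)).
Proof. exact: (normal_comp (@normal_amp K X) (normal_mul B D)). Qed.

Lemma normal_closure X Y (F : bop X X -> bop Y Y) (A : set (bop X X)) (B : set (bop Y Y)) :
  normal_map F -> (forall T, A T -> B (F T)) ->
  forall T, wstar_closure A T -> wstar_closure B (F T).
Proof.
move=> nF AB T /wstar_closureP AT; apply/wstar_closureP => s e e0.
pose pb p := projT1 (cid (nF p.1 p.2)).
have pbE p : exists g', forall T, wcoef (F T) p.1 p.2 = wcoef T (pb p) g'.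
  by rewrite /pb; case: cid.
pose pb2 p := projT1 (cid (pbE p)).
have pb2E p T' : wcoef (F T') p.1 p.2 = wcoef T' (pb p) (pb2 p).
  by rewrite /pb2; case: cid => g' /= ->.
have [S AS SS] := AT [seq (pb p, pb2 p) | p <- s] e e0.
exists (F S); first exact: AB.
by move=> p ps; rewrite !pb2E; apply: (SS (pb p, pb2 p)); apply/mapP; exists p.
Qed.

Lemma normal_continuous X Y (F : bop X X -> bop Y Y) (A : set (bop X X)) :
  normal_map F -> wstar_continuous A F.
Proof.
move=> nF; apply: continuous_subspaceT => T U /wstar_nbhsP [s [e [e0 sU]]].
suff : nbhs (T : wstar X) [set S | wclose s e (F T) (F S)].
  by apply: filterS => S /sU.
elim: s {sU} => [|p s IH]; first by apply: filterS filterT => S _ p.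
have [f [g fg]] := nF p.1 p.2.
have : nbhs (T : wstar X) [set S | wclose [:: (f, g)] e T S].
  by apply/wstar_nbhsP; exists [:: (f, g)], e.
move: IH; apply: filterS2 => S H1 H2 q; rewrite inE => /orP [/eqP ->|]; last exact: H1.
by rewrite !fg; apply: (H2 (f, g)); rewrite inE.
Qed.

Lemma wstar_continuousE X Y (F : bop X X -> bop Y Y) (A : set (bop X X)) :
  wstar_continuous A F -> forall T, A T -> forall s e, 0 < e ->
  exists t r, 0 < r /\ forall S, A S -> wclose t r T S -> wclose s e (F T) (F S).
Proof.
move=> /subspace_continuousP cF T AT s e e0.
have /(cF T AT) : nbhs (F T : wstar Y) (wclose s e (F T)).
  by apply/wstar_nbhsP; exists s, e.
rewrite nbhs_filterE /= /fmap /within /= => /wstar_nbhsP [t [r [r0 H]]].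
by exists t, r; split=> // S AS /H; exact.
Qed.

(** Weak* functionals separate operators, so the weak* topology is Hausdorff; the
usual density argument is carried out with two explicit neighbourhoods. *)
Lemma continuous_eq X Y (F G : bop X X -> bop Y Y) (A B : set (bop X X)) :
  wstar_continuous A F -> wstar_continuous A G -> B `<=` A ->
  (forall T, B T -> F T = G T) ->
  forall T, A T -> wstar_closure B T -> F T = G T.
Proof.
move=> cF cG BA FG T AT /wstar_closureP BT; apply: wcoef_sep => f g.
apply: eps_eq => e e0; have e2 : 0 < e / 2 by rewrite divr_gt0.
have [t [r [r0 H]]] := wstar_continuousE cF AT [:: (f, g)] e2.
have [t' [r' [r'0 H']]] := wstar_continuousE cG AT [:: (f, g)] e2.
have [|S BS SS] := BT (t ++ t') (Num.min r r'); first by rewrite lt_min r0 r'0.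
have h1 : wclose t r T S.
  move=> p pt; have := SS p; rewrite mem_cat pt => /(_ isT).
  by rewrite lt_min => /andP [].
have h2 : wclose t' r' T S.
  move=> p pt; have := SS p; rewrite mem_cat pt orbT => /(_ isT).
  by rewrite lt_min => /andP [].
have := H S (BA _ BS) h1 (f, g); rewrite inE eqxx => /(_ isT) /ltW /= k1.
have := H' S (BA _ BS) h2 (f, g); rewrite inE eqxx => /(_ isT) /ltW /= k2.
rewrite FG // in k1; rewrite (splitr e).
apply: le_trans (lerD k1 k2).
exact: nc_tri.
Qed.

Lemma normal_eq X Y (F G : bop X X -> bop Y Y) (B : set (bop X X)) :
  normal_map F -> normal_map G -> (forall T, B T -> F T = G T) ->
  forall T, wstar_closure B T -> F T = G T.
Proof.
move=> nF nG FG T; apply: (@continuous_eq _ _ F G setT B) => //;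
  exact: normal_continuous.
Qed.

End weak_star.

(** * Bessel families *)

Section bessel.
Context {R : realType}.
Implicit Types (X Y Z : choiceType).
Local Notation nc := (@Normc.normc R).
Local Notation C := R[i].
Local Notation cj := (@conjc R).
Local Notation l2 := (@l2 R).
Local Notation bop := (@bop R).

(** The operator is the adjoint of the analysis map y |-> (<y, eta x>)_x, which is
a contraction by the Bessel inequality.  Vectors of norm less than 1, in
particular zero vectors, are admitted. *)
Lemma orthonormal_bop X Y (eta : X -> l2 Y) :
  (forall x y, x != y -> ip (eta x) (eta y) = 0) ->
  (forall x, l2norm (eta x) <= 1) ->
  exists2 V : bop X Y, (forall x, V (std_vec x) = eta x) &
    forall f, l2norm (V f) <= l2norm f.
Proof.
move=> orth nrm.
have fin (y : l2 Y) s : uniq s -> \sum_(x <- s) nc (ip y (eta x)) ^+ 2 <= l2norm y ^+ 2.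
  move=> us; set S := \sum_(x <- s) _.
  pose z := \sum_(x <- s) ip y (eta x) *: eta x.
  have yz : ip y z = S%:C%C.
    rewrite /z ip_sumr sumC; apply: eq_bigr => x _.
    by rewrite ipZr mulrC ncZ2.
  have S0 : 0 <= S by apply: sumr_ge0 => x _; rewrite sqr_ge0.
  have ez x : x \in s -> ip (eta x) z = cj (ip y (eta x)) * ip (eta x) (eta x).
    move=> xs; rewrite /z ip_sumr (bigD1_seq x) //= ipZr big1 ?addr0 // => w wx.
    by rewrite ipZr orth ?mulr0 // eq_sym.
  have zz : l2norm z ^+ 2 <= S.
    rewrite l2norm_Re {1}/z ip_suml.
    have -> : \sum_(x <- s) ip (ip y (eta x) *: eta x) z =
        (\sum_(x <- s) (nc (ip y (eta x)) * l2norm (eta x)) ^+ 2)%:C%C.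
      rewrite sumC !big_seq; apply: eq_bigr => x xs.
      by rewrite ipZl ez // ip_norm mulrA ncZ2 -rcM exprMn.
    rewrite cReR /S; apply: ler_sum => x _; rewrite ler_sqr ?nnegrE ?mulr_ge0 ?nc_ge0 ?l2norm_ge0 //.
    by rewrite -[leRHS]mulr1 ler_wpM2l ?nc_ge0.
  have [->|Sn0] := eqVneq S 0; first by rewrite sqr_ge0.
  have Sp : 0 < S by rewrite lt_neqAle eq_sym Sn0.
  rewrite -(@ler_pM2r _ S) // -expr2.
  have := cauchy_schwarz y z; rewrite yz nc_real // => le1.
  apply: (@le_trans _ _ ((l2norm y * l2norm z) ^+ 2)).
    by rewrite ler_sqr ?nnegrE ?mulr_ge0 ?l2norm_ge0.
  by rewrite exprMn ler_wpM2l ?sqr_ge0.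
have hl2 y : (fun x => ip y (eta x)) \in @l2_pred R X.
  by rewrite unfold_in; apply: le_lt_trans (sqsum_le (fin y)) _; rewrite ltry.
pose W y : l2 X := L2 (hl2 y).
have Wb : W \in @bounded_pred R Y X.
  apply/asboolP; split.
    by move=> c f g; apply: l2_ext => x /=; rewrite ipDl ipZl.
  by exists 1 => // f; rewrite mul1r; apply: l2norm_le; [exact: l2norm_ge0|exact: fin].
exists (adj (Bop Wb)).
  move=> x; apply: ip_eq => y; rewrite adjEr [RHS]ipC.
  by rewrite ip_std_vecl.
move=> f; rewrite -[leRHS]mul1r; apply: adj_norm => // g; rewrite mul1r.
by apply: l2norm_le; [exact: l2norm_ge0|exact: fin].
Qed.

End bessel.

(** * The Wold decomposition of a cyclic subspace *)

Section wold.
Context {R : realType} {d : nat}.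
Local Notation C := R[i].
Local Notation cj := (@conjc R).
Local Notation l2 := (@l2 R).
Local Notation bop := (@bop R).
Local Notation word := (seq 'I_d).
Local Notation L := (@L R d).
Local Notation fs_alg := (@fs_alg R d).
Implicit Types (K : choiceType) (u v w : word).

Lemma xi_std_vec w : xi w = std_vec w :> l2 word.
Proof. exact: l2_ext. Qed.

Lemma L_std_vec u v : L u (std_vec v) = std_vec (u ++ v).
Proof. by rewrite -!xi_std_vec shift_xi. Qed.

Lemma L_comp u v : bcomp (L u) (L v) = L (u ++ v).
Proof. by apply: bop_std_vec => w; rewrite bcompE !L_std_vec catA. Qed.

Lemma L_nil : L [::] = bid word.
Proof. by apply: bop_std_vec => w; rewrite L_std_vec. Qed.

Lemma L_eval u (f : l2 word) v :
  L u f v = if prefix u v then f (drop (size u) v) else 0.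
Proof. by []. Qed.

Lemma adjL_eval u (f : l2 word) v : adj (L u) f v = f (u ++ v).
Proof. by rewrite -[LHS]ip_std_vec adjEr L_std_vec ip_std_vec. Qed.

Lemma L_iso u : bcomp (adj (L u)) (L u) = bid word.
Proof.
apply: bop_ext => f; apply: l2_ext => v.
by rewrite bcompE adjL_eval L_eval prefix_prefix drop_size_cat.
Qed.

Lemma cat_prefix u v w t : u ++ w = v ++ t -> prefix u v || prefix v u.
Proof.
elim: u v => [|a u IH] [|b v] //= [-> /IH].
by rewrite !eqxx.
Qed.

Lemma L_orth u v : ~~ prefix u v -> ~~ prefix v u -> bcomp (adj (L u)) (L v) = 0.
Proof.
move=> uv vu; apply: bop_ext => f; apply: l2_ext => w.
rewrite bcompE adjL_eval L_eval zerobopE; case: ifP => // /prefixP [t E].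
by have := cat_prefix E; rewrite (negbTE uv) (negbTE vu).
Qed.

Lemma fs_sub : subspace_set fs_alg.
Proof.
split=> [A [[[[A0 _] _] _ _] _]//|c S T fS fT A PA].
have [[[_ Al] _] _ _] := PA.1.
by apply: Al; [exact: fS|exact: fT].
Qed.

Lemma fs_comp S T : fs_alg S -> fs_alg T -> fs_alg (bcomp S T).
Proof.
move=> fS fT A PA; have [[_ Am] _ _] := PA.1.
by apply: Am; [exact: fS|exact: fT].
Qed.

Lemma fs_id : fs_alg (bid word).
Proof. by move=> A [[]]. Qed.

Lemma fs_L w : fs_alg (L w).
Proof. by move=> A [_]; apply; exists w. Qed.

Lemma fs_wot : wot_closed fs_alg.
Proof.
apply/wot_closedP => T H A PA; have [_ _ /wot_closedP cA] := PA.1.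
apply: cA => s e e0; have [S fS SS] := H s e e0.
by exists S => //; exact: fS.
Qed.

Lemma fs_ind (A : set (bop word word)) : subalgebra A -> A (bid word) -> wot_closed A ->
  (forall w, A (L w)) -> fs_alg `<=` A.
Proof. by move=> sA A1 cA AL T; apply; split=> // _ [w _ <-]. Qed.

Section one_vector.
Context {K : choiceType}.
Variable x : l2 (K * word)%type.
Local Notation LK w := (amp K (L w)).

Lemma LK_comp u v f : LK u (LK v f) = LK (u ++ v) f.
Proof. by rewrite -bcompE -amp_comp L_comp. Qed.

Lemma LK_iso u f g : ip (LK u f) (LK u g) = ip f g.
Proof. by rewrite ipC -adjEr adj_amp -bcompE -amp_comp L_iso amp_id -ipC. Qed.

Lemma LK_orth u v f g : ~~ prefix u v -> ~~ prefix v u -> ip (LK u f) (LK v g) = 0.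
Proof.
move=> uv vu; rewrite adjE adj_amp -bcompE -amp_comp L_orth //.
by rewrite amp0 zerobopE ip0r.
Qed.

Lemma LK_eval u f k v : LK u f (k, v) = if prefix u v then f (k, drop (size u) v) else 0.
Proof. by rewrite -sliceE slice_amp L_eval. Qed.

Let A : set (l2 (K * word)%type) := [set LK w x | w in [set w | w != [::]]].

(** z is the component of x orthogonal to all L_w x with w nonempty.  Such a vector
is wandering: its translates under distinct words are orthogonal, by L_orth when
the words are incomparable and by the choice of z when one extends the other. *)
Lemma wandering_vector : exists z : l2 (K * word)%type,
  [/\ forall w, w != [::] -> ip z (LK w x) = 0,
      forall h, (forall w, w != [::] -> ip h (LK w x) = 0) -> ip (x - z) h = 0 &
      forall u v, u != v -> ip (LK u z) (LK v z) = 0].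
Proof.
have [P PP] := ann_proj A; have [zA zP] := PP x; set z := P x in zA zP.
have h1 w : w != [::] -> ip z (LK w x) = 0 by move=> w0; apply: zA; exists w.
have h2 h : (forall w, w != [::] -> ip h (LK w x) = 0) -> ip (x - z) h = 0.
  by move=> H; apply: zP => _ [w w0 <-]; exact: H.
exists z; split=> //.
have h3 w : w != [::] -> ip z (LK w z) = 0.
  move=> w0; rewrite -[z in LK w z](subKr x) bopB ipBr h1 // sub0r.
  rewrite -adjEr ipC h2 ?conjc0 ?oppr0 // => u u0.
  by rewrite adjEr LK_comp h1 //; case: (w) w0.
have h4 u t : t != [::] -> ip (LK u z) (LK (u ++ t) z) = 0.
  by move=> t0; rewrite -LK_comp LK_iso h3.
move=> u v uv; have [/prefixP [t vE]|nuv] := boolP (prefix u v).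
  by rewrite vE h4 //; apply: contraNneq uv => t0; rewrite vE t0 cats0.
have [/prefixP [t uE]|nvu] := boolP (prefix v u); last exact: LK_orth.
by rewrite ipC uE h4 ?conjc0 //; apply: contraNneq uv => t0; rewrite uE t0 cats0.
Qed.

Definition cyclic_vector (v : l2 word) :=
  forall h, (forall w, ip (L w v) h = 0) -> h = 0.

(** V sends the word w to L_w (z / |z|) for the wandering vector z of x, and
intertwines the shifts.  That V adj(V) x = x, i.e. that x lies in the range of V,
expresses that 1 ⊗ L has no unitary part: the remainder r = x - V adj(V) x lies
in the closed span of the L_w r with w nonempty, and so its coefficients vanish
by induction on the length of the word.  If z = 0, the convention 0^-1 = 0 makes
V = 0, and then x = 0. *)
Lemma wold_isometry : exists V : bop word (K * word)%type,
  [/\ forall f, l2norm (V f) <= l2norm f,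
      forall w, bcomp (LK w) V = bcomp V (L w),
      V (adj V x) = x &
      cyclic_vector (adj V x) \/ V = 0].
Proof.
have [z [z1 z2 zz]] := wandering_vector.
pose c : C := ((l2norm z)^-1)%:C%C.
pose y := c *: z.
have yy u v : u != v -> ip (LK u y) (LK v y) = 0.
  by move=> uv; rewrite !bopZ ipZl ipZr zz // !mulr0.
have ip_zy : ip z y = (l2norm z)%:C%C.
  rewrite ipZr conjcR ip_norm -rcM expr2 mulrA.
  have [->|n0] := eqVneq (l2norm z) 0; first by rewrite !mulr0.
  by rewrite mulVf // mul1r.
have zE : z = (l2norm z)%:C%C *: y.
  have [/eqP|n0] := eqVneq (l2norm z) 0.
    by move=> /eqP /l2norm_eq0 ->; rewrite l2norm0 scale0r.
  by rewrite scalerA -rcM divff // scale1r.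
have y1 : l2norm y <= 1.
  rewrite l2normZ nc_real ?invr_ge0 ?l2norm_ge0 //.
  have [->|n0] := eqVneq (l2norm z) 0; first by rewrite mulr0.
  by rewrite mulVf.
have LKn u f : l2norm (LK u f) = l2norm f.
  by apply/eqP; rewrite -(@eqrXn2 _ 2) ?l2norm_ge0 // !l2norm_Re LK_iso.
have [|V VE Vn] := @orthonormal_bop _ _ _ (fun w => LK w y) yy.
  by move=> w; rewrite LKn.
have VL w : bcomp (LK w) V = bcomp V (L w).
  by apply: bop_std_vec => u; rewrite !bcompE L_std_vec !VE LK_comp.
have adjV f u : adj V f u = ip f (LK u y) by rewrite -[LHS]ip_std_vec adjEr VE.
have Vz : V (adj V z) = z.
  have -> : adj V z = (l2norm z)%:C%C *: std_vec [::].
    apply: l2_ext => u; rewrite adjV.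
    transitivity ((l2norm z)%:C%C * (u == [::])%:R : C); last by [].
    have [->|u0] := eqVneq u [::]; first by rewrite L_nil amp_id bidE ip_zy mulr1.
    rewrite mulr0 bopZ ipZr.
    have := zz [::] u; rewrite eq_sym => /(_ u0).
    by rewrite L_nil amp_id bidE => ->; rewrite mulr0.
  by rewrite bopZ VE L_nil amp_id bidE -zE.
have adjVL w : adj V (LK w x) = L w (adj V x).
  apply: l2_ext => u; rewrite adjV L_eval; case: ifPn => [/prefixP [t ->]|nwu].
    by rewrite drop_size_cat // -LK_comp LK_iso adjV.
  have [/prefixP [t wE]|nuw] := boolP (prefix u w); last exact: LK_orth.
  have t0 : t != [::].
    by apply: contraNneq nwu => t0; rewrite wE t0 cats0 prefix_refl.
  by rewrite wE -LK_comp LK_iso ipC ipZl z1 // mulr0 conjc0.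
pose r := x - V (adj V x).
(* V adj(V) commutes with the shifts on the orbit of x. *)
have Lr w : LK w r = LK w x - V (adj V (LK w x)).
  by rewrite bopB adjVL -(bcompE (LK w)) VL bcompE.
(* r lies in the closed span of its own proper translates, as z and the part of x
   in the range of V have been removed. *)
have pure h : (forall w, w != [::] -> ip (LK w r) h = 0) -> ip r h = 0.
  move=> H; pose h' := h - V (adj V h).
  have sym f : ip (f - V (adj V f)) h = ip f h'.
    by rewrite ipBl /h' ipBr adjE adjEr.
  have xzh : ip (x - z) h' = 0.
    apply: z2 => w w0; rewrite ipC -sym -Lr H ?conjc0 //.
  rewrite sym; move: xzh; rewrite ipBl => /eqP; rewrite subr_eq0 => /eqP ->.
  by rewrite -sym Vz subrr ip0l.
have r0 n : forall k v, (size v < n)%N -> r (k, v) = 0.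
  elim: n => // n IH k v vn; rewrite -ip_std_vec; apply: pure => w w0.
  rewrite ip_std_vec LK_eval; case: ifP => // /prefixP [t vE]; apply: IH.
  move: vn; rewrite vE drop_size_cat // size_cat ltnS; apply: leq_trans.
  by rewrite -[X in (X < _)%N]add0n ltn_add2r lt0n size_eq0.
have xE : V (adj V x) = x.
  apply/eqP; rewrite eq_sym -subr_eq0; apply/eqP; apply: l2_ext => -[k v].
  by rewrite -/r (r0 (size v).+1).
exists V; split=> //.
have [z0|zn0] := eqVneq (l2norm z) 0; [right|left].
  by apply: bop_std_vec => w; rewrite VE /y (l2norm_eq0 z0) scaler0 bop0 zerobopE.
have VV : bcomp (adj V) V = bid word.
  apply: bop_std_vec => u; apply: l2_ext => w; rewrite bcompE adjV VE.
  have [->|wu] := eqVneq w u.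
    rewrite LK_iso [RHS]std_vecE eqxx ip_norm l2normZ nc_real ?invr_ge0 ?l2norm_ge0 //.
    by rewrite mulVf // expr1n.
  by rewrite yy ?[RHS]std_vecE ?(negbTE wu) // eq_sym.
have iso f g : ip (V f) (V g) = ip f g by rewrite -adjEr -bcompE VV bidE.
(* Cyclicity of v = adj(V) x: a vector orthogonal to the orbit of v has no constant
   term, since V sends the empty word to the normalised z, which is in the closed
   span of the orbit of x.  The other coefficients follow by translation. *)
have cyc0 h : (forall w, ip (L w (adj V x)) h = 0) -> h [::] = 0.
  move=> H; have Vh w : ip (V h) (LK w x) = 0.
    by rewrite -{1}xE -(bcompE (LK w)) VL bcompE iso ipC H conjc0.
  have zh : ip z (V h) = 0.
    have := z2 (V h) (fun w _ => Vh w); rewrite ipBl => /eqP.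
    rewrite subr_eq0 => /eqP <-.
    by have := Vh [::]; rewrite L_nil amp_id bidE ipC => /(congr1 cj); rewrite conjcKK conjc0.
  have : ip y (V h) = 0 by rewrite ipZl zh mulr0.
  have -> : y = V (std_vec [::]) by rewrite VE L_nil amp_id bidE.
  by rewrite iso ip_std_vecl => /(congr1 cj); rewrite conjcKK conjc0.
move=> h H; apply: l2_ext => u; rewrite -[u]cats0 -adjL_eval; apply: cyc0 => w.
by rewrite -adjE -bcompE L_comp H.
Qed.

(** An intertwining relation with the shifts passes to L because the operators
satisfying it form a WOT-closed algebra. *)
Lemma fs_intertwine (V : bop word (K * word)%type) :
  (forall w, bcomp (LK w) V = bcomp V (L w)) ->
  forall T, fs_alg T -> bcomp (amp K T) V = bcomp V T.
Proof.
move=> VL; apply: fs_ind => //.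
- split; [split|].
  + by rewrite amp0 bcomp0l bcomp0r.
  + by move=> c S T SV TV; rewrite amp_lin bcomp_linl SV TV bcomp_linr.
  + by move=> S T SV TV; rewrite amp_comp -bcompA TV bcompA SV -bcompA.
- by rewrite amp_id bcomp1l bcomp1r.
- apply/wot_closedP => T H; apply: bop_ext => f; apply: l2_ext => -[k u].
  apply: eps_eq => e e0; have e2 : 0 < e / 2 by rewrite divr_gt0.
  have E1 S : bcomp (amp K S) V f (k, u) = ip (S (slice (V f) k)) (std_vec u).
    by rewrite bcompE -sliceE slice_amp ip_std_vec.
  have E2 S : bcomp V S f (k, u) = ip (S f) (adj V (std_vec (k, u))).
    by rewrite bcompE -adjE ip_std_vec.
  have [S SV SS] := H [:: (slice (V f) k, std_vec u); (f, adj V (std_vec (k, u)))] _ e2.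
  rewrite E1 E2 (splitr e).
  apply: le_trans (nc_tri _ _ (ip (S f) (adj V (std_vec (k, u))))) _.
  apply: lerD; apply: ltW; last first.
    by apply: (SS (f, adj V (std_vec (k, u)))); rewrite !inE eqxx orbT.
  by rewrite -E2 -SV E1; apply: (SS (slice (V f) k, std_vec u)); rewrite inE eqxx.
Qed.

(** With V as in wold_isometry, x = V v for v = adj(V) x, and V intertwines T with
1 ⊗ T; so <(1 ⊗ T) x, y> = <T v, adj(V) y>. *)
Lemma vector_functional (y : l2 (K * word)%type) : exists v y' : l2 word,
  [/\ forall T, fs_alg T -> ip (amp K T x) y = ip (T v) y',
      l2norm v <= l2norm x, l2norm y' <= l2norm y &
      cyclic_vector v \/ y' = 0].
Proof.
have [V [Vn VL xE cyc]] := wold_isometry.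
have Vn' f : l2norm (V f) <= 1 * l2norm f by rewrite mul1r.
exists (adj V x), (adj V y); split.
- by move=> T /(fs_intertwine VL) TV; rewrite -{1}xE -(bcompE (amp K T)) TV bcompE adjE.
- by rewrite -[leRHS]mul1r; apply: adj_norm.
- by rewrite -[leRHS]mul1r; apply: adj_norm.
- case: cyc => [|V0]; [by left|right].
  by apply: ip_eqr => h; rewrite -adjE V0 zerobopE ip0l ip0r.
Qed.

End one_vector.
End wold.

(** * Separation by finite-rank functionals *)

Section separation.
Context {R : realType}.
Local Notation nc := (@Normc.normc R).
Local Notation C := R[i].
Local Notation l2 := (@l2 R).
Local Notation bop := (@bop R).

Lemma lspan_sub (V : lmodType C) (G : set V) : subspace_set (lspan G).
Proof.
split=> [A [[A0 _] _] //|c S T fS fT A PA].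
by apply: (PA.1.2); [exact: fS|exact: fT].
Qed.

Lemma sub_lspan (V : lmodType C) (G : set V) : G `<=` lspan G.
Proof. exact: sub_gen_smallest. Qed.

Lemma lspan_min (V : lmodType C) (G A : set V) : subspace_set A -> G `<=` A -> lspan G `<=` A.
Proof. by move=> sA GA T; apply. Qed.

Lemma subspaceD (V : lmodType C) (A : set V) S T : subspace_set A -> A S -> A T -> A (S + T).
Proof. by move=> [_ lA] AS AT; rewrite -[S]scale1r; exact: lA. Qed.

Lemma subspaceZ (V : lmodType C) (A : set V) c S : subspace_set A -> A S -> A (c *: S).
Proof. by move=> [A0 lA] AS; rewrite -[_ *: _]addr0; exact: lA. Qed.

Lemma subspaceB (V : lmodType C) (A : set V) S T : subspace_set A -> A S -> A T -> A (S - T).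
Proof. by move=> [_ lA] AS AT; rewrite addrC -scaleN1r; exact: lA. Qed.

(** For finitely many functionals c_i and a subspace J, either some point of J
agrees with x on all of them, or a combination of the c_i kills J but not x.
Induction on the number of functionals: if c_i does not vanish on J, then J is
replaced by its intersection with the kernel of c_i and x is translated into
that kernel. *)
Lemma linear_separation (V : lmodType C) (I : Type) (c : I -> V -> C) (s : seq I) :
  (forall i a x y, c i (a *: x + y) = a * c i x + c i y) ->
  forall (J : set V) (x : V), subspace_set J ->
  (exists2 y, J y & forall i, List.In i s -> c i y = c i x) \/
  exists t : seq (C * I), (forall y, J y -> \sum_(q <- t) q.1 * c q.2 y = 0) /\
    \sum_(q <- t) q.1 * c q.2 x != 0.
Proof.
move=> lin; pose sc t y := \sum_(q <- t) q.1 * c q.2 y : C.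
have c0 i : c i 0 = 0.
  by have := lin i (-1) 0 0; rewrite scaler0 addr0 mulN1r addNr.
have sclin t a y z : sc t (a *: y + z) = a * sc t y + sc t z.
  rewrite /sc mulr_sumr -big_split; apply: eq_bigr => q _ /=.
  by rewrite lin mulrDr mulrCA.
elim: s => [|i s IH] J x sJ; first by left; exists 0 => //; case: sJ.
have [ciJ|] := pselect (forall y, J y -> c i y = 0).
  have [cx|cx] := eqVneq (c i x) 0; last first.
    right; exists [:: (1, i)]; split=> [y /ciJ|]; rewrite big_seq1 /= mul1r //.
  have [[y Jy ys]|] := IH J x sJ; [left|by right].
  by exists y => // j [<-|]; [rewrite cx ciJ|exact: ys].
move=> /existsNP [u0 /not_implyP [Ju0 /eqP cu0]].
pose u := (c i u0)^-1 *: u0.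
have Ju : J u by exact: subspaceZ.
have cu : c i u = 1 by rewrite -[u]addr0 lin c0 addr0 mulVf.
pose J' := J `&` [set y | c i y = 0].
have sJ' : subspace_set J'.
  split; first by split; [case: sJ|exact: c0].
  move=> a y z [Jy cy] [Jz cz]; split; first by case: sJ => _; apply.
  by rewrite /= lin cy cz mulr0 addr0.
pose x' := - c i x *: u + x.
have cx' : c i x' = 0 by rewrite lin cu mulr1 addNr.
have [[y [Jy cy] ys]|[t [tJ tx]]] := IH J' x' sJ'; [left|right].
  exists (c i x *: u + y); first by case: sJ => _; apply.
  move=> j; rewrite lin => -[<-|js]; first by rewrite cy cu mulr1 addr0.
  by rewrite ys // lin addrA mulNr addrN add0r.
exists ((- sc t u, i) :: t); split=> [y Jy|]; rewrite big_cons /= -/(sc t _).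
  have /tJ : J' (- c i y *: u + y).
    split; first by case: sJ => _; apply.
    by rewrite /= lin cu mulr1 addNr.
  by rewrite -/(sc t _) sclin !mulNr [c i y * _]mulrC.
by move: tx; rewrite -/(sc t _) sclin !mulNr [c i x * _]mulrC.
Qed.

(** If every finite list of matrix coefficients of T were matched exactly by an
element of J, then T would lie in the closure of J.  So linear_separation for some
finite list does the work of the Hahn-Banach theorem. *)
Lemma wot_separation X (J : set (bop X X)) (T : bop X X) :
  subspace_set J -> wot_closed J -> ~ J T ->
  exists t : seq (l2 X * l2 X),
    (forall S, J S -> \sum_(p <- t) ip (S p.1) p.2 = 0) /\
    \sum_(p <- t) ip (T p.1) p.2 != 0.
Proof.
move=> sJ /wot_closedP cJ nJT.
have : exists s, ~ exists2 S, J S & forall p, List.In p s -> ip (S p.1) p.2 = ip (T p.1) p.2.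
  apply/existsNP => H; apply: nJT; apply: cJ => s e e0.
  have [S JS SS] := H s; exists S => // p ps.
  have ps' : List.In p s.
    by elim: s ps {SS H} => // q s IH; rewrite inE => /orP [/eqP ->|/IH]; [left|right].
  by rewrite (SS p ps') subrr nc0.
move=> [s ns].
pose c (p : l2 X * l2 X) (S : bop X X) := ip (S p.1) p.2.
have linc p a S S' : c p (a *: S + S') = a * c p S + c p S'.
  by rewrite /c addbopE scalebopE ipDl ipZl.
have [//|[t [tJ tT]]] := linear_separation s linc T sJ.
have E (S : bop X X) : \sum_(p <- [seq (q.1 *: q.2.1, q.2.2) | q <- t]) ip (S p.1) p.2 =
    \sum_(q <- t) q.1 * ip (S q.2.1) q.2.2.
  by rewrite big_map; apply: eq_bigr => q _ /=; rewrite bopZ ipZl.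
exists [seq (q.1 *: q.2.1, q.2.2) | q <- t]; split=> [S JS|]; rewrite E //.
exact: tJ.
Qed.

Lemma wot_closure_map X (F : bop X X -> bop X X) (A B : set (bop X X)) :
  (forall p : l2 X * l2 X, exists q : l2 X * l2 X, forall T, ip (F T p.1) p.2 = ip (T q.1) q.2) ->
  (forall T, A T -> B (F T)) ->
  forall T, closure (A : set (wot X)) T -> closure (B : set (wot X)) (F T).
Proof.
move=> nF AB T /wot_closureP AT; apply/wot_closureP => s e e0.
pose pb p := projT1 (cid (nF p)).
have pbE p S : ip (F S p.1) p.2 = ip (S (pb p).1) (pb p).2 by rewrite /pb; case: cid.
have [S AS SS] := AT [seq pb p | p <- s] e e0.
exists (F S); first exact: AB.
by move=> p ps; rewrite !pbE; apply: SS; apply: map_f.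
Qed.

Lemma sub_wot_closure X (A : set (bop X X)) : A `<=` closure (A : set (wot X)).
Proof.
move=> T AT; apply/wot_closureP => s e e0; exists T => // p _.
by rewrite subrr nc0.
Qed.

Lemma wot_closure_sub X (A : set (bop X X)) :
  subspace_set A -> subspace_set (closure (A : set (wot X)) : set (bop X X)).
Proof.
move=> [A0 Alin]; split.
  exact: sub_wot_closure.
move=> c S T /wot_closureP AS /wot_closureP AT; apply/wot_closureP => s e e0.
pose k := nc c + 1; have k0 : 0 < k by rewrite ltr_wpDl ?nc_ge0.
have [S' AS' SS'] := AS s (e / 2 / k) (divr_gt0 (divr_gt0 e0 (ltr0n _ 2)) k0).
have [T' AT' TT'] := AT s (e / 2) (divr_gt0 e0 (ltr0n _ 2)).
exists (c *: S' + T'); first exact: Alin.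
move=> p ps; rewrite !(addbopE, scalebopE) !ipDl !ipZl.
have -> : c * ip (S' p.1) p.2 + ip (T' p.1) p.2 - (c * ip (S p.1) p.2 + ip (T p.1) p.2) =
  c * (ip (S' p.1) p.2 - ip (S p.1) p.2) + (ip (T' p.1) p.2 - ip (T p.1) p.2) by ring.
apply: le_lt_trans (@le_normcD R _ _) _; rewrite (splitr e).
apply: ler_ltD; last exact: TT'.
rewrite Normc.normcM; have /ltW H := SS' p ps.
apply: le_trans (ler_wpM2l (nc_ge0 c) H) _.
rewrite mulrA ler_pdivrMr // mulrC ler_wpM2l //; first by rewrite divr_ge0 // ltW.
by rewrite lerDl.
Qed.

End separation.

(** * Ideals and their coinvariant subspaces *)

Section ideals.
Context {R : realType} {d : nat}.
Local Notation l2 := (@l2 R).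
Local Notation bop := (@bop R).
Local Notation word := (seq 'I_d).
Local Notation L := (@L R d).
Local Notation fs_alg := (@fs_alg R d).
Implicit Types (u v w : word).

(** Multiplication is only separately WOT-continuous; the two variables are handled
one after the other. *)
Lemma wot_closure_comp (A : set (bop word word)) :
  (forall S T, A S -> A T -> A (bcomp S T)) ->
  forall S T, closure (A : set (wot word)) S -> closure (A : set (wot word)) T ->
  closure (A : set (wot word)) (bcomp S T).
Proof.
move=> Am S T clS clT.
have H S' : A S' -> closure (A : set (wot word)) (bcomp S' T).
  move=> AS'; apply: (@wot_closure_map _ _ (fun T => bcomp S' T) A) clT => [p|T' AT'].
    by exists (p.1, adj S' p.2) => T'; rewrite bcompE adjE.
  exact: Am.
have : closure (closure (A : set (wot word)) : set (wot word)) (bcomp S T).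
  apply: (@wot_closure_map _ _ (fun S => bcomp S T) A) clS => [p|S' /H //].
  by exists (T p.1, p.2).
exact: closed_closure.
Qed.

Definition fs_poly : set (bop word word) := lspan (range L).

Lemma fs_poly_sub : fs_poly `<=` fs_alg.
Proof. by apply: lspan_min (fs_sub) _ => _ [w _ <-]; exact: fs_L. Qed.

Lemma fs_poly_comp S T : fs_poly S -> fs_poly T -> fs_poly (bcomp S T).
Proof.
move=> pS pT.
have H u : fs_poly (bcomp (L u) T).
  apply: (lspan_min (A := [set T | fs_poly (bcomp (L u) T)])) pT.
    split=> [|c T1 T2 /= h1 h2] /=; first by rewrite bcomp0r; case: (lspan_sub (range L)).
    by rewrite bcomp_linr; case: (lspan_sub (range L)) => _; apply.
  by move=> _ [w _ <-] /=; rewrite L_comp; apply: sub_lspan; exists (u ++ w).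
apply: (lspan_min (A := [set S | fs_poly (bcomp S T)])) pS.
  split=> [|c T1 T2 /= h1 h2] /=; first by rewrite bcomp0l; case: (lspan_sub (range L)).
  by rewrite bcomp_linl; case: (lspan_sub (range L)) => _; apply.
by move=> _ [w _ <-]; exact: H.
Qed.

Lemma fs_poly_wot : fs_alg `<=` closure (fs_poly : set (wot word)).
Proof.
apply: fs_ind.
- split; first exact/wot_closure_sub/lspan_sub.
  by move=> S T; apply: wot_closure_comp; exact: fs_poly_comp.
- by apply: sub_wot_closure; rewrite -L_nil; apply: sub_lspan; exists [::].
- exact: closed_closure.
- by move=> w; apply: sub_wot_closure; apply: sub_lspan; exists w.
Qed.

Lemma wcoef_vector (f g : l2 (nat * word)%type) : exists q : l2 word * l2 word,
  forall T, fs_alg T -> wcoef T f g = ip (T q.1) q.2.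
Proof.
have [v [y [H _ _ _]]] := vector_functional f g.
by exists (v, y).
Qed.

(** On L every weak* functional is a single matrix coefficient, hence WOT
neighbourhoods are as small as weak* neighbourhoods. *)
Lemma wotclose_wclose (s : seq (l2 (nat * word)%type * l2 (nat * word)%type)) :
  exists t : seq (l2 word * l2 word), forall e S T, fs_alg S -> fs_alg T ->
    wotclose t e T S -> wclose s e T S.
Proof.
pose q p := projT1 (cid (wcoef_vector p.1 p.2)).
have qE p T : fs_alg T -> wcoef T p.1 p.2 = ip (T (q p).1) (q p).2.
  by move=> fT; rewrite /q; case: cid => r /= ->.
exists [seq q p | p <- s] => e S T fS fT H p ps.
by rewrite !qE //; apply: H; apply: map_f.
Qed.

Lemma wot_wstar_closure (A : set (bop word word)) : A `<=` fs_alg ->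
  forall T, closure (A : set (wot word)) T -> wstar_closure A T.
Proof.
move=> Af T clT; have fT : fs_alg T.
  by apply: (@fs_wot R d); apply/wot_closureP => s e e0; move/wot_closureP: clT => /(_ s e e0) [S /Af fS SS]; exists S.
apply/wstar_closureP => s e e0; have [t tP] := wotclose_wclose s.
move/wot_closureP: clT => /(_ t e e0) [S AS SS]; exists S => //.
by apply: tP => //; exact: Af.
Qed.

Lemma fs_poly_dense : fs_alg `<=` wstar_closure fs_poly.
Proof. by move=> T /fs_poly_wot; apply: wot_wstar_closure; exact: fs_poly_sub. Qed.

Lemma linear_on0 X Y (A : set (bop X X)) (F : bop X X -> bop Y Y) :
  A 0 -> linear_on A F -> F 0 = 0.
Proof.
by move=> A0 lF; have := lF (-1) 0 0 A0 A0; rewrite scaler0 addr0 scaleN1r addNr.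
Qed.

(** The way identities between weak*-continuous maps on L are proved below. *)
Lemma fs_eq X (F G : bop word word -> bop X X) :
  linear_on fs_alg F -> linear_on fs_alg G ->
  wstar_continuous fs_alg F -> wstar_continuous fs_alg G ->
  (forall w, F (L w) = G (L w)) -> forall T, fs_alg T -> F T = G T.
Proof.
move=> lF lG cF cG FG T fT.
apply: (continuous_eq cF cG fs_poly_sub) (fT) (fs_poly_dense fT) => S pS.
suff [] : (fs_alg `&` [set S | F S = G S]) S by [].
apply: (lspan_min (A := fs_alg `&` [set S | F S = G S])) pS; last first.
  by move=> _ [w _ <-]; split; [exact: fs_L|exact: FG].
have [f0 fl] := @fs_sub R d.
split; first by split; rewrite //= (linear_on0 f0 lF) (linear_on0 f0 lG).
move=> c S1 S2 [f1 e1] [f2 e2]; split; first exact: fl.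
by rewrite /= lF // lG // e1 e2.
Qed.

(** A sum of two vector functionals is one functional with multiplicity space bool,
to which vector_functional applies.  The norms add in squares. *)
Lemma two_functionals (v1 y1 v2 y2 : l2 word) : exists v y : l2 word,
  [/\ forall T, fs_alg T -> ip (T v1) y1 + ip (T v2) y2 = ip (T v) y,
      l2norm v ^+ 2 <= l2norm v1 ^+ 2 + l2norm v2 ^+ 2,
      l2norm y ^+ 2 <= l2norm y1 ^+ 2 + l2norm y2 ^+ 2 &
      cyclic_vector v \/ y = 0].
Proof.
pose j (a b : l2 word) := tensv (std_vec true) a + tensv (std_vec false) b : l2 (bool * word)%type.
have jj T (a b a' b' : l2 word) : ip (amp bool T (j a b)) (j a' b') = ip (T a) a' + ip (T b) b'.
  rewrite /j bopD !amp_tensv ipDl !ipDr !ip_tensv !ip_std_vec !std_vecE /=.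
  by rewrite !mul1r !mul0r addr0 add0r.
have jn (a b : l2 word) : l2norm (j a b) ^+ 2 = l2norm a ^+ 2 + l2norm b ^+ 2.
  have := jj (bid word) a b a b; rewrite amp_id !bidE => E.
  by rewrite l2norm_Re E cReD -(l2norm_Re a) -(l2norm_Re b).
have [v [y [H vn yn cyc]]] := vector_functional (j v1 v2) (j y1 y2).
exists v, y; split=> //.
- by move=> T fT; rewrite -jj H.
- by rewrite -jn ler_sqr ?nnegrE ?l2norm_ge0.
- by rewrite -jn ler_sqr ?nnegrE ?l2norm_ge0.
Qed.

Lemma finite_functional (t : seq (l2 word * l2 word)) : exists v y : l2 word,
  (forall T, fs_alg T -> \sum_(p <- t) ip (T p.1) p.2 = ip (T v) y) /\
  (cyclic_vector v \/ y = 0).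
Proof.
elim: t => [|p t [v [y [H _]]]].
  by exists 0, 0; split; [move=> T _; rewrite big_nil ip0r|right].
have [v' [y' [H' _ _ cyc]]] := two_functionals p.1 p.2 v y.
by exists v', y'; split=> // T fT; rewrite big_cons H // H'.
Qed.

Section one_ideal.
Variable J : set (bop word word).
Hypothesis idJ : wot_ideal J.
Local Notation e := (Nproj J).
Local Notation N := (Nspace J).

Lemma NspaceE : N = ann [set T (xi [::]) | T in J].
Proof.
apply/seteqP; split=> f Nf; first by move=> _ [T JT <-]; exact: Nf.
by move=> T JT; apply: Nf; exists T.
Qed.

Lemma NprojP f : N (e f) /\ forall g, N g -> ip (f - e f) g = 0.
Proof.
have [P PP] := ann_proj [set T (xi [::]) | T in J].
have /xgetPex H : exists P : bop word word, forall f, N (P f) /\ forall g, N g -> ip (f - P f) g = 0.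
  by exists P => g; rewrite NspaceE; exact: PP.
exact: (H 0 f).
Qed.

Lemma Nproj_in f : N (e f). Proof. by case: (NprojP f). Qed.

Lemma Nproj_ip f g : N g -> ip (e f) g = ip f g.
Proof.
move=> Ng; have [_ /(_ g Ng)] := NprojP f.
by rewrite ipBl => /eqP; rewrite subr_eq0 => /eqP.
Qed.

Lemma Nproj_sa f g : ip (e f) g = ip f (e g).
Proof.
rewrite -[RHS](Nproj_ip _ (Nproj_in g)) ipC -(Nproj_ip g (Nproj_in f)) -ipC.
by rewrite ipC Nproj_ip -?ipC //; exact: Nproj_in.
Qed.

Lemma Nproj_id f : N f -> e f = f.
Proof. by move=> Nf; apply: ip_eqr => h; rewrite -Nproj_sa Nproj_ip. Qed.

Lemma NprojK : bcomp e e = e.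
Proof. by apply: bop_ext => f; rewrite bcompE Nproj_id //; exact: Nproj_in. Qed.

Lemma Nproj_proj : projection e.
Proof. by split; [exact: NprojK|exact: Nproj_sa]. Qed.

Lemma adj_Nproj : adj e = e.
Proof. by apply: adj_eq => f g; exact: Nproj_sa. Qed.

Lemma Nproj_norm f : l2norm (e f) <= 1 * l2norm f.
Proof.
rewrite mul1r -ler_sqr ?nnegrE ?l2norm_ge0 // -{2}(subrK (e f) f).
by rewrite (pythagoras ((NprojP f).2 _ (Nproj_in f))) lerDr sqr_ge0.
Qed.

Lemma ideal_fs : J `<=` fs_alg. Proof. by case: idJ. Qed.
Lemma ideal_sub : subspace_set J. Proof. by case: idJ. Qed.
Lemma ideal_mull S T : fs_alg S -> J T -> J (bcomp S T).
Proof. by case: idJ => _ _ H _ fS JT; case: (H S T fS JT). Qed.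
Lemma ideal_mulr S T : fs_alg S -> J T -> J (bcomp T S).
Proof. by case: idJ => _ _ H _ fS JT; case: (H S T fS JT). Qed.
Lemma ideal_wot : wot_closed J. Proof. by case: idJ. Qed.

Lemma adj_ideal_N T h : J T -> N h -> adj T h = 0.
Proof.
move=> JT Nh; apply: l2_ext => w; rewrite -ip_std_vec adjEr -[w]cats0 -L_std_vec -bcompE -xi_std_vec.
by apply: Nh; apply: ideal_mulr => //; exact: fs_L.
Qed.

(** N is invariant under adjoints because J absorbs left multiplication. *)
Lemma N_coinvariant T h : fs_alg T -> N h -> N (adj T h).
Proof.
move=> fT Nh S JS; rewrite adjEr -bcompE; apply: Nh; exact: ideal_mull.
Qed.

(** The compression is multiplicative on L for this reason. *)
Lemma Nproj_mul T : fs_alg T -> bcomp e (bcomp T e) = bcomp e T.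
Proof.
move=> fT; apply: bop_ext => f; apply: ip_eq => g; rewrite !bcompE !Nproj_sa.
by rewrite !(adjE T) Nproj_ip //; apply: N_coinvariant => //; exact: Nproj_in.
Qed.

Lemma compr_fs T : fs_alg T -> compr J T = bcomp e T.
Proof. exact: Nproj_mul. Qed.

Lemma Nproj_ideal T : J T -> bcomp e T = 0.
Proof.
move=> JT; apply: bop_ext => f; apply: ip_eq => g; rewrite bcompE zerobopE ip0l.
by rewrite Nproj_sa (adjE T) adj_ideal_N ?ip0r //; exact: Nproj_in.
Qed.

(** <T v, y> = 0 on J gives, since J absorbs L_w on the right, that adj(T) y is
orthogonal to every L_w v; cyclicity of v makes adj(T) y vanish for every T in J,
which is stronger than y being in N. *)
Lemma annihilator_N (v y : l2 word) : cyclic_vector v \/ y = 0 ->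
  (forall T, J T -> ip (T v) y = 0) -> N y.
Proof.
move=> [cyc H T JT|->]; last by move=> _ T _; exact: ip0l.
have -> : ip y (T (xi [::])) = ip (adj T y) (xi [::]) by rewrite adjEr.
rewrite (cyc (adj T y)) ?ip0l // => w.
by rewrite -adjE -bcompE H //; apply: ideal_mulr => //; exact: fs_L.
Qed.

(** If T were outside J, a finite-rank functional would separate it from J.  That
functional is <T v, y> with y in N, and it only depends on e T. *)
Lemma compr_kernel T : fs_alg T -> compr J T = 0 -> J T.
Proof.
move=> fT eT; apply: contrapT => nJT.
have [t [tJ tT]] := wot_separation ideal_sub ideal_wot nJT.
have [v [y [H cyc]]] := finite_functional t.
have Ny : N y.
  apply: (annihilator_N cyc) => S JS; rewrite -H ?tJ //; exact: ideal_fs.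
move: tT; rewrite H // -(Nproj_id Ny) -Nproj_sa -bcompE -compr_fs // eT.
by rewrite zerobopE ip0l eqxx.
Qed.

End one_ideal.
End ideals.

(** * The Hahn-Banach theorem *)

Section hahn_banach.
Context {R : realType} {V : lmodType R}.
Variables (K G0 : V -> R -> Prop).
Hypothesis K00 : K 0 0.
Hypothesis KD : forall v v' s s', K v s -> K v' s' -> K (v + v') (s + s').
Hypothesis KZ : forall t v s, 0 < t -> K v s -> K (t *: v) (t * s).
Hypothesis KN : forall v s, K v s -> K (- v) s.
Hypothesis G00 : G0 0 0.
Hypothesis G0lin : forall a v v' r r', G0 v r -> G0 v' r' -> G0 (a *: v + v') (a * r + r').
Hypothesis G0K : forall v r s, G0 v r -> K v s -> r <= s.

Let good (G : set (V * R)) :=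
  (forall a p q, G p -> G q -> G (a *: p.1 + q.1, a * p.2 + q.2)) /\
  (forall p s, G p -> K p.1 s -> p.2 <= s).

Let gr0 : set (V * R) := [set p | G0 p.1 p.2].

(** Partial functionals are represented by their graphs.  The Zorn argument ranges
over sets A whose union with gr0 is good, so that the empty chain is bounded as
well. *)
Lemma hb_maximal : exists G, [/\ good G, gr0 `<=` G &
  forall H, good H -> G `<=` H -> H `<=` G].
Proof.
have [|A [PA maxA]] := @Zorn_bigcup (V * R)%type (fun A => good (A `|` gr0)).
  move=> F FP Ftot; split.
    move=> a p q.
    have lin0 : gr0 p -> gr0 q -> gr0 (a *: p.1 + q.1, a * p.2 + q.2).
      by move=> hp hq; exact: G0lin.
    have up A : F A -> (A `|` gr0) p -> (A `|` gr0) q ->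
        (\bigcup_(X in F) X `|` gr0) (a *: p.1 + q.1, a * p.2 + q.2).
      move=> FA hp hq; have [l _] := FP A FA.
      by have [h|h] := l a p q hp hq; [left; exists A|right].
    move=> [[A FA Ap]|p0] [[B FB Bq]|q0].
    - have [AB|BA] := Ftot A B FA FB.
        by apply: (up B) => //; left => //; exact: AB.
      by apply: (up A) => //; left => //; exact: BA.
    - by apply: (up A) => //; [left|right].
    - by apply: (up B) => //; [right|left].
    - by right; exact: lin0.
  move=> p s [[A FA Ap]|p0]; last exact: G0K.
  by have [_] := FP A FA; apply; left.
exists (A `|` gr0); split=> // H gH AH p Hp; apply: contrapT => nHp.
apply: (maxA H); last by rewrite setUidl // => q q0; apply: AH; right.
split=> [q Aq|HA]; first by apply: AH; left.
by apply: nHp; left; exact: HA.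
Qed.

Lemma hb_functional G v r r' : good G -> G (v, r) -> G (v, r') -> r = r'.
Proof.
move=> [lin dom] Gr Gr'.
have le (a b : R) : G (v, a) -> G (v, b) -> a <= b.
  move=> Ga Gb; have := lin (-1) _ _ Gb Ga; rewrite /= scaleN1r addNr mulN1r => h.
  by have := dom _ 0 h K00; rewrite /= addrC subr_le0.
by apply/le_anti; rewrite !le.
Qed.

(** The one-dimensional extension: the value a at x0 has to lie between the numbers
p.2 - s with K (p.1 - x0) s and the numbers s - p.2 with K (p.1 + x0) s, and the
supremum of the former does. *)
Lemma hb_extend G x0 s0 : good G -> gr0 `<=` G -> K x0 s0 ->
  (forall H, good H -> G `<=` H -> H `<=` G) -> exists a, G (x0, a).
Proof.
move=> [lin dom] G0G Kx0 maxG.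
have Gz : G (0, 0) by apply: G0G; exact: G00.
have GZ t p : G p -> G (t *: p.1, t * p.2).
  by move=> Gp; have := lin t p (0, 0) Gp Gz; rewrite !addr0.
pose D := [set z | exists p s, [/\ G p, K (p.1 - x0) s & z = p.2 - s]].
have ub p s : G p -> K (p.1 + x0) s -> ubound D (s - p.2).
  move=> Gp Kp _ [q [s' [Gq Kq ->]]].
  have h := lin 1 p q Gp Gq; rewrite scale1r mul1r in h.
  have k := KD Kp Kq; rewrite addrACA subrr addr0 in k.
  by have := dom _ _ h k; rewrite /=; lra.
have D0 : D !=set0.
  by exists (0 - s0), (0, 0), s0; split => //; rewrite sub0r; exact: KN.
pose a := sup D.
have a_le p s : G p -> K (p.1 + x0) s -> p.2 + a <= s.
  by move=> Gp Kp; have := ge_sup D0 (ub p s Gp Kp); rewrite -/a; lra.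
have a_ge p s : G p -> K (p.1 - x0) s -> p.2 - a <= s.
  move=> Gp Kp; have : p.2 - s <= a.
    apply: ub_le_sup; last by exists p, s.
    by exists (s0 - 0); apply: (ub (0, 0)) => //; rewrite add0r.
  by lra.
pose H := [set q | exists p t, G p /\ q = (p.1 + t *: x0, p.2 + t * a)].
have gH : good H.
  split.
    move=> b _ _ [p [t [Gp ->]]] [q [u [Gq ->]]].
    exists (b *: p.1 + q.1, b * p.2 + q.2), (b * t + u); split; first exact: lin.
    by congr pair => /=; [rewrite scalerDr scalerDl -scalerA addrACA|ring].
  move=> _ s [p [t [Gp ->]]] /= Kq.
  have [t0|t0|t0] := ltgtP t 0; last first.
  - by move: Kq; rewrite t0 scale0r mul0r !addr0; exact: dom.
  - have ti : 0 < t^-1 by rewrite invr_gt0.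
    have := KZ ti Kq; rewrite scalerDr scalerA mulVf ?gt_eqF // scale1r => k.
    have := a_le _ _ (GZ t^-1 _ Gp) k; rewrite /= -(@ler_pM2l _ t) // mulrDr !mulrA.
    by rewrite divff ?gt_eqF // !mul1r.
  - have nt : 0 < - t by rewrite oppr_gt0.
    have ti : 0 < (- t)^-1 by rewrite invr_gt0.
    have := KZ ti Kq; rewrite scalerDr scalerA.
    rewrite (_ : (- t)^-1 * t = -1); last by rewrite invrN mulNr mulVf ?lt_eqF.
    rewrite scaleN1r => k.
    have := a_ge _ _ (GZ (- t)^-1 _ Gp) k; rewrite /= -(@ler_pM2l _ (- t)) // mulrBr !mulrA.
    by rewrite divff ?gt_eqF // !mul1r mulNr opprK.
exists a; apply: (maxG H) => //.
  by move=> p Gp; exists p, 0; split=> //; rewrite scale0r mul0r !addr0; case: p {Gp}.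
by exists (0, 0), 1; split=> //=; rewrite scale1r mul1r !add0r.
Qed.

(** The dominating seminorm is given by its upper graph K, which need not be defined
everywhere and need not be attained; the extended functional is linear on the
domain of K.  In the application V is a space of functions on L, and
only the vector functionals lie in the domain. *)
Lemma hahn_banach : exists lam : V -> R,
  [/\ forall v r, G0 v r -> (exists s, K v s) -> lam v = r,
      forall v s, K v s -> lam v <= s &
      forall a v v' s s', K v s -> K v' s' -> lam (a *: v + v') = a * lam v + lam v'].
Proof.
have [G [gG G0G maxG]] := hb_maximal.
pose lam v := xget 0 [set r | G (v, r)].
have lamP v s : K v s -> G (v, lam v).
  move=> Kv; have [a Ga] := hb_extend gG G0G Kv maxG.
  exact: (@xgetPex _ 0 [set r | G (v, r)] (ex_intro _ a Ga)).
exists lam; split.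
- move=> v r Gv [s Kv]; apply: (hb_functional gG (lamP _ _ Kv)); exact: G0G.
- by move=> v s Kv; have [_ dom] := gG; exact: (dom (v, lam v)) (lamP _ _ Kv) Kv.
- move=> a v v' s s' Kv Kv'; have [lin _] := gG.
  have h := lin a _ _ (lamP _ _ Kv) (lamP _ _ Kv').
  have [u Kav] : exists u, K (a *: v + v') u.
    have [a0|a0|->] := ltgtP a 0; last by exists s'; rewrite scale0r add0r.
      exists (- a * s + s'); apply: KD Kv'; rewrite -[a in a *: _]opprK scaleNr.
      by apply: KN; apply: KZ Kv; rewrite oppr_gt0.
    by exists (a * s + s'); apply: KD Kv'; exact: KZ.
  exact: (hb_functional gG (lamP _ _ Kav) h).
Qed.

End hahn_banach.

(** * Weak* closedness of the quotient algebra *)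

Section quotient_closed.
Context {R : realType} {d : nat}.
Local Notation nc := (@Normc.normc R).
Local Notation C := R[i].
Local Notation l2 := (@l2 R).
Local Notation bop := (@bop R).
Local Notation word := (seq 'I_d).
Local Notation L := (@L R d).
Local Notation fs_alg := (@fs_alg R d).
Implicit Types (w : word).

Lemma sum_nc_le (I : eqType) (t : seq I) (F G : I -> C) (r : R) :
  (forall p, p \in t -> nc (F p - G p) <= r) ->
  nc (\sum_(p <- t) F p - \sum_(p <- t) G p) <= (size t)%:R * r.
Proof.
elim: t => [|p t IH] H.
  by rewrite !big_nil subrr mul0r nc0.
rewrite !big_cons opprD addrACA -natr1 mulrDl mul1r addrC [leRHS]addrC.
rewrite addrC; apply: le_trans (@le_normcD R _ _) _; apply: lerD.
  by apply: H; rewrite inE eqxx.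
by apply: IH => q qt; apply: H; rewrite inE qt orbT.
Qed.

(** Finite linear relations between matrix coefficients pass to weak* closures. *)
Lemma wstar_closure_relation (A : set (bop word word)) (t : seq (l2 word * l2 word)) :
  (forall S, A S -> \sum_(p <- t) ip (S p.1) p.2 = 0) ->
  forall X, wstar_closure A X -> \sum_(p <- t) ip (X p.1) p.2 = 0.
Proof.
move=> At X /wstar_closureP cX; apply: eps_eq => e e0.
pose n : R := (size t).+1%:R; have n0 : 0 < n by rewrite ltr0n.
have [S AS SS] := cX [seq (tensv (std_vec 0%N) p.1, tensv (std_vec 0%N) p.2) | p <- t] _ (divr_gt0 e0 n0).
rewrite -[Y in _ - Y](At S AS).
apply: le_trans (@sum_nc_le _ _ _ _ (e / n) _) _ => [p pt|].
  rewrite -ncN opprB -!wcoef_tensv; apply/ltW.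
  apply: (SS (tensv (std_vec 0%N) p.1, tensv (std_vec 0%N) p.2)).
  exact: (map_f (fun p => (tensv (std_vec 0%N) p.1, tensv (std_vec 0%N) p.2))).
by rewrite mulrCA ler_piMr ?(ltW e0) // ler_pdivrMr // mul1r ler_nat.
Qed.

Variable J : set (bop word word).
Hypothesis idJ : wot_ideal J.
Local Notation e := (Nproj J).
Local Notation N := (Nspace J).

Lemma quot_alg_ip S (v y : l2 word) : fs_alg S -> N y ->
  ip (compr J S v) y = ip (S v) y.
Proof. by move=> fS Ny; rewrite (compr_fs idJ) // bcompE Nproj_ip. Qed.

Lemma N_lin c (f g : l2 word) : N f -> N g -> N (c *: f + g).
Proof. by rewrite NspaceE; exact: ann_lin. Qed.

Variable X : bop word word.
Hypothesis cX : wstar_closure (quot_alg J) X.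

(** For y in N the coefficients <e T e v, y> and <T v, y> agree.  A relation that
holds between such coefficients on L therefore holds on the quotient algebra and
on its closure: X acts on the functionals <T v, y> with y in N. *)
Lemma relation_transfer (t : seq (l2 word * l2 word)) :
  (forall p, p \in t -> N p.2) ->
  (forall T, fs_alg T -> \sum_(p <- t) ip (T p.1) p.2 = 0) ->
  \sum_(p <- t) ip (X p.1) p.2 = 0.
Proof.
move=> tN H; apply: wstar_closure_relation cX => _ [T fT <-].
rewrite -[RHS](H T fT) !big_seq; apply: eq_bigr => p pt.
by rewrite quot_alg_ip //; exact: tN.
Qed.

Lemma transfer2 (v1 y1 v2 y2 v y : l2 word) : N y1 -> N y2 -> N y ->
  (forall T, fs_alg T -> ip (T v1) y1 + ip (T v2) y2 = ip (T v) y) ->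
  ip (X v1) y1 + ip (X v2) y2 = ip (X v) y.
Proof.
move=> N1 N2 Ny H.
have := @relation_transfer [:: (v1, y1); (v2, y2); (- v, y)].
rewrite !big_cons !big_nil /= addr0 bopN ipNl addrA => E.
apply/eqP; rewrite -subr_eq0 E // => [p|T fT].
  by rewrite !inE => /or3P [] /eqP ->.
by rewrite !big_cons big_nil /= addr0 bopN ipNl addrA H // subrr.
Qed.

Lemma transfer1 (v1 y1 v y : l2 word) : N y1 -> N y ->
  (forall T, fs_alg T -> ip (T v1) y1 = ip (T v) y) -> ip (X v1) y1 = ip (X v) y.
Proof.
move=> N1 Ny H; have N0 : N 0 by rewrite NspaceE; exact: ann0.
have <- : ip (X v1) y1 + ip (X 0) 0 = ip (X v) y.
  by apply: transfer2 => // T fT; rewrite ip0r addr0 H.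
by rewrite ip0r addr0.
Qed.

Let V := ({T : bop word word | fs_alg T} -> R^o).
(** Real parts suffice, because L is closed under multiplication by the imaginary
unit; they put the extension problem over the real field. *)
Definition re_coef (v y : l2 word) : V := fun T => complex.Re (ip (sval T v) y).

Lemma fs_alg_Z c T : fs_alg T -> fs_alg (c *: T).
Proof. exact: (subspaceZ c (@fs_sub R d)). Qed.

Lemma re_coef_eq v y v' y' : re_coef v y = re_coef v' y' ->
  forall T, fs_alg T -> ip (T v) y = ip (T v') y'.
Proof.
move=> E; have re T : fs_alg T -> complex.Re (ip (T v) y) = complex.Re (ip (T v') y').
  by move=> fT; exact: (congr1 (fun f : V => f (exist _ T fT)) E).
move=> T fT; apply: cpx_ext; first exact: re.
have := re _ (fs_alg_Z (Complex 0 1) fT); rewrite !scalebopE !ipZl !cReM /=.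
by rewrite !mul0r !mul1r !sub0r => /oppr_inj.
Qed.

Lemma re_coef_scale (a : R) v y : a *: re_coef v y = re_coef (a%:C%C *: v) y.
Proof.
apply/funext => T; rewrite /re_coef bopZ ipZl cReM /= mul0r subr0.
by [].
Qed.

Lemma re_coefN v y : - re_coef v y = re_coef v (- y).
Proof. by apply/funext => T; rewrite /re_coef ipNr cReN. Qed.

Lemma two_re_coefs v1 y1 v2 y2 : exists v y,
  [/\ re_coef v1 y1 + re_coef v2 y2 = re_coef v y,
      forall T, fs_alg T -> ip (T v1) y1 + ip (T v2) y2 = ip (T v) y,
      l2norm v ^+ 2 <= l2norm v1 ^+ 2 + l2norm v2 ^+ 2,
      l2norm y ^+ 2 <= l2norm y1 ^+ 2 + l2norm y2 ^+ 2 &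
      cyclic_vector v \/ y = 0].
Proof.
have [v [y [H vn yn cyc]]] := two_functionals v1 y1 v2 y2.
exists v, y; split=> //; apply/funext => -[T fT].
by rewrite /re_coef -H // cReD.
Qed.

Lemma N_ideal0 T (v y : l2 word) : J T -> N y -> ip (T v) y = 0.
Proof. by move=> JT Ny; rewrite (adjE T) (adj_ideal_N idJ) // ip0r. Qed.

(** X defines a functional on the coefficients with y in N, and Hahn-Banach extends
it to all coefficients of L.  Measuring a coefficient by M (|v|^2 + |y|^2) / 2
rather than by the product M |v| |y| makes the dominating cone stable under
addition, by two_functionals.  Domination uses that a functional killing J can be
represented, without increasing the norms, by a pair (v, y) with v cyclic, and
then y is in N. *)
Lemma lifting_functional : exists2 M : R, 0 <= M & exists lam : V -> R,
  [/\ forall v y, N y -> lam (re_coef v y) = complex.Re (ip (X v) y),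
      forall v y, lam (re_coef v y) <= M * ((l2norm v ^+ 2 + l2norm y ^+ 2) / 2) &
      forall a v y v' y', lam (a *: re_coef v y + re_coef v' y') =
        a * lam (re_coef v y) + lam (re_coef v' y')].
Proof.
have [M M0 XM] := bop_bounded X; exists M => //.
pose K (phi : V) (s : R) := exists v y,
  phi = re_coef v y /\ M * ((l2norm v ^+ 2 + l2norm y ^+ 2) / 2) <= s.
pose G0 (phi : V) (r : R) := exists v y,
  [/\ phi = re_coef v y, N y & r = complex.Re (ip (X v) y)].
have N0 : N 0 by rewrite NspaceE; exact: ann0.
have re_coef0 : re_coef 0 0 = 0 by apply/funext => T; rewrite /re_coef ip0r.
have KR v y : K (re_coef v y) (M * ((l2norm v ^+ 2 + l2norm y ^+ 2) / 2)).
  by exists v, y.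
have [|||||||lam [lamG lamK laml]] := @hahn_banach R V K G0.
- by exists 0, 0; rewrite re_coef0 !l2norm0 expr0n addr0 mul0r mulr0.
- move=> _ _ s s' [v1 [y1 [-> h1]]] [v2 [y2 [-> h2]]].
  have [v [y [E _ vn yn _]]] := two_re_coefs v1 y1 v2 y2.
  exists v, y; split=> //; apply: le_trans (lerD h1 h2).
  rewrite -mulrDr -mulrDl ler_wpM2l // ler_wpM2r //.
  by apply: le_trans (lerD vn yn) _; rewrite addrACA.
- move=> t _ s t0 [v [y [-> h]]].
  (* A factor t is distributed as sqrt t on both vectors, to scale the cost by t. *)
  pose q : C := (Num.sqrt t)%:C%C.
  exists (q *: v), (q *: y); split.
    apply/funext => T.
    transitivity (t * complex.Re (ip (sval T v) y)); first by [].
    rewrite /re_coef bopZ ipZl ipZr conjcR mulrA -rcM -expr2 sqr_sqrtr ?(ltW t0) //.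
    by rewrite cReM /= mul0r subr0.
  rewrite !l2normZ nc_real ?sqrtr_ge0 // !exprMn sqr_sqrtr ?(ltW t0) // -mulrDr.
  by rewrite -mulrA mulrCA ler_wpM2l // (ltW t0).
- move=> _ s [v [y [-> h]]]; exists v, (- y); split; first exact: re_coefN.
  by rewrite l2normN.
- by exists 0, 0; rewrite ip0r.
- move=> a _ _ r r' [v1 [y1 [-> Ny1 ->]]] [v2 [y2 [-> Ny2 ->]]].
  have [v [y [E Ec _ _ cyc]]] := two_re_coefs (a%:C%C *: v1) y1 v2 y2.
  have Ny : N y.
    apply: (annihilator_N idJ cyc) => T JT; rewrite -Ec; last exact: (ideal_fs idJ).
    by rewrite !N_ideal0 // addr0.
  exists v, y; split=> //; first by rewrite -E re_coef_scale.
  rewrite -(transfer2 Ny1 Ny2 Ny Ec) cReD bopZ ipZl cReM /= mul0r subr0.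
  by [].
- move=> _ _ s [v [y [-> Ny ->]]] [v' [y' [E h]]].
  have [v2 [y2 [E2 _ vn yn cyc]]] := two_re_coefs v' y' 0 0.
  rewrite re_coef0 addr0 -E in E2.
  rewrite !l2norm0 !expr0n !addr0 in vn yn.
  have Ec := re_coef_eq E2.
  have Ny2 : N y2.
    apply: (annihilator_N idJ cyc) => T JT; rewrite -Ec; last exact: (ideal_fs idJ).
    exact: N_ideal0.
  rewrite (transfer1 Ny Ny2 Ec); apply: le_trans h.
  apply: le_trans (ler_norm _) _; apply: le_trans (Re_le_nc _) _.
  apply: le_trans (cauchy_schwarz _ _) _.
  apply: le_trans (ler_wpM2r (l2norm_ge0 _) (XM _)) _.
  rewrite -mulrA ler_wpM2l //.
  by have := sqr_ge0 (l2norm v2 - l2norm y2); move: vn yn; rewrite sqrrB; lra.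
exists lam; split.
- by move=> v y Ny; apply: lamG; [exists v, y|eexists; exact: KR].
- by move=> v y; apply: lamK; exact: KR.
- by move=> a v y v' y'; apply: laml; exact: KR.
Qed.

(** As a function of (v, y), the extended functional lam is the real part of a bounded
sesquilinear form, and so of the form <T v, y> of an operator T.  Since lam respects all
linear relations between coefficients on L, the operator T cannot be separated
from L, so it belongs to L; and lam agrees with X when y is in N, so T compresses
to X. *)
Lemma lift_quotient : exists2 T, fs_alg T & X = compr J T.
Proof.
have [M M0 [lam [lamN lamM laml]]] := lifting_functional.
pose im y : l2 word := Complex 0 1 *: y.
have re_coef0 : re_coef 0 0 = 0 by apply/funext => T; rewrite /re_coef ip0r.
have lam0 : lam 0 = 0.
  by have := laml (-1) 0 0 0 0; rewrite !re_coef0 scaler0 addr0 mulN1r addNr.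
have lamZ a v y : lam (a *: re_coef v y) = a * lam (re_coef v y).
  by have := laml a v y 0 0; rewrite re_coef0 lam0 !addr0.
have lamN1 v y : lam (re_coef v (- y)) = - lam (re_coef v y).
  by rewrite -re_coefN -scaleN1r lamZ mulN1r.
have lam3 a b v y v' y' v2 y2 : lam (a *: re_coef v y + b *: re_coef v' y' + re_coef v2 y2) =
    a * lam (re_coef v y) + b * lam (re_coef v' y') + lam (re_coef v2 y2).
  have [v3 [y3 [E _ _ _ _]]] := two_re_coefs (b%:C%C *: v') y' v2 y2.
  rewrite -addrA [b *: _]re_coef_scale E laml -E -re_coef_scale laml addrA.
  by [].
have nonneg (x : l2 word) : 0 <= l2norm x := l2norm_ge0 x.
have lam_le v y : lam (re_coef v y) <= M * (l2norm v * l2norm y).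
  have [v0|v0] := eqVneq (l2norm v) 0.
    rewrite v0 mul0r mulr0 (l2norm_eq0 v0).
    have -> : re_coef 0 y = 0 by apply/funext => T; rewrite /re_coef bop0 ip0l.
    by rewrite lam0.
  have [y0|y0] := eqVneq (l2norm y) 0.
    rewrite y0 !mulr0 (l2norm_eq0 y0).
    have -> : re_coef v 0 = 0 by apply/funext => T; rewrite /re_coef ip0r.
    by rewrite lam0.
  have vp : 0 < l2norm v by rewrite lt_neqAle eq_sym v0 nonneg.
  have yp : 0 < l2norm y by rewrite lt_neqAle eq_sym y0 nonneg.
  (* Scaling v by k and y by 1/k leaves the coefficient unchanged and makes the two
     norms equal, where the arithmetic mean equals the product. *)
  pose k := Num.sqrt (l2norm y / l2norm v).
  have kp : 0 < k by rewrite sqrtr_gt0 divr_gt0.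
  have k2 : k ^+ 2 = l2norm y / l2norm v by rewrite sqr_sqrtr // divr_ge0.
  have -> : re_coef v y = re_coef (k%:C%C *: v) (k^-1%:C%C *: y).
    apply/funext => T; rewrite /re_coef bopZ ipZl ipZr conjcR mulrA -rcM.
    by rewrite divff ?gt_eqF // mul1r.
  apply: le_trans (lamM _ _) _; rewrite ler_wpM2l // !l2normZ !nc_real ?invr_ge0 ?(ltW kp) //.
  rewrite !exprMn exprVn k2 le_eqVlt; apply/orP; left; apply/eqP; field.
  by rewrite v0 y0.
have lam_abs v y : `|lam (re_coef v y)| <= M * (l2norm v * l2norm y).
  rewrite ler_norml lam_le andbT lerNl -lamN1.
  by apply: le_trans (lam_le _ _) _; rewrite l2normN.
have imn y : l2norm (im y) = l2norm y.
  by rewrite l2normZ /= expr0n expr1n add0r sqrtr1 mul1r.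
(* The imaginary part of <T v, y> is the real part of <T v, i y>. *)
pose b (v y : l2 word) : C := Complex (lam (re_coef v y)) (lam (re_coef v (im y))).
have ip_im (z y : l2 word) : ip z (im y) = Complex 0 (-1) * ip z y.
  by rewrite ipZr; congr (_ * _); rewrite /conjc.
have [||||T TE _] := @form_bop R _ _ b (M + M).
- by rewrite addr_ge0.
- move=> [p q] v v' y; apply: cpx_ext; rewrite /b ?(cReD, cImD, cReM, cImM) /=.
    rewrite -mulNr -lam3; congr lam; apply/funext => S.
    transitivity (p * complex.Re (ip (sval S v) y) + (- q) * complex.Re (ip (sval S v) (im y)) + complex.Re (ip (sval S v') y)); last by [].
    rewrite /re_coef bop_linear ipDl ipZl ip_im cReD !cReM /=; ring.
  rewrite -lam3; congr lam; apply/funext => S.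
  transitivity (p * complex.Re (ip (sval S v) (im y)) + q * complex.Re (ip (sval S v) y) + complex.Re (ip (sval S v') (im y))); last by [].
  rewrite /re_coef bop_linear ipDl ipZl !ip_im cReD !cReM !cImM /=; ring.
- move=> [p q] v y y'; apply: cpx_ext; rewrite /b ?(cReD, cImD, cReM, cImM) /=.
    rewrite -mulNr opprK -lam3; congr lam; apply/funext => S.
    transitivity (p * complex.Re (ip (sval S v) y) + q * complex.Re (ip (sval S v) (im y)) + complex.Re (ip (sval S v) y')); last by [].
    rewrite /re_coef ipDr ipZr ip_im cReD !cReM /=; ring.
  rewrite -lam3; congr lam; apply/funext => S.
  transitivity (p * complex.Re (ip (sval S v) (im y)) + (- q) * complex.Re (ip (sval S v) y) + complex.Re (ip (sval S v) (im y'))); last by [].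
  rewrite /re_coef !ip_im ipDr ipZr !cReM !(cReD, cImD, cImM, cReM) /=; ring.
- move=> v y; have -> : b v y = (lam (re_coef v y))%:C%C + (Complex 0 1) * (lam (re_coef v (im y)))%:C%C.
    by apply: cpx_ext; rewrite !(cReD, cImD, cReM, cImM) /=; ring.
  have rn (r : R) : nc r%:C%C = `|r| by rewrite /= expr0n addr0 sqrtr_sqr.
  apply: le_trans (@le_normcD R _ _) _; rewrite Normc.normcM !rn.
  rewrite (_ : nc _ = 1) ?mul1r; last by rewrite /= expr0n expr1n add0r sqrtr1.
  rewrite -mulrA mulrDl; apply: lerD; first exact: lam_abs.
  by apply: le_trans (lam_abs _ _) _; rewrite imn.
have lam_sum (t : seq (l2 word * l2 word)) : exists v y,
    (forall S, fs_alg S -> \sum_(p <- t) ip (S p.1) p.2 = ip (S v) y) /\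
    \sum_(p <- t) lam (re_coef p.1 p.2) = lam (re_coef v y).
  elim: t => [|p t [v [y [H E]]]].
    by exists 0, 0; rewrite big_nil re_coef0 lam0; split=> // S _; rewrite big_nil ip0r.
  have [v3 [y3 [E3 H3 _ _ _]]] := two_re_coefs p.1 p.2 v y.
  exists v3, y3; split=> [S fS|]; first by rewrite big_cons H // H3.
  by rewrite big_cons E -E3; have := laml 1 p.1 p.2 v y; rewrite scale1r mul1r.
have lam_sum0 (t : seq (l2 word * l2 word)) :
    (forall S, fs_alg S -> \sum_(p <- t) ip (S p.1) p.2 = 0) ->
    \sum_(p <- t) lam (re_coef p.1 p.2) = 0.
  move=> H; have [v [y [Hv ->]]] := lam_sum t.
  have -> : re_coef v y = 0.
    by apply/funext => -[S fS]; rewrite /re_coef /= -Hv // H.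
  exact: lam0.
have fT : fs_alg T.
  apply: contrapT => nfT.
  have [t [tf]] := wot_separation (@fs_sub R d) (@fs_wot R d) nfT.
  under eq_bigr do rewrite TE; move=> /eqP; apply; apply: cpx_ext.
    have -> : complex.Re (\sum_(p <- t) b p.1 p.2) = \sum_(p <- t) lam (re_coef p.1 p.2).
      elim: (t) => [|p s IH]; first by rewrite !big_nil.
      by rewrite !big_cons cReD IH.
    exact: lam_sum0.
  have -> : complex.Im (\sum_(p <- t) b p.1 p.2) = \sum_(p <- [seq (p.1, im p.2) | p <- t]) lam (re_coef p.1 p.2).
    elim: (t) => [|p s IH]; first by rewrite !big_nil.
    by rewrite /= !big_cons cImD IH.
  apply: lam_sum0 => S fS; rewrite big_map /=.
  by under eq_bigr do rewrite ip_im; rewrite -mulr_sumr tf // mulr0.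
exists T => //.
(* Elements of the closure are fixed by the compression. *)
have <- : compr J X = X.
  apply: (@normal_eq _ _ _ (compr J) idfun (quot_alg J)) cX.
  - exact: normal_mul.
  - exact: normal_id.
  - move=> _ [S fS <-]; rewrite /compr.
    by rewrite !bcompA NprojK -!bcompA NprojK.
apply: bop_ext => f; apply: ip_eq => g; rewrite /compr !bcompE !Nproj_sa TE.
have Ng : N (e g) := Nproj_in g.
apply: cpx_ext => /=; first by rewrite lamN.
rewrite lamN; last by rewrite -[im _]addr0; apply: N_lin => //; rewrite NspaceE; exact: ann0.
by rewrite ip_im cReM /=; ring.
Qed.

End quotient_closed.

Lemma quot_alg_closed (R : realType) (d : nat) (J : set (@bop R (seq 'I_d) (seq 'I_d))) :
  wot_ideal J -> wstar_closed (quot_alg J).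
Proof.
by move=> idJ; apply/wstar_closedP => X /(lift_quotient idJ) [T fT ->]; exists T.
Qed.

(** * Complete contractivity of spatial maps *)

Section spatial_maps.
Context {R : realType}.
Implicit Types (X Y Z K : choiceType).
Local Notation l2 := (@l2 R).
Local Notation bop := (@bop R).
Local Notation reindex := (@Defs.reindex R _ _ _).

Definition norm_le1 X Y (T : bop X Y) := forall f, l2norm (T f) <= l2norm f.

Lemma norm_le1_comp X Y Z (S : bop Y Z) (T : bop X Y) :
  norm_le1 S -> norm_le1 T -> norm_le1 (bcomp S T).
Proof. by move=> cS cT f; rewrite bcompE; apply: le_trans (cS _) (cT _). Qed.

Lemma norm_le1_amp X Y Z (T : bop Y Z) : norm_le1 T -> norm_le1 (amp X T).
Proof.
by move=> cT f; rewrite -[leRHS]mul1r; apply: amp_norm => // g; rewrite mul1r.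
Qed.

Lemma norm_le1_adj X Y (T : bop X Y) : norm_le1 T -> norm_le1 (adj T).
Proof.
by move=> cT f; rewrite -[leRHS]mul1r; apply: adj_norm => // g; rewrite mul1r.
Qed.

Lemma norm_le1_reindex X Y (h : Y -> X) (hI : injective h) : norm_le1 (reindex hI).
Proof. by move=> f; rewrite -[leRHS]mul1r; exact: reindex_norm. Qed.

Lemma norm_le1_tens X Y X' Y' (S : bop X X') (T : bop Y Y') :
  norm_le1 S -> norm_le1 T -> norm_le1 (tens S T).
Proof.
move=> cS cT; apply: norm_le1_comp; first exact: norm_le1_reindex.
apply: norm_le1_comp; first exact: norm_le1_amp.
apply: norm_le1_comp; first exact: norm_le1_reindex.
exact: norm_le1_amp.
Qed.

(** mxnorm is an infimum of real numbers; were the set empty, it would be 0 and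
carry no information. *)
Lemma mxnorm_set_nonempty n X (a : 'M[bop X X]_n) :
  [set M : R | 0 <= M /\ forall v : 'I_n -> l2 X,
    \sum_i l2norm (\sum_j a i j (v j)) ^+ 2 <= M ^+ 2 * \sum_j l2norm (v j) ^+ 2] !=set0.
Proof.
have /choice [m mP] : forall ij : 'I_n * 'I_n, exists m : R, 0 < m /\
    forall f, l2norm (a ij.1 ij.2 f) <= m * l2norm f.
  by move=> ij; have [m m0 H] := bop_gt0 (a ij.1 ij.2); exists m.
pose M := \sum_i \sum_j m (i, j).
have M0 : 0 <= M by apply: sumr_ge0 => i _; apply: sumr_ge0 => j _; case: (mP (i, j)) => /ltW.
pose q : R := n%:R.
have q0 : 0 <= q by rewrite ler0n.
have mM i j : m (i, j) <= M.
  rewrite /M (bigD1 i) //= (bigD1 j) //= -addrA lerDl addr_ge0 //.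
    by apply: sumr_ge0 => k _; case: (mP (i, k)) => /ltW.
  by apply: sumr_ge0 => k _; apply: sumr_ge0 => l _; case: (mP (k, l)) => /ltW.
exists (M * (q + 1) * (q + 1)); split; first by rewrite !mulr_ge0 ?addr_ge0.
move=> v; set S := \sum_j l2norm (v j) ^+ 2.
have S0 : 0 <= S by apply: sumr_ge0 => j _; rewrite sqr_ge0.
have vS j : l2norm (v j) <= Num.sqrt S.
  rewrite -ler_sqr ?nnegrE ?l2norm_ge0 ?sqrtr_ge0 // (sqr_sqrtr S0) /S (bigD1 j) //=.
  by rewrite lerDl; apply: sumr_ge0 => k _; rewrite sqr_ge0.
have rowle i : l2norm (\sum_j a i j (v j)) <= M * (q + 1) * Num.sqrt S.
  apply: (@le_trans _ _ (\sum_(j < n) l2norm (a i j (v j)))).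
    elim/big_rec2 : _ => [|j x f _ IH]; first by rewrite l2norm0.
    by apply: le_trans (l2normD _ _) _; rewrite lerD2l.
  apply: (@le_trans _ _ (\sum_(j < n) M * Num.sqrt S)).
    apply: ler_sum => j _; case: (mP (i, j)) => m0 /(_ (v j)) /le_trans; apply.
    by apply: ler_pM; rewrite ?l2norm_ge0 //; exact: ltW.
  rewrite sumr_const card_ord -mulr_natr -/q mulrAC ler_wpM2r ?sqrtr_ge0 //.
  by rewrite ler_wpM2l // lerDl.
apply: (@le_trans _ _ (\sum_(i < n) (M * (q + 1) * Num.sqrt S) ^+ 2)).
  apply: ler_sum => i _; rewrite ler_sqr ?nnegrE ?l2norm_ge0 //.
  by rewrite !mulr_ge0 ?addr_ge0 ?sqrtr_ge0.
rewrite sumr_const card_ord -mulr_natr -/q [(_ * Num.sqrt S) ^+ 2]exprMn (sqr_sqrtr S0).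
rewrite mulrAC ler_wpM2r // [X in _ <= X]exprMn ler_wpM2l ?sqr_ge0 //.
by rewrite expr2 mulrDl mul1r; have := sqr_ge0 q; rewrite expr2; nra.
Qed.

Lemma amp_row n K X (a : 'I_n -> bop X X) (w : 'I_n -> l2 (K * X)%type) k :
  slice (\sum_j amp K (a j) (w j)) k = \sum_j a j (slice (w j) k).
Proof.
rewrite [LHS]bop_sum; apply: eq_bigr => j _; exact: slice_amp.
Qed.

Lemma sum_norm_slices n K X (w : 'I_n -> l2 (K * X)%type) :
  ((\sum_(i < n) l2norm (w i) ^+ 2)%:E =
  \esum_(k in [set: K]) (\sum_(i < n) l2norm (slice (w i) k) ^+ 2)%:E)%E.
Proof.
rewrite -sumEFin; under [RHS]eq_esum do rewrite -sumEFin.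
rewrite esum_sum; last by move=> *; rewrite lee_fin sqr_ge0.
by apply: eq_bigr => i _; rewrite l2normE sqsum_slices.
Qed.

(** A bound for the matrix (a_ij) is one for its amplification, slice by slice, and
B and D do not increase norms; so every bound for a is a bound for its image. *)
Lemma spatial_completely_contractive K X Y (B : bop (K * X)%type Y)
    (D : bop Y (K * X)%type) (A : set (bop X X)) :
  norm_le1 B -> norm_le1 D ->
  completely_contractive A (fun T => bcomp B (bcomp (amp K T) D)).
Proof.
move=> cB cD n a _; rewrite /mxnorm.
set S1 := [set _ | _]; set S2 := [set _ | _].
have S2S1 : S2 `<=` S1.
  move=> M [M0 H]; split=> // v.
  pose w j := D (v j).
  apply: (@le_trans _ _ (\sum_i l2norm (\sum_j amp K (a i j) (w j)) ^+ 2)).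
    apply: ler_sum => i _; rewrite ler_sqr ?nnegrE ?l2norm_ge0 //.
    rewrite (_ : \sum_j _ = B (\sum_j amp K (a i j) (w j))) //.
    by rewrite bop_sum; apply: eq_bigr => j _; rewrite mxE.
  apply: (@le_trans _ _ (M ^+ 2 * \sum_j l2norm (w j) ^+ 2)); last first.
    rewrite ler_wpM2l ?sqr_ge0 //; apply: ler_sum => j _.
    by rewrite ler_sqr ?nnegrE ?l2norm_ge0 //; exact: cD.
  rewrite -lee_fin EFinM !sum_norm_slices -esumZ ?sqr_ge0 //; last first.
    by move=> k; rewrite lee_fin; apply: sumr_ge0 => i _; rewrite sqr_ge0.
  apply: le_esum => k _; rewrite -EFinM lee_fin.
  by under eq_bigr do rewrite amp_row; exact: H.
apply: lb_le_inf; first exact: mxnorm_set_nonempty.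
by move=> M /S2S1 S1M; apply: ge_inf => //; exists 0 => x [].
Qed.

End spatial_maps.

(** * The canonical comultiplication of a Hopf ideal *)

Section common_prefix.
Variable A : eqType.
Implicit Types (a b c : seq A).

Fixpoint split_prefix a b : (seq A * seq A) * seq A :=
  match a, b with
  | x :: a', y :: b' =>
      if x == y then ((split_prefix a' b').1, x :: (split_prefix a' b').2)
      else ((a, b), [::])
  | _, _ => ((a, b), [::])
  end.

Lemma split_prefixK a b :
  ((split_prefix a b).2 ++ (split_prefix a b).1.1 = a) *
  ((split_prefix a b).2 ++ (split_prefix a b).1.2 = b).
Proof.
elim: a b => [|x a IH] [|y b] //=; case: eqP => [<-|] //=.
by rewrite !IH.
Qed.

Lemma split_prefix_cat c a b : split_prefix (c ++ a) (c ++ b) =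
  ((split_prefix a b).1, c ++ (split_prefix a b).2).
Proof. by elim: c => [|x c IH] /=; [case: split_prefix|rewrite eqxx IH]. Qed.

(** The pairs p with split_pair p = (p, [::]) are those without a common first
letter; they index a basis of the wandering subspace of the operators L_w ⊗ L_w. *)
Lemma split_prefix_idem a b :
  split_prefix (split_prefix a b).1.1 (split_prefix a b).1.2 = ((split_prefix a b).1, [::]).
Proof.
elim: a b => [|x a IH] [|y b] //=; case: eqP => [_|/eqP /negbTE ne] /=; first exact: IH.
by rewrite ne.
Qed.

Definition split_pair (p : seq A * seq A) := split_prefix p.1 p.2.

Lemma split_pair_inj : injective split_pair.
Proof.
move=> [a b] [a' b'] /(congr1 (fun z => (z.2 ++ z.1.1, z.2 ++ z.1.2))).
by rewrite /split_pair /= !split_prefixK.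
Qed.

End common_prefix.

Section comultiplication.
Context {R : realType} {d : nat}.
Local Notation C := R[i].
Local Notation l2 := (@l2 R).
Local Notation bop := (@bop R).
Local Notation reindex := (@Defs.reindex R _ _ _).
Local Notation word := (seq 'I_d).
Local Notation WW := (seq 'I_d * seq 'I_d)%type.
Local Notation L := (@L R d).
Local Notation fs_alg := (@fs_alg R d).
Implicit Types (u v w : word) (X Y Z K : choiceType).

(** The adjoint of wold_map sends the basis vector (w p.1, w p.2), for a pair p
without a common first letter, to p ⊗ w.  So wold_map is the Wold decomposition of
the row isometry L_w ⊗ L_w, as a multiple of L_w; it is indexed by all pairs to
keep the type simple, and vanishes at the pairs with a common first letter. *)
Definition wold_map : bop (WW * word)%type WW := reindex (@split_pair_inj 'I_d).
Local Notation G := wold_map.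

Lemma wold_mapE f p : G f p = f (split_pair p). Proof. by []. Qed.

Lemma wold_map_coiso : bcomp G (adj G) = bid WW.
Proof. exact: reindex_coiso. Qed.

Lemma wold_map_std_vec (p : WW) u : G (tensv (std_vec p) (std_vec u)) =
  if split_pair p == (p, [::]) then tensv (std_vec (u ++ p.1)) (std_vec (u ++ p.2)) else 0.
Proof.
rewrite -std_vec_pair; case: eqP => [red|nred].
  rewrite -std_vec_pair -[RHS](reindex_std_vec (@split_pair_inj 'I_d)); congr (G (std_vec _)).
  by rewrite /split_pair split_prefix_cat /= -/(split_pair p) red cats0.
apply: l2_ext => q; rewrite wold_mapE std_vecE; case: eqP => // E; case: nred.
have := split_prefix_idem q.1 q.2; rewrite -/(split_pair q) E /=.
by [].
Qed.

Lemma wold_map_L w : bcomp (tens (L w) (L w)) G = bcomp G (amp WW (L w)).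
Proof.
apply: bop_tensv => p u; rewrite (bcompE _ G) (bcompE G) amp_tensv L_std_vec !wold_map_std_vec.
by case: ifP => _; rewrite ?bop0 // tensE !L_std_vec !catA.
Qed.

(** The projection adj(G) G only selects slices, and so commutes with 1 ⊗ T. *)
Lemma wold_map_amp (T : bop word word) :
  bcomp G (bcomp (amp WW T) (bcomp (adj G) G)) = bcomp G (amp WW T).
Proof.
pose Q := bcomp (adj G) G.
have sQ F p : slice (Q F) p = if split_pair p == (p, [::]) then slice F p else 0.
  apply: l2_ext => u; rewrite sliceE -ip_std_vec bcompE adjEr std_vec_pair wold_map_std_vec.
  case: ifP => [/eqP red|_]; last by rewrite ip0r.
  rewrite -std_vec_pair ip_std_vec wold_mapE /split_pair split_prefix_cat /= -/(split_pair p) red.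
  by rewrite cats0.
have comm : bcomp (amp WW T) Q = bcomp Q (amp WW T).
  apply: bop_ext => F; apply: slice_ext => p; rewrite !bcompE -/(bcomp _ _) slice_amp.
  rewrite -!(bcompE (adj G) G) !sQ slice_amp.
  by case: ifP => // _; rewrite bop0.
by rewrite -/Q comm !bcompA wold_map_coiso bcomp1l.
Qed.

Lemma lspan_eq_on X Y (F H : bop X X -> bop Y Y) (B : set (bop X X)) :
  linear_on (lspan B) F -> linear_on (lspan B) H -> (forall T, B T -> F T = H T) ->
  forall T, lspan B T -> F T = H T.
Proof.
move=> lF lH FH T BT; have [b0 bl] := lspan_sub B.
suff [] : (lspan B `&` [set S | F S = H S]) T by [].
apply: (lspan_min (A := lspan B `&` [set S | F S = H S])) BT; last first.
  by move=> S BS; split; [exact: sub_lspan|exact: FH].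
split; first by split; rewrite //= (linear_on0 b0 lF) (linear_on0 b0 lH).
move=> c S1 S2 [f1 e1] [f2 e2]; split; first exact: bl.
by rewrite /= lF // lH // e1 e2.
Qed.

Lemma normal_mull X (B : bop X X) : normal_map (fun T : bop X X => bcomp B T).
Proof.
have := normal_mul B (bid X); congr (normal_map _).
by apply/funext => T; rewrite bcomp1r.
Qed.

Lemma normal_mulr X (B : bop X X) : normal_map (fun T : bop X X => bcomp T B).
Proof.
have := normal_mul (bid X) B; congr (normal_map _).
by apply/funext => T; rewrite bcomp1l.
Qed.

Definition linear_map X Y (F : bop X X -> bop Y Y) :=
  forall (c : C) S T, F (c *: S + T) = c *: F S + F T.

Lemma linear_map_on X Y (F : bop X X -> bop Y Y) A : linear_map F -> linear_on A F.
Proof. by move=> lF c S T _ _; exact: lF. Qed.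

Lemma linear_mul X Y (B : bop X Y) (D : bop Y X) :
  linear_map (fun T => bcomp B (bcomp T D)).
Proof. by move=> c S T; rewrite bcomp_linl bcomp_linr. Qed.

Lemma linear_spatial K X Y (B : bop (K * X)%type Y) (D : bop Y (K * X)%type) :
  linear_map (fun T => bcomp B (bcomp (amp K T) D)).
Proof. by move=> c S T; rewrite amp_lin bcomp_linl bcomp_linr. Qed.

Lemma linear_comp X Y Z (F : bop X X -> bop Y Y) (H : bop Y Y -> bop Z Z) :
  linear_map F -> linear_map H -> linear_map (H \o F).
Proof. by move=> lF lH c S T; rewrite /= lF lH. Qed.

Variable DL : bop word word -> bop WW WW.
Hypothesis DLP : is_fs_comult DL.

Lemma DL_linear : linear_on fs_alg DL.
Proof. by case: DLP => [[_ [_ [h _] _ _ _]] _]. Qed.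

Lemma DL_mul S T : fs_alg S -> fs_alg T -> DL (bcomp S T) = bcomp (DL S) (DL T).
Proof. by case: DLP => [[_ [_ [_ h] _ _ _]] _]; exact: h. Qed.

Lemma DL_continuous : wstar_continuous fs_alg DL.
Proof. by case: DLP => [[_ [_ _ h _ _]] _]. Qed.

Lemma DL_in T : fs_alg T -> normal_tens fs_alg fs_alg (DL T).
Proof. by case: DLP => [[_ [[h _] _ _ _ _]] _]; exact: h. Qed.

Lemma DL_id : DL (bid word) = tens (bid word) (bid word).
Proof. by case: DLP => [[_ [[_ h] _ _ _ _]] _]. Qed.

Lemma DL_L w : DL (L w) = tens (L w) (L w).
Proof. by case: DLP. Qed.

(** Both sides are linear, weak*-continuous and equal to L_w ⊗ L_w at L_w. *)
Lemma DL_spatial T : fs_alg T -> DL T = bcomp G (bcomp (amp WW T) (adj G)).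
Proof.
apply: (fs_eq DL_linear (linear_map_on (linear_spatial G (adj G))) DL_continuous).
  exact/normal_continuous/normal_spatial.
by move=> w; rewrite DL_L bcompA -wold_map_L -bcompA wold_map_coiso bcomp1r.
Qed.

Lemma DL_intertwine T : fs_alg T -> bcomp (DL T) G = bcomp G (amp WW T).
Proof. by move=> fT; rewrite DL_spatial // -!bcompA wold_map_amp. Qed.

Variable J : set (bop word word).
Hypothesis idJ : wot_ideal J.
Local Notation e := (Nproj J).
Local Notation P := (tens (Nproj J) (Nproj J)).

Definition compr2 (Y : bop WW WW) : bop WW WW := bcomp P (bcomp Y P).

Lemma P_idem : bcomp P P = P.
Proof. by rewrite tens_comp NprojK. Qed.

Lemma compr2_tens S T : compr2 (tens S T) = tens (compr J S) (compr J T).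
Proof. by rewrite /compr2 !tens_comp. Qed.

(** The subspace N ⊗ N is coinvariant for the tensor product of L with itself. *)
Lemma compr2_fs (Y : bop WW WW) : normal_tens fs_alg fs_alg Y -> compr2 Y = bcomp P Y.
Proof.
apply: normal_eq; [exact: normal_mul|exact: normal_mull|].
apply: lspan_eq_on.
- exact/linear_map_on/linear_mul.
- by move=> c S T _ _; rewrite bcomp_linr.
- move=> _ [S fS [T fT <-]]; rewrite compr2_tens tens_comp.
  by rewrite !(compr_fs idJ).
Qed.

Lemma compr2_extension : tens_extension fs_alg fs_alg (compr J) (compr J) compr2.
Proof.
split; first exact/linear_map_on/linear_mul.
  exact/normal_continuous/normal_mul.
by move=> S T _ _; exact: compr2_tens.
Qed.

Lemma compr_quot S T : fs_alg S -> fs_alg T ->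
  bcomp (compr J S) (compr J T) = compr J (bcomp S T).
Proof.
move=> fS fT; rewrite [compr J T]/compr (bcompA (compr J S)).
have -> : bcomp (compr J S) e = bcomp e S.
  by rewrite -(compr_fs idJ fS) /compr -!bcompA NprojK.
by rewrite /compr -!bcompA.
Qed.

Lemma compr_linear : linear_map (compr J).
Proof. exact: linear_mul. Qed.

Lemma compr_id : compr J (bid word) = e.
Proof. by rewrite /compr bcomp1l NprojK. Qed.

Lemma compr_absorb T : bcomp e (compr J T) = compr J T /\ bcomp (compr J T) e = compr J T.
Proof.
by split; rewrite /compr; [rewrite bcompA NprojK|rewrite -!bcompA NprojK].
Qed.

Lemma quot_sub : subspace_set (quot_alg J).
Proof.
have [f0 fl] := @fs_sub R d.
split; first by exists 0 => //; exact: (linear_on0 f0 (linear_map_on compr_linear)).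
move=> c _ _ [S fS <-] [T fT <-]; exists (c *: S + T); first exact: fl.
exact: compr_linear.
Qed.

Lemma quot_dual_operator_algebra : dual_operator_algebra e (quot_alg J).
Proof.
split; first exact: Nproj_proj.
- by exists (bid word); [exact: fs_id|exact: compr_id].
- by move=> _ [T _ <-]; exact: compr_absorb.
- split; first exact: quot_sub.
  move=> _ _ [S fS <-] [T fT <-]; exists (bcomp S T); first exact: fs_comp.
  by rewrite compr_quot.
- exact: quot_alg_closed.
Qed.

Lemma norm_le1_Nproj : norm_le1 e.
Proof. by move=> f; rewrite -[leRHS]mul1r; exact: Nproj_norm. Qed.

Definition quot_map : bop (WW * word)%type WW := bcomp P G.
Local Notation B := quot_map.

(** The formula for the comultiplication of the quotient.  It makes sense for every
ideal; the Hopf property enters in quot_comult_compr. *)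
Definition quot_comult (X : bop word word) : bop WW WW :=
  bcomp B (bcomp (amp WW X) (adj B)).
Local Notation D := quot_comult.

Lemma norm_le1_B : norm_le1 B.
Proof.
apply: norm_le1_comp; last exact: norm_le1_reindex.
by apply: norm_le1_tens; exact: norm_le1_Nproj.
Qed.

Lemma adj_B : adj B = bcomp (adj G) P.
Proof. by rewrite adj_comp adj_tens adj_Nproj. Qed.

Lemma normal_D : normal_map D. Proof. exact: normal_spatial. Qed.
Lemma linear_D : linear_map D. Proof. exact: linear_spatial. Qed.

Lemma ip_slicel K X (h : l2 (K * X)%type) k (g : l2 X) :
  ip (slice h k) g = ip h (tensv (std_vec k) g).
Proof.
rewrite ip_slice (@csum_pt _ _ _ k) => [|j jk]; rewrite slice_tensv std_vecE.
  by rewrite eqxx scale1r.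
by rewrite (negbTE jk) scale0r ip0r.
Qed.

Section hopf.
Hypothesis hopfJ : hopf_ideal DL J.

(** The projection P kills J ⊗ L + L ⊗ J because e kills J on the left, and
killing passes to the weak* closure. *)
Lemma P_DL_ideal T : J T -> bcomp P (DL T) = 0.
Proof.
move=> JT.
have n0 : normal_map (fun _ : bop WW WW => 0 : bop WW WW).
  move=> f g; exists 0, 0 => Y; rewrite /wcoef ip0r.
  by rewrite amp0 zerobopE ip0l.
have kill S S' : J S \/ J S' -> bcomp P (tens S S') = 0.
  by rewrite tens_comp => -[|] JS; rewrite (Nproj_ideal idJ JS) ?tens0l ?tens0r.
have sub0 : subspace_set [set U : bop WW WW | bcomp P U = 0].
  split; first by rewrite /= bcomp0r.
  by move=> c Y Z /= hY hZ; rewrite bcomp_linr hY hZ scaler0 addr0.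
apply: (normal_eq (normal_mull P) n0) (hopfJ JT) => _ [Y1 Y1J [Y2 Y2J <-]].
apply: (subspaceD sub0).
  by apply: (lspan_min sub0) Y1J => _ [S JS [S' _ <-]]; apply: kill; left.
by apply: (lspan_min sub0) Y2J => _ [S _ [S' JS' <-]]; apply: kill; right.
Qed.

(** B (1 ⊗ T) = P DL(T) G = 0 for T in J, so the range of adj(B) consists of vectors
with slices in N. *)
Lemma B_Nproj : bcomp B (amp WW e) = B.
Proof.
rewrite -[LHS]adjK -[RHS]adjK; congr adj; rewrite adj_comp adj_amp adj_Nproj.
apply: bop_ext => f; rewrite bcompE; apply: slice_ext => p; rewrite slice_amp.
apply: Nproj_id => T JT; rewrite ip_slicel adjEr -amp_tensv -bcompE.
rewrite /quot_map -bcompA -DL_intertwine; last exact: (ideal_fs idJ).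
by rewrite bcompA P_DL_ideal // bcomp0l zerobopE ip0r.
Qed.

Lemma quot_comult_compr T : fs_alg T -> D (compr J T) = compr2 (DL T).
Proof.
move=> fT.
have adjBe : bcomp (amp WW e) (adj B) = adj B.
  by rewrite -{1}[e]adj_Nproj -adj_amp -adj_comp B_Nproj.
have -> : D (compr J T) = bcomp B (bcomp (amp WW e) (bcomp (amp WW T) (adj B))).
  rewrite /quot_comult /compr !amp_comp -(bcompA (amp WW e)) -(bcompA (amp WW T)).
  by rewrite adjBe.
rewrite (bcompA B) B_Nproj adj_B /compr2 DL_spatial //.
by rewrite /quot_map -(bcompA P) -(bcompA G) -(bcompA (amp WW T)).
Qed.

Lemma quot_comult_id : D e = tens e e.
Proof.
rewrite -{1}compr_id quot_comult_compr; last exact: fs_id.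
by rewrite DL_id compr2_tens compr_id.
Qed.

Lemma quot_comult_in T : quot_alg J T -> normal_tens (quot_alg J) (quot_alg J) (D T).
Proof.
move=> [S fS <-]; rewrite quot_comult_compr //.
have lc : linear_map compr2 by exact: linear_mul.
apply: (normal_closure (F := compr2)) (DL_in fS); first exact: normal_mul.
have [q0 ql] := lspan_sub [set tens S T | S in quot_alg J & T in quot_alg J].
apply: (lspan_min (A := [set U : bop WW WW | alg_tens (quot_alg J) (quot_alg J) (compr2 U)])).
  split=> [|c Y Z] /=; last by rewrite lc; exact: ql.
  by have := lc (-1) 0 0; rewrite scaler0 addr0 scaleN1r addNr => ->.
move=> _ [S1 f1 [S2 f2 <-]] /=; rewrite compr2_tens; apply: sub_lspan.
by exists (compr J S1); [exists S1|exists (compr J S2) => //; exists S2].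
Qed.

Lemma quot_comult_mul S T : quot_alg J S -> quot_alg J T ->
  D (bcomp S T) = bcomp (D S) (D T).
Proof.
move=> [S1 f1 <-] [T1 g1 <-]; rewrite compr_quot // !quot_comult_compr //; last exact: fs_comp.
rewrite DL_mul // [compr2 (DL T1)]/compr2 (bcompA (compr2 _)).
have -> : bcomp (compr2 (DL S1)) P = bcomp P (DL S1).
  by rewrite -(compr2_fs (DL_in f1)) /compr2 -(bcompA P) -(bcompA (DL S1)) P_idem.
by rewrite /compr2 -(bcompA (DL S1)) -(bcompA P).
Qed.

Let K := WW.

Definition flip_in (p : word * (K * word)) : K * (word * word) := (p.2.1, (p.1, p.2.2)).
Definition flip_out (p : K * (word * word)) : word * (K * word) := (p.2.1, (p.1, p.2.2)).
Definition assoc_out (p : K * (word * word)) : (K * word) * word := ((p.1, p.2.1), p.2.2).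
Definition assoc_word (p : word * (word * word)) : (word * word) * word :=
  ((p.1, p.2.1), p.2.2).

Lemma flip_in_inj : injective flip_in.
Proof. by move=> [? [? ?]] [? [? ?]] [-> -> ->]. Qed.
Lemma flip_out_inj : injective flip_out.
Proof. by move=> [? [? ?]] [? [? ?]] [-> -> ->]. Qed.
Lemma assoc_out_inj : injective assoc_out.
Proof. by move=> [? [? ?]] [? [? ?]] [-> -> ->]. Qed.
Lemma assoc_word_inj : injective assoc_word.
Proof. by move=> [? [? ?]] [? [? ?]] [-> -> ->]. Qed.

Lemma flip_in_tensv (f g h : l2 _) :
  reindex flip_in_inj (tensv f (tensv g h)) = tensv g (tensv f h).
Proof. by apply: l2_ext => -[a [k b]]; rewrite reindexE /= mulrCA. Qed.

Lemma flip_out_tensv (f g h : l2 _) :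
  reindex flip_out_inj (tensv f (tensv g h)) = tensv g (tensv f h).
Proof. by apply: l2_ext => -[k [a b]]; rewrite reindexE /= mulrCA. Qed.

Lemma assoc_out_tensv (f g h : l2 _) :
  reindex assoc_out_inj (tensv (tensv f g) h) = tensv f (tensv g h).
Proof. by apply: l2_ext => -[k [a b]]; rewrite reindexE /= mulrA. Qed.

Lemma assoc_word_tensv (f g h : l2 _) :
  reindex assoc_word_inj (tensv (tensv f g) h) = tensv f (tensv g h).
Proof. by apply: l2_ext => -[k [a b]]; rewrite reindexE /= mulrA. Qed.

Lemma bassoc_tensv X Y Z (f : l2 X) (g : l2 Y) (h : l2 Z) :
  bassoc X Y Z (tensv f (tensv g h)) = tensv (tensv f g) h.
Proof. by apply: l2_ext => -[[a b] c]; rewrite reindexE /= mulrA. Qed.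

(** The map 1 ⊗ D on the tensor product of two copies of the quotient: the
multiplicity leg of D is moved to the front, so that the map is again spatial,
hence normal. *)
Definition right_comult (Y : bop WW WW) : bop (word * WW)%type (word * WW)%type :=
  bcomp (bcomp (amp word B) (reindex flip_in_inj))
    (bcomp (amp K Y) (bcomp (reindex flip_out_inj) (amp word (adj B)))).

(** The map D ⊗ 1, in the same form. *)
Definition left_comult (Y : bop WW WW) : bop (WW * word)%type (WW * word)%type :=
  bcomp (bcomp (tens B (bid word)) (bassoc K word word))
    (bcomp (amp K Y) (bcomp (reindex assoc_out_inj) (tens (adj B) (bid word)))).

Lemma right_comult_tens S T : right_comult (tens S T) = tens S (D T).
Proof.
have E : bcomp (reindex flip_in_inj) (bcomp (amp K (tens S T)) (reindex flip_out_inj)) =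
    tens S (amp K T).
  apply: bop_tensv3 => f g h; rewrite (bcompE (reindex _)) (bcompE (amp K _)).
  by rewrite flip_out_tensv amp_tensv !tensE flip_in_tensv amp_tensv.
transitivity (bcomp (amp word B) (bcomp (tens S (amp K T)) (amp word (adj B)))).
  by rewrite -E /right_comult -(bcompA (amp word B)) -(bcompA (reindex flip_in_inj)) -(bcompA (amp K _)).
by rewrite [amp word B]amp_tens [amp word (adj B)]amp_tens !tens_comp bcomp1l bcomp1r.
Qed.

Lemma left_comult_tens S T : left_comult (tens S T) = tens (D S) T.
Proof.
have E : bcomp (bassoc K word word) (bcomp (amp K (tens S T)) (reindex assoc_out_inj)) =
    tens (amp K S) T.
  apply: bop_tensv3l => f g h; rewrite (bcompE (bassoc _ _ _)) (bcompE (amp K _)).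
  by rewrite assoc_out_tensv amp_tensv !tensE bassoc_tensv amp_tensv.
transitivity (bcomp (tens B (bid word)) (bcomp (tens (amp K S) T) (tens (adj B) (bid word)))).
  by rewrite -E /left_comult -(bcompA (tens B _)) -(bcompA (bassoc K word word)) -(bcompA (amp K _)).
by rewrite !tens_comp bcomp1l bcomp1r.
Qed.

(** Precomposed with the compression, both sides are normal and linear on L, and
both send L_w to the threefold tensor power of its compression. *)
Lemma quot_comult_coassociative : coassociative (quot_alg J) D.
Proof.
have nr : normal_map right_comult by exact: normal_spatial.
have nl : normal_map left_comult by exact: normal_spatial.
have lr : linear_map right_comult by exact: linear_spatial.
have ll : linear_map left_comult by exact: linear_spatial.
exists right_comult, left_comult; split.
- split; [exact: linear_map_on|exact: normal_continuous|].
  by move=> S T _ _; exact: right_comult_tens.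
- split; [exact: linear_map_on|exact: normal_continuous|].
  by move=> S T _ _; exact: left_comult_tens.
move=> _ [T fT <-].
pose as' := reindex assoc_word_inj.
have aa : bcomp as' (bassoc word word word) = bid _.
  by apply: bop_tensv3 => f g h; rewrite bcompE bassoc_tensv assoc_word_tensv.
have aa' : bcomp (bassoc word word word) as' = bid _.
  by apply: bop_tensv3l => f g h; rewrite bcompE assoc_word_tensv bassoc_tensv.
have nD : normal_map (D \o compr J) by apply: (normal_comp _ normal_D); exact: normal_mul.
have lD : linear_map (D \o compr J) by apply: (linear_comp compr_linear linear_D).
pose F := right_comult \o (D \o compr J).
pose H := (fun Y : bop (WW * word)%type (WW * word)%type => bcomp as' (bcomp Y (bassoc word word word))) \o (left_comult \o (D \o compr J)).
have FH : forall T, fs_alg T -> F T = H T.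
  apply: fs_eq.
  - exact/linear_map_on/linear_comp.
  - apply/linear_map_on; apply: linear_comp; last exact: linear_mul.
    exact: linear_comp.
  - exact/normal_continuous/normal_comp.
  - apply: normal_continuous; apply: normal_comp; last exact: normal_mul.
    exact: normal_comp.
  - move=> w; rewrite /F /H /= quot_comult_compr; last exact: fs_L.
    rewrite DL_L compr2_tens right_comult_tens left_comult_tens.
    rewrite quot_comult_compr; last exact: fs_L.
    rewrite DL_L compr2_tens; apply: bop_tensv3 => f g h.
    rewrite (bcompE as') (bcompE (tens _ _)) bassoc_tensv !tensE.
    by rewrite assoc_word_tensv.
have -> : right_comult (D (compr J T)) = F T by [].
by rewrite FH // /H /= bcompA aa' bcomp1l.
Qed.

Lemma quot_hopf : hopf_dual_algebra e (quot_alg J) D /\ canonical_comult DL J D.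
Proof.
split; last by exists compr2; [exact: compr2_extension|exact: quot_comult_compr].
split; first exact: quot_dual_operator_algebra.
split.
- by split; [exact: quot_comult_in|exact: quot_comult_id].
- by split; [exact/linear_map_on/linear_D|exact: quot_comult_mul].
- exact/normal_continuous/normal_D.
- apply: spatial_completely_contractive; first exact: norm_le1_B.
  by apply: norm_le1_adj; exact: norm_le1_B.
- exact: quot_comult_coassociative.
Qed.

End hopf.
End comultiplication.

(** * Ideals generated by polynomials *)

Section converse.
Context {R : realType} {d : nat}.
Local Notation C := R[i].
Local Notation l2 := (@l2 R).
Local Notation bop := (@bop R).
Local Notation word := (seq 'I_d).
Local Notation WW := (seq 'I_d * seq 'I_d)%type.
Local Notation L := (@L R d).
Local Notation fs_alg := (@fs_alg R d).
Local Notation op := (bop word word).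

Variable DL : op -> bop WW WW.
Hypothesis DLP : is_fs_comult DL.
Variable J : set op.
Hypothesis idJ : wot_ideal J.
Local Notation e := (Nproj J).

Definition coideal_sum : set (bop WW WW) :=
  [set A + B | A in alg_tens J fs_alg & B in alg_tens fs_alg J].

Lemma coideal_sum_sub : subspace_set coideal_sum.
Proof.
have [a0 al] := lspan_sub [set tens S T | S in J & T in fs_alg].
have [b0 bl] := lspan_sub [set tens S T | S in fs_alg & T in J].
split; first by exists 0 => //; exists 0 => //; rewrite addr0.
move=> c _ _ [A1 hA1 [B1 hB1 <-]] [A2 hA2 [B2 hB2 <-]].
exists (c *: A1 + A2); first exact: al.
by exists (c *: B1 + B2); [exact: bl|rewrite scalerDr addrACA].
Qed.

Lemma coideal_sum_tens S T : fs_alg S -> fs_alg T -> J S \/ J T -> coideal_sum (tens S T).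
Proof.
move=> fS fT [JS|JT].
  exists (tens S T); first by apply: sub_lspan; exists S => //; exists T.
  by exists 0; [case: (lspan_sub [set tens S T | S in fs_alg & T in J])|rewrite addr0].
exists 0; first by case: (lspan_sub [set tens S T | S in J & T in fs_alg]).
by exists (tens S T); [apply: sub_lspan; exists S => //; exists T|rewrite add0r].
Qed.

Lemma coideal_sum_ind (A : set (bop WW WW)) : subspace_set A ->
  (forall S T, fs_alg S -> fs_alg T -> J S \/ J T -> A (tens S T)) ->
  coideal_sum `<=` A.
Proof.
move=> sA H _ [Y1 h1 [Y2 h2 <-]]; apply: (subspaceD sA).
  apply: (lspan_min sA) h1 => _ [S JS [T fT <-]].
  by apply: H => //; [exact: (ideal_fs idJ)|left].
apply: (lspan_min sA) h2 => _ [S fS [T JT <-]].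
by apply: H => //; [exact: (ideal_fs idJ)|right].
Qed.

Lemma coideal_sum_mul S T Y : fs_alg S -> fs_alg T -> coideal_sum Y ->
  coideal_sum (bcomp (tens S T) Y) /\ coideal_sum (bcomp Y (tens S T)).
Proof.
move=> fS fT; have [c0 cl] := coideal_sum_sub; split.
  apply: (coideal_sum_ind (A := [set U | coideal_sum (bcomp (tens S T) U)])) H => [|S' T' fS' fT' JJ] /=.
    split=> [|c U U'] /=; first by rewrite bcomp0r.
    by rewrite bcomp_linr; exact: cl.
  rewrite tens_comp; apply: coideal_sum_tens; try exact: fs_comp.
  by case: JJ => h; [left|right]; apply: (ideal_mull idJ).
apply: (coideal_sum_ind (A := [set U | coideal_sum (bcomp U (tens S T))])) H => [|S' T' fS' fT' JJ] /=.
  split=> [|c U U'] /=; first by rewrite bcomp0l.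
  by rewrite bcomp_linl; exact: cl.
rewrite tens_comp; apply: coideal_sum_tens; try exact: fs_comp.
by case: JJ => h; [left|right]; apply: (ideal_mulr idJ).
Qed.

(** One factor at a time: first the elementary tensors act on the closure, then
each element of the closure absorbs limits of combinations of them. *)
Lemma coideal_closure_mul Z Y : normal_tens fs_alg fs_alg Z ->
  wstar_closure coideal_sum Y ->
  wstar_closure coideal_sum (bcomp Z Y) /\ wstar_closure coideal_sum (bcomp Y Z).
Proof.
move=> nZ cY; have [c0 cl] := wstar_closure_sub coideal_sum_sub.
have tl S T : fs_alg S -> fs_alg T -> wstar_closure coideal_sum (bcomp (tens S T) Y).
  move=> fS fT; apply: (normal_closure (normal_mull (tens S T))) cY => U hU.
  by case: (coideal_sum_mul fS fT hU).
have tr S T : fs_alg S -> fs_alg T -> wstar_closure coideal_sum (bcomp Y (tens S T)).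
  move=> fS fT; apply: (normal_closure (normal_mulr (tens S T))) cY => U hU.
  by case: (coideal_sum_mul fS fT hU).
split.
  apply: wstar_closure_closed.
  apply: (normal_closure (normal_mulr Y)) nZ => U.
  apply: (lspan_min (A := [set U | wstar_closure coideal_sum (bcomp U Y)])).
    split=> [|c U1 U2] /=; first by rewrite bcomp0l.
    by rewrite bcomp_linl; exact: cl.
  by move=> _ [S fS [T fT <-]]; exact: tl.
apply: wstar_closure_closed.
apply: (normal_closure (normal_mull Y)) nZ => U.
apply: (lspan_min (A := [set U | wstar_closure coideal_sum (bcomp Y U)])).
  split=> [|c U1 U2] /=; first by rewrite bcomp0r.
  by rewrite bcomp_linr; exact: cl.
by move=> _ [S fS [T fT <-]]; exact: tr.
Qed.

(** WOT-closedness is where the agreement of the two topologies on L is used, as DL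
is only weak*-continuous. *)
Lemma coideal_preimage_ideal :
  wot_ideal (fs_alg `&` [set T | wstar_closure coideal_sum (DL T)]).
Proof.
have [f0 fl] := @fs_sub R d.
have [c0 cl] := wstar_closure_sub coideal_sum_sub.
have lD := DL_linear DLP.
split.
- by move=> T [].
- split; first by split => //=; rewrite (linear_on0 f0 lD).
  move=> c S T [fS hS] [fT hT]; split; first exact: fl.
  by rewrite /= lD //; exact: cl.
- move=> S T fS [fT hT]; have [h1 h2] := coideal_closure_mul (DL_in DLP fS) hT.
  by split; split; rewrite /= ?(DL_mul DLP) //; exact: fs_comp.
- apply/wot_closedP => T H.
  have fT : fs_alg T.
    move/wot_closedP: (@fs_wot R d); apply=> s r r0.
    by have [S [fS _] SS] := H s r r0; exists S.
  split=> //; apply: wstar_closure_closed; apply/wstar_closureP => s r r0.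
  have [t [q [q0 tq]]] := wstar_continuousE (DL_continuous DLP) fT s r0.
  have [t' t'P] := wotclose_wclose t.
  have [S [fS hS] SS] := H t' q q0.
  by exists (DL S) => //; apply: tq => //; exact: t'P.
Qed.

Lemma compr_sum (I : Type) (s : seq I) (F : I -> op) :
  compr J (\sum_(i <- s) F i) = \sum_(i <- s) compr J (F i).
Proof.
elim: s => [|i s IH]; rewrite ?big_nil ?big_cons.
  by rewrite /compr bcomp0l bcomp0r.
rewrite -IH; have := compr_linear J 1 (F i) (\sum_(j <- s) F j).
by rewrite !scale1r.
Qed.

Lemma comprZ c T : compr J (c *: T) = c *: compr J T.
Proof.
have := compr_linear J c T 0; rewrite addr0 => ->.
by rewrite [compr J 0]/compr bcomp0l bcomp0r addr0.
Qed.

Lemma tensZl X Y X' Y' c (S : bop X X') (T : bop Y Y') :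
  tens (c *: S) T = c *: tens S T.
Proof. by rewrite -[c *: S]addr0 tens_linl tens0l addr0. Qed.

Lemma tensZr X Y X' Y' c (S : bop X X') (T : bop Y Y') :
  tens S (c *: T) = c *: tens S T.
Proof. by rewrite -[c *: T]addr0 tens_linr tens0r addr0. Qed.

Lemma tens_sumr X Y X' Y' (I : Type) (s : seq I) (S : bop X X') (F : I -> bop Y Y') :
  tens S (\sum_(i <- s) F i) = \sum_(i <- s) tens S (F i).
Proof.
elim: s => [|i s IH]; rewrite ?big_nil ?big_cons ?tens0r //.
by rewrite -IH -[F i in LHS]scale1r tens_linr scale1r.
Qed.

Lemma sum_bopE X Y (I : Type) (s : seq I) (F : I -> bop X Y) f :
  (\sum_(i <- s) F i) f = \sum_(i <- s) F i f.
Proof. by elim: s => [|i s IH]; rewrite ?big_nil ?big_cons // addbopE IH. Qed.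

(** Induction on the number of terms.  If the compressed right factors are linearly
independent, all left factors compress to 0 and hence lie in J.  Otherwise one
right factor is, modulo J, a combination of the others, and its term can be
distributed over them. *)
Lemma tensor_kernel (t : seq (op * op)) :
  (forall p, p \in t -> fs_alg p.1 /\ fs_alg p.2) ->
  \sum_(p <- t) tens (compr J p.1) (compr J p.2) = 0 ->
  coideal_sum (\sum_(p <- t) tens p.1 p.2).
Proof.
have [n] := ubnP (size t); elim: n t => // n IH t tn tfs t0.
have [c0 cl] := coideal_sum_sub.
have csum0 (I : eqType) (s : seq I) (F : I -> bop WW WW) :
    (forall i, i \in s -> coideal_sum (F i)) -> coideal_sum (\sum_(i <- s) F i).
  move=> H; rewrite big_seq; elim/big_ind: _ => // U U' hU hU'.
  exact: (subspaceD coideal_sum_sub).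
have [[c [ct [q qt cq]]]|indep] := pselect (exists c : op * op -> C,
    \sum_(p <- t) c p *: compr J p.2 = 0 /\ exists2 q, q \in t & c q != 0).
  have perm := perm_to_rem qt; set t' := rem q t in perm.
  (* The relation solved for the compression of q.2; S is the difference, in J. *)
  pose b p : C := - (c q)^-1 * c p.
  have fs' p : p \in t' -> fs_alg p.1 /\ fs_alg p.2.
    by move=> pt'; apply: tfs; rewrite (perm_mem perm) inE pt' orbT.
  have [fq1 fq2] := tfs _ qt.
  pose S := q.2 - \sum_(p <- t') b p *: p.2.
  have fsum : fs_alg (\sum_(p <- t') b p *: p.2).
    rewrite big_seq; elim/big_ind: _ => [|U U'|p /fs' [_ fp]].
    - by case: (@fs_sub R d).
    - exact: (subspaceD (@fs_sub R d)).
    - exact: (subspaceZ _ (@fs_sub R d)).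
  have fS : fs_alg S by exact: (subspaceB (@fs_sub R d)).
  have Eq : compr J q.2 = \sum_(p <- t') b p *: compr J p.2.
    move: ct; rewrite (perm_big _ perm) big_cons /= => /eqP; rewrite addr_eq0 => /eqP E.
    have -> : compr J q.2 = (c q)^-1 *: (c q *: compr J q.2).
      by rewrite scalerA mulVf // scale1r.
    rewrite E scalerN -scaleNr scaler_sumr; apply: eq_bigr => p _.
    by rewrite scalerA.
  have JS : J S.
    apply: (compr_kernel idJ fS); rewrite /S -[q.2]scale1r.
    have := compr_linear J (-1) (\sum_(p <- t') b p *: p.2) q.2.
    rewrite scaleN1r addrC scale1r => ->; rewrite scaleN1r compr_sum Eq.
    by under eq_bigr do rewrite comprZ; rewrite addNr.
  have elim_q (F1 F2 : op -> op) Z (FZ : F2 q.2 = Z + \sum_(p <- t') b p *: F2 p.2)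
      (F1l : forall p, F1 (p.1 + b p *: q.1) = F1 p.1 + b p *: F1 q.1) :
      \sum_(p <- t) tens (F1 p.1) (F2 p.2) = tens (F1 q.1) Z +
      \sum_(p <- [seq (p.1 + b p *: q.1, p.2) | p <- t']) tens (F1 p.1) (F2 p.2).
    rewrite (perm_big _ perm) big_cons big_map /= FZ -[Z in LHS]scale1r tens_linr scale1r.
    rewrite tens_sumr -addrA -big_split; congr (_ + _); apply: eq_bigr => p _ /=.
    by rewrite F1l [F1 p.1 + _]addrC tens_linl tensZr.
  rewrite (elim_q id id S) ?subrK //.
  apply: (subspaceD coideal_sum_sub).
    by apply: coideal_sum_tens => //; right.
  apply: IH.
  - rewrite size_map size_rem //; move: tn; case: (t) qt => //.
  - move=> _ /mapP [p /fs' [f1 f2] ->]; split=> //=.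
    by rewrite addrC; case: (@fs_sub R d) => _; apply.
  - have := elim_q (compr J) (compr J) 0; rewrite add0r tens0r add0r => <- // p.
    by rewrite addrC compr_linear addrC.
apply: csum0 => p pt; have [f1 f2] := tfs p pt.
apply: coideal_sum_tens => //; left; apply: (compr_kernel idJ f1).
apply: bop_ext => f; apply: l2_ext => x; apply/eqP; apply: contrapT => nz.
(* A nonzero coordinate of some compressed left factor is a relation between the
   right factors. *)
apply: indep; exists (fun p => compr J p.1 f x); split; last by exists p => //; exact/negP.
apply: bop_ext => g; rewrite sum_bopE.
have := congr1 (fun T : bop WW WW => slice (T (tensv f g)) x) t0.
rewrite sum_bopE [slice _ _]bop_sum zerobopE [slice 0 _]bop0 => E0.
rewrite zerobopE -[RHS]E0; apply: eq_bigr => r _.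
by rewrite tensE -[RHS]/(slice (tensv _ _) x) slice_tensv.
Qed.

Lemma hom_poly_terms T : hom_poly T -> exists t : seq (op * op),
  [/\ forall p, p \in t -> fs_alg p.1 /\ fs_alg p.2, fs_alg T &
      DL T = \sum_(p <- t) tens p.1 p.2].
Proof.
move=> [n hT]; have [f0 fl] := @fs_sub R d; have lD := DL_linear DLP.
apply: (lspan_min (A := [set T | exists t : seq (op * op),
  [/\ forall p, p \in t -> fs_alg p.1 /\ fs_alg p.2, fs_alg T &
      DL T = \sum_(p <- t) tens p.1 p.2]])) hT.
  split; first by exists [::]; split; rewrite // big_nil (linear_on0 f0 lD).
  move=> c S T' [s [sf fS sE]] [t [tf fT tE]].
  exists ([seq (c *: p.1, p.2) | p <- s] ++ t); split.
  - move=> p; rewrite mem_cat => /orP [/mapP [q /sf [h1 h2] ->]|/tf //].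
    by split=> //=; exact: (subspaceZ _ (@fs_sub R d)).
  - exact: fl.
  - rewrite lD // sE tE big_cat big_map scaler_sumr; congr (_ + _).
    by apply: eq_bigr => p _; rewrite tensZl.
move=> _ [w _ <-]; exists [:: (L w, L w)]; split; last by rewrite big_seq1 (DL_L DLP).
  by move=> p; rewrite inE => /eqP ->; split; exact: fs_L.
exact: fs_L.
Qed.

(** The canonical comultiplication sends 0 to 0 and the compression kills J, so the
extension F kills DL(J).  F is determined by its values on elementary tensors,
which are those of compr2. *)
Lemma homogeneous_hopf_ideal D : homogeneous J ->
  hopf_dual_algebra e (quot_alg J) D -> canonical_comult DL J D -> hopf_ideal DL J.
Proof.
move=> [G Ghom JE] [_ [_ [lD _] _ _ _]] [F [lF cF Ft] DF].
have GJ : G `<=` J by rewrite JE; exact: sub_gen_smallest.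
have FE Y : normal_tens fs_alg fs_alg Y -> F Y = compr2 J Y.
  move=> nY; apply: (continuous_eq cF _ _ _ nY nY).
  - exact/normal_continuous/normal_mul.
  - exact: sub_wstar_closure.
  - apply: lspan_eq_on; last first.
    + by move=> _ [S fS [T fT <-]]; rewrite compr2_tens Ft.
    + exact/linear_map_on/linear_mul.
    + by move=> c S T hS hT; apply: lF; exact: sub_wstar_closure.
have q0 : quot_alg J 0 by case: (@quot_sub R d J).
have kill T : J T -> compr2 J (DL T) = 0.
  move=> JT; have fT := ideal_fs idJ JT.
  rewrite -FE; last exact: (DL_in DLP).
  rewrite -DF // (compr_fs idJ) // (Nproj_ideal idJ) //.
  exact: (linear_on0 q0 lD).
suff : J `<=` fs_alg `&` [set T | wstar_closure coideal_sum (DL T)].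
  by move=> H T /H [].
rewrite {1}JE; apply: smallest_sub; first exact: coideal_preimage_ideal.
move=> T GT; have [t [tf fT tE]] := hom_poly_terms (Ghom T GT).
split=> //=; apply: sub_wstar_closure; rewrite tE; apply: tensor_kernel => //.
have := kill T (GJ T GT); rewrite tE => E0; rewrite -[RHS]E0 {E0}.
have lc : linear_map (compr2 J) by exact: linear_mul.
elim: (t) => [|p s IH]; first by rewrite !big_nil /compr2 bcomp0l bcomp0r.
rewrite !big_cons -[tens p.1 p.2]scale1r lc scale1r compr2_tens IH.
by [].
Qed.

End converse.

Theorem theorem4p2 (R : realType) (d : nat) (d_gt0 : (0 < d)%N)
    (DL : @bop R (seq 'I_d) (seq 'I_d) ->
          @bop R (seq 'I_d * seq 'I_d)%type (seq 'I_d * seq 'I_d)%type)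
    (DLP : is_fs_comult DL)
    (J : set (@bop R (seq 'I_d) (seq 'I_d))) (idealJ : wot_ideal J) :
  (hopf_ideal DL J ->
     exists D, hopf_dual_algebra (Nproj J) (quot_alg J) D /\
               canonical_comult DL J D)
  /\
  (homogeneous J ->
     (exists D, hopf_dual_algebra (Nproj J) (quot_alg J) D /\
                canonical_comult DL J D) ->
     hopf_ideal DL J).
Proof.
split; first by move=> hJ; exists (quot_comult J); exact: quot_hopf.
by move=> homJ [D [hD cD]]; exact: (homogeneous_hopf_ideal DLP idealJ homJ hD cD).
Qed.
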